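(* In the algebra $\mathrm{SLF}(\bar U_q)$ the following identities hold: \begin{align*} &\chi^+_2G_1 = [2]G_2, \\ &\chi^+_2G_s = \frac{[s-1]}{[s]}G_{s-1} + \frac{[s+1]}{[s]}G_{s+1} \quad\text{for } 2 \leq s \leq p-2,\\ &\chi^+_2G_{p-1} = [2]G_{p-2}, \\ &\chi^-_1G_s = -G_{p-s} \quad\text{for all } 1\le s\le p-1,\\ &G_sG_t = 0 \quad\text{for all } 1\le s, t\le p-1. \end{align*} Moreover, the multiplication rules in the basis $(\chi^\pm_s)_{1\le s\le p}$, $(G_s)_{1\le s\le p-1}$ of the commutative unital algebra $\mathrm{SLF}(\bar U_q)$ (with unit $\chi^+_1$) are entirely determined by these identities together with the (known) relations, for $\alpha\in\{\pm\}$, $$\chi^-_1\chi^{\alpha}_s = \chi^{-\alpha}_s \ (1\le s\le p), \qquad \chi^+_2 \chi^{\alpha}_s = \chi^{\alpha}_{s-1} + \chi^{\alpha}_{s+1}\ (2\le s\le p-1), \qquad \chi^{+}_2\chi^{\alpha}_p = 2\chi^{\alpha}_{p-1} + 2\chi^{-\alpha}_1,$$ in the sense that all products of two basis elements can be deduced from them using commutativity, associativity, bilinearity and the unit.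
   Context: Let $p\ge 2$ be an integer, $q=e^{i\pi/p}$, $[n]=\frac{q^n-q^{-n}}{q-q^{-1}}$. $\bar U_q=\bar U_q(\mathfrak{sl}(2))$ is the $2p^3$-dimensional $\mathbb{C}$-algebra generated by $E,F,K$ with relations $E^p=F^p=0$, $K^{2p}=1$, $KE=q^2EK$, $KF=q^{-2}FK$, $EF=FE+\frac{K-K^{-1}}{q-q^{-1}}$; it is a Hopf algebra with $\Delta(E)=1\otimes E+E\otimes K$, $\Delta(F)=F\otimes1+K^{-1}\otimes F$, $\Delta(K)=K\otimes K$, $\varepsilon(E)=\varepsilon(F)=0$, $\varepsilon(K)=1$, $S(E)=-EK^{-1}$, $S(F)=-KF$, $S(K)=K^{-1}$. Simple modules: for $\alpha\in\{\pm\}$ (identified with $\pm1$) and $1\le s\le p$, $\mathcal{X}^\alpha(s)$ has basis $(v_i)_{0\le i\le s-1}$ with $Kv_i=\alpha q^{s-1-2i}v_i$, $Ev_0=0$, $Ev_i=\alpha[i][s-i]v_{i-1}$ ($i\ge1$), $Fv_i=v_{i+1}$ ($i\le s-2$), $Fv_{s-1}=0$. Projective modules: for $1\le s\le p-1$, $\mathcal{P}^\alpha(s)$ (the projective cover of $\mathcal{X}^\alpha(s)$) has a standard basis $(b_i,x_j,y_k,a_l)$, $0\le i,l\le s-1$, $0\le j,k\le p-s-1$, with $Kb_i=\alpha q^{s-1-2i}b_i$, $Eb_i=\alpha[i][s-i]b_{i-1}+a_{i-1}$ ($i\ge1$), $Eb_0=x_{p-s-1}$, $Fb_i=b_{i+1}$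 ($i\le s-2$), $Fb_{s-1}=y_0$; $Kx_j=-\alpha q^{p-s-1-2j}x_j$, $Ex_j=-\alpha[j][p-s-j]x_{j-1}$ ($j\ge1$), $Ex_0=0$, $Fx_j=x_{j+1}$ ($j\le p-s-2$), $Fx_{p-s-1}=a_0$; $Ky_k=-\alpha q^{p-s-1-2k}y_k$, $Ey_k=-\alpha[k][p-s-k]y_{k-1}$ ($k\ge1$), $Ey_0=a_{s-1}$, $Fy_k=y_{k+1}$ ($k\le p-s-2$), $Fy_{p-s-1}=0$; $Ka_l=\alpha q^{s-1-2l}a_l$, $Ea_l=\alpha[l][s-l]a_{l-1}$ ($l\ge1$), $Ea_0=0$, $Fa_l=a_{l+1}$ ($l\le s-2$), $Fa_{s-1}=0$. $\mathrm{SLF}(\bar U_q)$ is the space of linear forms $\varphi$ on $\bar U_q$ with $\varphi(xy)=\varphi(yx)$; it is a commutative algebra under $(\varphi\psi)(x)=(\varphi\otimes\psi)(\Delta(x))$ with unit $\varepsilon=\chi^+_1$. Define $\chi^\alpha_s(x)=\mathrm{tr}(x|_{\mathcal{X}^\alpha(s)})$ for $1\le s\le p$. For $1\le s\le p-1$ and $x\in\bar U_q$, let $H^\alpha_s(x)$ be the $s\times s$ matrix whose $(l,i)$ entry is the coefficient of $a_l$ in $x b_i$ in the standard basis of $\mathcal{P}^\alpha(s)$, and $G_s=\mathrm{tr}(H^+_s)+\mathrm{tr}(H^-_{p-s})$. It is known that the $\chi^\pm_s$ ($1\le s\le p$) and $G_{s}$ ($1\le s\le p-1$) form a basis of $\mathrm{SLF}(\bar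 U_q)$. Convention: $G_0=G_p=0$ (relevant only for $p=2$, where $[2]=0$). *)

(* Defs.v *)
From HB Require Import structures.
From mathcomp Require Import all_boot all_order all_algebra.
From mathcomp Require Import boolp classical_sets functions reals trigo.
From mathcomp Require Import complex.

Set Implicit Arguments.
Unset Strict Implicit.
Unset Printing Implicit Defensive.

Import GRing.Theory.
Local Open Scope ring_scope.
Local Open Scope quotient_scope.

Section Presentation.
Variables (C : comNzRingType) (X : Type).

(* Formal expressions; [Cst a] stands for the scalar [a] times the unit. *)
Inductive term : Type :=
| Gen of X
| Cst of C
| Add of term & term
| Mul of term & term.

HB.instance Definition _ := gen_eqMixin term.
HB.instance Definition _ := gen_choiceMixin term.

Fixpoint tpow (t : term) (n : nat) : term :=
  if n is m.+1 then Mul t (tpow t m) else Cst 1.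

(* Equality of expressions deducible from the axioms of associative unital
   C-algebras together with the equations [r]. *)
Inductive alg_eq (r : term -> term -> Prop) : term -> term -> Prop :=
| alg_eq_rel s t of r s t : alg_eq r s t
| alg_eq_refl s : alg_eq r s s
| alg_eq_sym s t of alg_eq r s t : alg_eq r t s
| alg_eq_trans s t u of alg_eq r s t & alg_eq r t u : alg_eq r s u
| alg_eq_Add s s' t t' of alg_eq r s s' & alg_eq r t t' :
    alg_eq r (Add s t) (Add s' t')
| alg_eq_Mul s s' t t' of alg_eq r s s' & alg_eq r t t' :
    alg_eq r (Mul s t) (Mul s' t')
| alg_eq_addA s t u : alg_eq r (Add s (Add t u)) (Add (Add s t) u)
| alg_eq_addC s t : alg_eq r (Add s t) (Add t s)
| alg_eq_add0 s : alg_eq r (Add (Cst 0) s) s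
| alg_eq_addN s : alg_eq r (Add (Mul (Cst (-1)) s) s) (Cst 0)
| alg_eq_mulA s t u : alg_eq r (Mul s (Mul t u)) (Mul (Mul s t) u)
| alg_eq_mul1 s : alg_eq r (Mul (Cst 1) s) s
| alg_eq_mulDl s t u : alg_eq r (Mul (Add s t) u) (Add (Mul s u) (Mul t u))
| alg_eq_mulDr s t u : alg_eq r (Mul s (Add t u)) (Add (Mul s t) (Mul s u))
| alg_eq_CstD a b : alg_eq r (Add (Cst a) (Cst b)) (Cst (a + b))
| alg_eq_CstM a b : alg_eq r (Mul (Cst a) (Cst b)) (Cst (a * b))
| alg_eq_CstC a s : alg_eq r (Mul (Cst a) s) (Mul s (Cst a)).

Fixpoint teval (B : pzRingType) (c : C -> B) (g : X -> B) (t : term) : B :=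
  match t with
  | Gen x => g x
  | Cst a => c a
  | Add s t => teval c g s + teval c g t
  | Mul s t => teval c g s * teval c g t
  end.

Section Quotient.
Variable r : term -> term -> Prop.

Definition alg_eqb : rel term := fun s t => `[< alg_eq r s t >].

Lemma alg_eqb_refl : reflexive alg_eqb.
Proof. by move=> s; apply/asboolP/alg_eq_refl. Qed.

Lemma alg_eqb_sym : symmetric alg_eqb.
Proof. by move=> s t; apply/asboolP/asboolP => /alg_eq_sym. Qed.

Lemma alg_eqb_trans : transitive alg_eqb.
Proof.
by move=> t s u /asboolP st /asboolP tu; apply/asboolP/(alg_eq_trans st tu).
Qed.

Canonical alg_equiv := EquivRel alg_eqb alg_eqb_refl alg_eqb_sym alg_eqb_trans.

(* The C-algebra with generators [X] and defining relations [r]. *)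
Definition palg : Type := {eq_quot alg_equiv}.

HB.instance Definition _ := Choice.on palg.
HB.instance Definition _ := EqQuotient.on palg.

Definition pcls (t : term) : palg := \pi_palg t.

Lemma palgP s t : pcls s = pcls t <-> alg_eq r s t.
Proof. by split=> [/eqquotP/asboolP|?] //; apply/eqquotP/asboolP. Qed.

Lemma pcls_repr u : pcls (repr u) = u.
Proof. exact: reprK. Qed.

Lemma alg_eq_repr t : alg_eq r (repr (pcls t)) t.
Proof. by apply/palgP; rewrite pcls_repr. Qed.

Definition padd (u v : palg) := pcls (Add (repr u) (repr v)).
Definition pmul (u v : palg) := pcls (Mul (repr u) (repr v)).
Definition pscale (a : C) (u : palg) := pcls (Mul (Cst a) (repr u)).
Definition popp (u : palg) := pscale (-1) u.

Lemma paddE s t : padd (pcls s) (pcls t) = pcls (Add s t).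
Proof. by apply/palgP; apply: alg_eq_Add; apply: alg_eq_repr. Qed.

Lemma pmulE s t : pmul (pcls s) (pcls t) = pcls (Mul s t).
Proof. by apply/palgP; apply: alg_eq_Mul; apply: alg_eq_repr. Qed.

Lemma pscaleE a t : pscale a (pcls t) = pcls (Mul (Cst a) t).
Proof.
by apply/palgP; apply: alg_eq_Mul; [apply: alg_eq_refl | apply: alg_eq_repr].
Qed.

Lemma palg_ind (P : palg -> Prop) : (forall t, P (pcls t)) -> forall u, P u.
Proof. by move=> PP u; rewrite -[u]pcls_repr. Qed.

Lemma paddA : associative padd.
Proof.
elim/palg_ind=> s; elim/palg_ind=> t; elim/palg_ind=> u.
by rewrite !paddE; apply/palgP/alg_eq_addA.
Qed.

Lemma paddC : commutative padd.
Proof.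
by elim/palg_ind=> s; elim/palg_ind=> t; rewrite !paddE; apply/palgP/alg_eq_addC.
Qed.

Lemma padd0 : left_id (pcls (Cst 0)) padd.
Proof. by elim/palg_ind=> s; rewrite paddE; apply/palgP/alg_eq_add0. Qed.

Lemma paddN : left_inverse (pcls (Cst 0)) popp padd.
Proof.
by elim/palg_ind=> s; rewrite /popp pscaleE paddE; apply/palgP/alg_eq_addN.
Qed.

HB.instance Definition _ := GRing.isZmodule.Build palg paddA paddC padd0 paddN.

Lemma pmulA : associative pmul.
Proof.
elim/palg_ind=> s; elim/palg_ind=> t; elim/palg_ind=> u.
by rewrite !pmulE; apply/palgP/alg_eq_mulA.
Qed.

Lemma pmul1l : left_id (pcls (Cst 1)) pmul.
Proof. by elim/palg_ind=> s; rewrite pmulE; apply/palgP/alg_eq_mul1. Qed.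

Lemma pmul1r : right_id (pcls (Cst 1)) pmul.
Proof.
elim/palg_ind=> s; rewrite pmulE; apply/palgP.
exact: alg_eq_trans (alg_eq_sym (alg_eq_CstC _ _ _)) (alg_eq_mul1 _ _).
Qed.

Lemma pmulDl : left_distributive pmul +%R.
Proof.
elim/palg_ind=> s; elim/palg_ind=> t; elim/palg_ind=> u.
rewrite /GRing.add /= !(paddE, pmulE); exact/palgP/alg_eq_mulDl.
Qed.

Lemma pmulDr : right_distributive pmul +%R.
Proof.
elim/palg_ind=> s; elim/palg_ind=> t; elim/palg_ind=> u.
rewrite /GRing.add /= !(paddE, pmulE); exact/palgP/alg_eq_mulDr.
Qed.

HB.instance Definition _ :=
  GRing.Zmodule_isPzRing.Build palg pmulA pmul1l pmul1r pmulDl pmulDr.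

Lemma pscaleM a u : pscale a u = pcls (Cst a) * u.
Proof. by elim/palg_ind: u => s; rewrite pscaleE -pmulE. Qed.

Lemma pscaleA a b u : pscale a (pscale b u) = pscale (a * b) u.
Proof.
rewrite !pscaleM mulrA; congr (_ * _); rewrite /GRing.mul /= pmulE.
exact/palgP/alg_eq_CstM.
Qed.

Lemma pscale1 : left_id 1 pscale.
Proof. by move=> u; rewrite pscaleM mul1r. Qed.

Lemma pscaleDr : right_distributive pscale +%R.
Proof. by move=> a u v; rewrite !pscaleM mulrDr. Qed.

Lemma pscaleDl u : {morph pscale^~ u : a b / a + b}.
Proof.
move=> a b; rewrite !pscaleM -mulrDl; congr (_ * _).
by rewrite /GRing.add /= paddE; apply/palgP/alg_eq_sym/alg_eq_CstD.
Qed.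

HB.instance Definition _ :=
  GRing.Zmodule_isLmodule.Build C palg pscaleA pscale1 pscaleDr pscaleDl.

Lemma palg_scalerAl (a : C) (u v : palg) : a *: (u * v) = (a *: u) * v.
Proof. by rewrite /GRing.scale /= !pscaleM mulrA. Qed.

Lemma palg_scalerAr (a : C) (u v : palg) : a *: (u * v) = u * (a *: v).
Proof.
rewrite /GRing.scale /= !pscaleM !mulrA; congr (_ * _).
elim/palg_ind: u => s; rewrite /GRing.mul /= !pmulE.
exact/palgP/alg_eq_CstC.
Qed.

(* The algebra morphism from [palg] to [B] extending [g] (with structure map
   [c]); it is well defined as soon as [g] satisfies the relations [r]. *)
Definition palg_eval (B : pzRingType) (c : C -> B) (g : X -> B) (u : palg) : B :=
  teval c g (repr u).

Lemma palg_evalE (B : pzRingType) (c : {rmorphism C -> B}) (g : X -> B) :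
  (forall a b, GRing.comm (c a) b) ->
  (forall s t, r s t -> teval c g s = teval c g t) ->
  forall t, palg_eval c g (pcls t) = teval c g t.
Proof.
move=> cC gr; have ev s t : alg_eq r s t -> teval c g s = teval c g t.
  elim=> //=.
  - by move=> ? ? ? _ -> _ ->.
  - by move=> ? ? ? ? _ -> _ ->.
  - by move=> ? ? ? ? _ -> _ ->.
  - by move=> *; rewrite addrA.
  - by move=> *; rewrite addrC.
  - by move=> *; rewrite rmorph0 add0r.
  - by move=> *; rewrite rmorphN1 mulN1r addNr rmorph0.
  - by move=> *; rewrite mulrA.
  - by move=> *; rewrite rmorph1 mul1r.
  - by move=> *; rewrite mulrDl.
  - by move=> *; rewrite mulrDr.
  - by move=> *; rewrite rmorphD.
  - by move=> *; rewrite rmorphM.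
  - by move=> *; apply: cC.
by move=> t; apply/ev/alg_eq_repr.
Qed.

End Quotient.
End Presentation.

Arguments Gen {C X}.
Arguments Cst {C X}.

Section Tensor.
Variables (C : comNzRingType) (A B : lmodType C).

Definition bilin (V : lmodType C) (f : A -> B -> V) : Prop :=
  (forall b, linear (f^~ b)) /\ (forall a, linear (f a)).

Definition fsum (V : lmodType C) (f : A -> B -> V) (s : seq (A * B)) : V :=
  \sum_(ab <- s) f ab.1 ab.2.

(* [A (x) B] is the quotient of the formal sums of pairs [(a, b)] by the
   relations satisfied by their images under all bilinear maps. *)
Definition tens_eqb : rel (seq (A * B)) := fun s t =>
  `[< forall (V : lmodType C) (f : A -> B -> V), bilin f -> fsum f s = fsum f t >].

Lemma tens_eqb_refl : reflexive tens_eqb.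
Proof. by move=> s; apply/asboolP. Qed.

Lemma tens_eqb_sym : symmetric tens_eqb.
Proof. by move=> s t; apply/asboolP/asboolP => st V f bf; rewrite st. Qed.

Lemma tens_eqb_trans : transitive tens_eqb.
Proof.
by move=> t s u /asboolP st /asboolP tu; apply/asboolP=> V f bf; rewrite st ?tu.
Qed.

Canonical tens_equiv :=
  EquivRel tens_eqb tens_eqb_refl tens_eqb_sym tens_eqb_trans.

Definition tens : Type := {eq_quot tens_equiv}.

HB.instance Definition _ := Choice.on tens.
HB.instance Definition _ := EqQuotient.on tens.

Definition tcls (s : seq (A * B)) : tens := \pi_tens s.

Definition tpure (a : A) (b : B) : tens := tcls [:: (a, b)].

(* The linear map [a (x) b |-> f a b], for [f] bilinear. *)
Definition tens_eval (V : lmodType C) (f : A -> B -> V) (t : tens) : V :=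
  fsum f (repr t).

Lemma tensP s t :
  tcls s = tcls t <->
  forall (V : lmodType C) (f : A -> B -> V), bilin f -> fsum f s = fsum f t.
Proof. by split=> [/eqquotP/asboolP|?] //; apply/eqquotP/asboolP. Qed.

Lemma tcls_repr t : tcls (repr t) = t.
Proof. exact: reprK. Qed.

Lemma tens_evalE (V : lmodType C) (f : A -> B -> V) s :
  bilin f -> tens_eval f (tcls s) = fsum f s.
Proof.
move=> bf; rewrite /tens_eval.
by have /tensP/(_ V f bf) -> : tcls (repr (tcls s)) = tcls s by exact: tcls_repr.
Qed.

Lemma tens_ind (P : tens -> Prop) : (forall s, P (tcls s)) -> forall t, P t.
Proof. by move=> PP t; rewrite -[t]tcls_repr. Qed.

Definition fscale (a : C) (s : seq (A * B)) := [seq (a *: ab.1, ab.2) | ab <- s].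

Definition tadd (s t : tens) := tcls (repr s ++ repr t).
Definition tscale (a : C) (t : tens) := tcls (fscale a (repr t)).
Definition topp (t : tens) := tscale (-1) t.

Lemma fsum_cat (V : lmodType C) (f : A -> B -> V) s t :
  fsum f (s ++ t) = fsum f s + fsum f t.
Proof. exact: big_cat. Qed.

Lemma bilinZl (V : lmodType C) (f : A -> B -> V) a x y :
  bilin f -> f (a *: x) y = a *: f x y.
Proof.
case=> fl _; have f0 : f 0 y = 0.
  by have /= := fl y (-1) 0 0; rewrite scaler0 addr0 scaleN1r addNr.
by have /= := fl y a x 0; rewrite f0 !addr0.
Qed.

Lemma fsum_scale (V : lmodType C) (f : A -> B -> V) a s :
  bilin f -> fsum f (fscale a s) = a *: fsum f s.
Proof.
move=> bf; rewrite /fsum /fscale big_map scaler_sumr.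
by apply: eq_bigr => -[x y] _; rewrite bilinZl.
Qed.

Lemma fsum_repr (V : lmodType C) (f : A -> B -> V) s :
  bilin f -> fsum f (repr (tcls s)) = fsum f s.
Proof. exact: tens_evalE. Qed.

Lemma taddE s t : tadd (tcls s) (tcls t) = tcls (s ++ t).
Proof. by apply/tensP=> V f bf; rewrite !fsum_cat !fsum_repr. Qed.

Lemma tscaleE a s : tscale a (tcls s) = tcls (fscale a s).
Proof. by apply/tensP=> V f bf; rewrite !fsum_scale ?fsum_repr. Qed.

Lemma taddA : associative tadd.
Proof.
elim/tens_ind=> s; elim/tens_ind=> t; elim/tens_ind=> u.
by rewrite !taddE catA.
Qed.

Lemma taddC : commutative tadd.
Proof.
elim/tens_ind=> s; elim/tens_ind=> t; rewrite !taddE.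
by apply/tensP=> V f bf; rewrite !fsum_cat addrC.
Qed.

Lemma tadd0 : left_id (tcls [::]) tadd.
Proof. by elim/tens_ind=> s; rewrite taddE. Qed.

Lemma taddN : left_inverse (tcls [::]) topp tadd.
Proof.
elim/tens_ind=> s; rewrite /topp tscaleE taddE.
apply/tensP=> V f bf; rewrite fsum_cat fsum_scale // scaleN1r addNr.
by rewrite /fsum big_nil.
Qed.

HB.instance Definition _ := GRing.isZmodule.Build tens taddA taddC tadd0 taddN.

Lemma tscaleA a b t : tscale a (tscale b t) = tscale (a * b) t.
Proof.
elim/tens_ind: t => s; rewrite !tscaleE; apply/tensP=> V f bf.
by rewrite !fsum_scale // scalerA.
Qed.

Lemma tscale1 : left_id 1 tscale.
Proof.
elim/tens_ind=> s; rewrite tscaleE; apply/tensP=> V f bf.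
by rewrite fsum_scale // scale1r.
Qed.

Lemma tscaleDr : right_distributive tscale +%R.
Proof.
move=> a; elim/tens_ind=> s; elim/tens_ind=> t.
rewrite /GRing.add /= !(taddE, tscaleE); apply/tensP=> V f bf.
by rewrite fsum_cat !fsum_scale // fsum_cat scalerDr.
Qed.

Lemma tscaleDl t : {morph tscale^~ t : a b / a + b}.
Proof.
elim/tens_ind: t => s a b; rewrite /GRing.add /= !(taddE, tscaleE).
by apply/tensP=> V f bf; rewrite fsum_cat !fsum_scale // scalerDl.
Qed.

HB.instance Definition _ :=
  GRing.Zmodule_isLmodule.Build C tens tscaleA tscale1 tscaleDr tscaleDl.

End Tensor.

(* The tensor product of two algebras, with
   [(a (x) b) (a' (x) b') = a a' (x) b b'] *)
Section TensorAlgebra.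
Variables (C : comNzRingType) (X Y : Type).
Variables (r : term C X -> term C X -> Prop) (r' : term C Y -> term C Y -> Prop).
Local Notation A := (palg r).
Local Notation B := (palg r').
Local Notation T := (tens A B).

Definition fmul (s t : seq (A * B)) : seq (A * B) :=
  [seq (ab.1 * cd.1, ab.2 * cd.2) | ab <- s, cd <- t].

Definition tmul (s t : T) : T := tcls (fmul (repr s) (repr t)).

Lemma fsum_mul (V : lmodType C) (f : A -> B -> V) s t :
  fsum f (fmul s t) =
  fsum (fun (a : A) (b : B) => fsum (fun (c : A) (d : B) => f (a * c) (b * d)) t) s.
Proof.
by rewrite /fsum /fmul big_allpairs_dep.
Qed.

Lemma fsum_mulC (V : lmodType C) (f : A -> B -> V) s t :
  fsum f (fmul s t) =
  fsum (fun (c : A) (d : B) => fsum (fun (a : A) (b : B) => f (a * c) (b * d)) s) t.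
Proof. by rewrite fsum_mul /fsum exchange_big. Qed.

Lemma bilin_mulr (V : lmodType C) (f : A -> B -> V) t :
  bilin f -> bilin (fun (a : A) (b : B) => fsum (fun (c : A) (d : B) => f (a * c) (b * d)) t).
Proof.
move=> [fl fr]; split=> [b a x y|a a' x y]; rewrite /fsum scaler_sumr -big_split;
  apply: eq_bigr => -[c d] _ /=.
- by rewrite mulrDl -palg_scalerAl fl.
- by rewrite mulrDl -palg_scalerAl fr.
Qed.

Lemma bilin_mull (V : lmodType C) (f : A -> B -> V) s :
  bilin f -> bilin (fun (c : A) (d : B) => fsum (fun (a : A) (b : B) => f (a * c) (b * d)) s).
Proof.
move=> [fl fr]; split=> [b a x y|a a' x y]; rewrite /fsum scaler_sumr -big_split;
  apply: eq_bigr => -[c d] _ /=.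
- by rewrite mulrDr -palg_scalerAr fl.
- by rewrite mulrDr -palg_scalerAr fr.
Qed.

Lemma tmulE s t : tmul (tcls s) (tcls t) = tcls (fmul s t).
Proof.
apply/tensP=> V f bf.
rewrite fsum_mul (fsum_repr _ (bilin_mulr _ bf)) -fsum_mul.
by rewrite fsum_mulC (fsum_repr _ (bilin_mull _ bf)) -fsum_mulC.
Qed.

Lemma tmulA : associative tmul.
Proof.
elim/tens_ind=> s; elim/tens_ind=> t; elim/tens_ind=> u.
rewrite !tmulE; apply/tensP=> V f bf; rewrite !fsum_mul.
apply: eq_bigr => ab _; rewrite fsum_mul; apply: eq_bigr => cd _.
by apply: eq_bigr => xy _; rewrite !mulrA.
Qed.

Lemma tmul1l : left_id (tpure (1 : A) (1 : B)) tmul.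
Proof.
elim/tens_ind=> s; rewrite tmulE /fmul /= cats0; congr (tcls _).
by rewrite -[RHS]map_id; apply: eq_map => -[x y] /=; rewrite !mul1r.
Qed.

Lemma tmul1r : right_id (tpure (1 : A) (1 : B)) tmul.
Proof.
elim/tens_ind=> s; rewrite tmulE; congr (tcls _).
by rewrite /fmul; elim: s => //= -[x y] s ->; rewrite !mulr1.
Qed.

Lemma tmulDl : left_distributive tmul +%R.
Proof.
elim/tens_ind=> s; elim/tens_ind=> t; elim/tens_ind=> u.
rewrite /GRing.add /= !(taddE, tmulE); apply/tensP=> V f bf.
by rewrite fsum_mul !fsum_cat -!fsum_mul.
Qed.

Lemma tmulDr : right_distributive tmul +%R.
Proof.
elim/tens_ind=> s; elim/tens_ind=> t; elim/tens_ind=> u.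
rewrite /GRing.add /= !(taddE, tmulE); apply/tensP=> V f bf.
by rewrite fsum_mulC !fsum_cat -!fsum_mulC.
Qed.

HB.instance Definition _ :=
  GRing.Zmodule_isPzRing.Build T tmulA tmul1l tmul1r tmulDl tmulDr.

End TensorAlgebra.

Inductive uq_gen : Type := genE | genF | genK.

Section RestrictedQuantumGroup.
Variables (R : realType) (p : nat).
Local Notation C := R[i].

(* [e ^ (i pi / p)] *)
Definition qpar : C := Complex (cos (pi / p%:R)) (sin (pi / p%:R)).

Definition qint (n : nat) : C := (qpar ^+ n - qpar ^- n) / (qpar - qpar^-1).

(* Since [K ^ (2p) = 1], the inverse of [K] is [K ^ (2p - 1)]. *)
Inductive uq_rel : term C uq_gen -> term C uq_gen -> Prop :=
| uq_relEp : uq_rel (tpow (Gen genE) p) (Cst 0)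
| uq_relFp : uq_rel (tpow (Gen genF) p) (Cst 0)
| uq_relKp : uq_rel (tpow (Gen genK) (2 * p)) (Cst 1)
| uq_relKE : uq_rel (Mul (Gen genK) (Gen genE))
               (Mul (Cst (qpar ^+ 2)) (Mul (Gen genE) (Gen genK)))
| uq_relKF : uq_rel (Mul (Gen genK) (Gen genF))
               (Mul (Cst (qpar ^- 2)) (Mul (Gen genF) (Gen genK)))
| uq_relEF : uq_rel (Mul (Gen genE) (Gen genF))
               (Add (Mul (Gen genF) (Gen genE))
                  (Mul (Cst (qpar - qpar^-1)^-1)
                     (Add (Gen genK)
                        (Mul (Cst (-1)) (tpow (Gen genK) (2 * p).-1))))).

Local Notation Uq := (palg uq_rel).

Definition uqE : Uq := pcls uq_rel (Gen genE).
Definition uqF : Uq := pcls uq_rel (Gen genF).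
Definition uqK : Uq := pcls uq_rel (Gen genK).

Definition uqDelta : Uq -> tens Uq Uq :=
  palg_eval (B := tens Uq Uq) (fun a : C => a *: tpure (1 : Uq) (1 : Uq)) (fun g =>
    match g with
    | genE => tpure (1 : Uq) uqE + tpure uqE uqK
    | genF => tpure uqF (1 : Uq) + tpure (uqK ^+ (2 * p).-1) uqF
    | genK => tpure uqK uqK
    end).

(* A module with a chosen basis is given by the matrices of [E], [F], [K], the
   [j]-th column holding the coordinates of the image of the [j]-th basis
   vector. Signs are Booleans, [false] being [+]. *)

Definition sgn (a : bool) : C := (-1) ^+ a.

Definition simpleE (a : bool) (s : nat) : 'M[C]_s :=
  \matrix_(i, j) (if i.+1 == j :> nat then sgn a * qint j * qint (s - j) else 0).

Definition simpleF (s : nat) : 'M[C]_s :=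
  \matrix_(i, j) (i == j.+1 :> nat)%:R.

Definition simpleK (a : bool) (s : nat) : 'M[C]_s :=
  \matrix_(i, j) (if i == j
                  then sgn a * qpar ^ (s%:Z - 1 - 2 * (j : nat)%:Z) else 0).

Definition simple_rep (a : bool) (s : nat) : Uq -> 'M[C]_s :=
  palg_eval (@scalar_mx C s) (fun g =>
    match g with
    | genE => simpleE a s
    | genF => simpleF s
    | genK => simpleK a s
    end).

Definition single_mx (m n k l : nat) : 'M[C]_(m, n) :=
  \matrix_(i, j) ((i == k :> nat) && (j == l :> nat))%:R.

(* Blocks in the order (b, x, y, a) of the standard basis; the diagonal blocks
   are the simple modules of sign [a] (for b and a) and of the opposite sign
   (for x and y), and the other blocks are the extra terms
   [E b_0 = x_(p-s-1)], [E b_i = ... + a_(i-1)], [E y_0 = a_(s-1)],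
   [F b_(s-1) = y_0] and [F x_(p-s-1) = a_0]. *)
Definition projE (a : bool) (s : nat) : 'M[C]_(s + (p - s) + ((p - s) + s)) :=
  block_mx
    (block_mx (simpleE a s)                       0
              (single_mx (p - s) s (p - s).-1 0)    (simpleE (~~ a) (p - s)))
    0
    (block_mx 0                                   0
              (\matrix_(l, i) (l.+1 == i :> nat)%:R) 0)
    (block_mx (simpleE (~~ a) (p - s))            0
              (single_mx s (p - s) s.-1 0)          (simpleE a s)).

Definition projF (s : nat) : 'M[C]_(s + (p - s) + ((p - s) + s)) :=
  block_mx
    (block_mx (simpleF s) 0
              0           (simpleF (p - s)))
    0
    (block_mx (single_mx (p - s) s 0 s.-1) 0
              0                          (single_mx s (p - s) 0 (p - s).-1))
    (block_mx (simpleF (p - s)) 0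
              0                 (simpleF s)).

Definition projK (a : bool) (s : nat) : 'M[C]_(s + (p - s) + ((p - s) + s)) :=
  block_mx
    (block_mx (simpleK a s) 0 0 (simpleK (~~ a) (p - s)))
    0
    0
    (block_mx (simpleK (~~ a) (p - s)) 0 0 (simpleK a s)).

Definition proj_rep (a : bool) (s : nat) :
    Uq -> 'M[C]_(s + (p - s) + ((p - s) + s)) :=
  palg_eval (@scalar_mx C _) (fun g =>
    match g with
    | genE => projE a s
    | genF => projF s
    | genK => projK a s
    end).

Definition SLF (phi : Uq -> C^o) : Prop :=
  linear phi /\ forall x y, phi (x * y) = phi (y * x).

Definition slf_mul (phi psi : Uq -> C^o) : Uq -> C^o :=
  fun x => tens_eval (fun a b : Uq => phi a * psi b : C^o) (uqDelta x).

Definition chi (a : bool) (s : nat) : Uq -> C^o := fun x => \tr (simple_rep a s x).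

(* The block of rows a and columns b. *)
Definition Hmx (a : bool) (s : nat) (x : Uq) : 'M[C]_s :=
  dlsubmx (dlsubmx (proj_rep a s x)).

(* The value 0 outside the range is the convention [G_0 = G_p = 0]. *)
Definition Gform (s : nat) : Uq -> C^o :=
  if (0 < s < p)%N then fun x => \tr (Hmx false s x) + \tr (Hmx true (p - s) x)
  else 0.

(* Symbols for the forms [chi a s] and [Gform s]. *)
Definition slf_gen : Type := ((bool * nat) + nat)%type.

Definition slf_basis : seq slf_gen :=
  [seq inl (a, s) | a <- [:: false; true], s <- iota 1 p] ++
  [seq inr s | s <- iota 1 p.-1].

Definition slf_elt (g : slf_gen) : Uq -> C^o :=
  match g with inl (a, s) => chi a s | inr s => Gform s end.

Definition tchi (a : bool) (s : nat) : term C slf_gen := Gen (inl (a, s)).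

Definition tG (s : nat) : term C slf_gen :=
  if (0 < s < p)%N then Gen (inr s) else Cst 0.

(* Associativity and bilinearity are built in [alg_eq]. *)
Inductive slf_rule : term C slf_gen -> term C slf_gen -> Prop :=
| slf_comm t u : slf_rule (Mul t u) (Mul u t)
| slf_unit : slf_rule (tchi false 1) (Cst 1)
| slf_chi2_G1 :
    slf_rule (Mul (tchi false 2) (tG 1)) (Mul (Cst (qint 2)) (tG 2))
| slf_chi2_G s of (2 <= s <= p - 2)%N :
    slf_rule (Mul (tchi false 2) (tG s))
      (Add (Mul (Cst (qint s.-1 / qint s)) (tG s.-1))
           (Mul (Cst (qint s.+1 / qint s)) (tG s.+1)))
| slf_chi2_Gp :
    slf_rule (Mul (tchi false 2) (tG p.-1)) (Mul (Cst (qint 2)) (tG (p - 2)))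
| slf_chi1_G s of (1 <= s <= p.-1)%N :
    slf_rule (Mul (tchi true 1) (tG s)) (Mul (Cst (-1)) (tG (p - s)))
| slf_GG s t of (1 <= s <= p.-1)%N & (1 <= t <= p.-1)%N :
    slf_rule (Mul (tG s) (tG t)) (Cst 0)
| slf_chi1_chi a s of (1 <= s <= p)%N :
    slf_rule (Mul (tchi true 1) (tchi a s)) (tchi (~~ a) s)
| slf_chi2_chi a s of (2 <= s <= p.-1)%N :
    slf_rule (Mul (tchi false 2) (tchi a s)) (Add (tchi a s.-1) (tchi a s.+1))
| slf_chi2_chip a :
    slf_rule (Mul (tchi false 2) (tchi a p))
      (Add (Mul (Cst 2) (tchi a p.-1)) (Mul (Cst 2) (tchi (~~ a) 1))).

Definition slf_deducible : term C slf_gen -> term C slf_gen -> Prop :=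
  alg_eq slf_rule.

End RestrictedQuantumGroup.

Arguments qint R p n : clear implicits.
Arguments SLF {R p} phi.
Arguments slf_mul {R p} phi psi x.
Arguments chi R p a s x : clear implicits.
Arguments Gform R p s x : clear implicits.
Arguments slf_elt R p g x : clear implicits.
Arguments slf_deducible R p t u : clear implicits.

(* Main.v *)
(* A symmetric linear form vanishes on the monomials of nonzero K-weight, so it
   is determined by its values at c^n K^j, n < p, where c is the Casimir
   element. On the tensor product with the 2-dimensional simple module c
   satisfies a quadratic equation, which expresses the values of chi^+_2 f
   through those of f; comparing with the explicit values of chi^+-_s and G_s
   gives the products by chi^+_2 (and similarly those by chi^-_1). Commutativity
   comes from the involution E <-> F, K <-> K^-1: it reverses the coproduct and
   fixes all chi^+-_s and G_s.

   Let zeta_s = chi^+_s + chi^-_(p-s). The fusion rules imply that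
   zeta_a zeta_b depends only on the parities of a and b, and zeta_a G_b = 0.
   When s runs through the integers of a fixed parity, x acts through a
   polynomial P with zeta_s(x) = P(c_s) and G_s(x) = theta P'(c_s), where
   c_s = q^s + q^-s. The coproduct of c^n K^j thus yields a bivariate polynomial
   of total degree at most n < p, which is constant on a grid and stationary at
   its points in each variable; this forces its mixed derivatives there, which
   are the values of G_s G_t, to vanish.

   Since chi^+_s is a polynomial in chi^+_2 and chi^-_s = chi^-_1 chi^+_s, all
   the other products follow. *)

Require Import Defs.
From HB Require Import structures.
From mathcomp Require Import all_boot all_order all_algebra.
From mathcomp Require Import boolp functions reals trigo.
From mathcomp Require Import complex separable ring zify.

Set Implicit Arguments.
Unset Strict Implicit.
Unset Printing Implicit Defensive.

Import GRing.Theory Order.TTheory Num.Theory.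
Local Open Scope ring_scope.

(** * Presented algebras, tensor products, and the q-binomial formula *)

(** The algebra is given by a presentation, so the proof works with spanning monomials and explicit
    values. Elements are rewritten as combinations of $c^aK^lE^w$ and $c^aK^lF^w$, and $E^p=0$ turns
    $F^pE^p$ into an equation of degree $p$ for $c$: hence the bound $n<p$. The same $p$ is the
    number of conditions, counted with multiplicity, that the Casimir values of one parity impose on
    a polynomial, so the vanishing of $G_sG_t$ is obtained exactly at this limit. Associativity is
    proved for products whose first factor is the trace of a representation, by contracting the
    first leg of the coproduct with matrix coefficients; this avoids triple tensor products. The
    derivative in the values of $G_s$ comes from the projective modules, where $c$ acts as a scalar
    plus $\theta$ times the nilpotent map $b_i\mapsto a_i$. For deducibility, every computation runs
    both among the forms and in the algebra presented by the rules, with one coefficient vector for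
    both. *)

Section PresentedAlgebra.
Variables (C : comNzRingType) (X : Type) (r : term C X -> term C X -> Prop).
Implicit Types (u v : palg r).

Lemma pcls_Add s t : pcls r (Add s t) = pcls r s + pcls r t.
Proof. by rewrite /GRing.add /= paddE. Qed.

Lemma pcls_Mul s t : pcls r (Mul s t) = pcls r s * pcls r t.
Proof. by rewrite /GRing.mul /= pmulE. Qed.

Lemma pcls_Cst a : pcls r (Cst a) = a *: (1 : palg r).
Proof.
by rewrite -[LHS]mulr1 [RHS]pscaleM.
Qed.

Lemma pcls_CstM a t : pcls r (Mul (Cst a) t) = a *: pcls r t.
Proof. by rewrite pcls_Mul [RHS]pscaleM. Qed.

Lemma pcls_tpow t n : pcls r (tpow t n) = pcls r t ^+ n.
Proof.
by elim: n => [|n IH]; rewrite ?expr0 ?exprS ?pcls_Mul /= ?pcls_Mul ?IH.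
Qed.

Lemma palg_gen_ind (P : palg r -> Prop) :
  (forall x, P (pcls r (Gen x))) -> (forall a : C, P (a *: (1 : palg r))) ->
  (forall u v, P u -> P v -> P (u + v)) ->
  (forall u v, P u -> P v -> P (u * v)) -> forall u, P u.
Proof.
move=> Pg Pc PD PM; elim/palg_ind; elim=> [x|a|s Ps t Pt|s Ps t Pt].
- exact: Pg.
- by rewrite pcls_Cst.
- by rewrite pcls_Add; apply: PD.
- by rewrite pcls_Mul; apply: PM.
Qed.

Section Eval.
Variables (B : pzRingType) (c : {rmorphism C -> B}) (g : X -> B).
Hypothesis c_comm : forall a b, GRing.comm (c a) b.
Hypothesis g_rel : forall s t, r s t -> teval c g s = teval c g t.
Local Notation ev := (@palg_eval C X r B c g).

Lemma palg_eval_gen x : ev (pcls r (Gen x)) = g x.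
Proof. by rewrite palg_evalE. Qed.

Lemma palg_evalD : {morph ev : u v / u + v}.
Proof.
by elim/palg_ind=> s; elim/palg_ind=> t; rewrite -pcls_Add !palg_evalE.
Qed.

Lemma palg_evalM : {morph ev : u v / u * v}.
Proof.
by elim/palg_ind=> s; elim/palg_ind=> t; rewrite -pcls_Mul !palg_evalE.
Qed.

Lemma palg_evalZ a u : ev (a *: u) = c a * ev u.
Proof. by elim/palg_ind: u => s; rewrite -pcls_CstM !palg_evalE. Qed.

Lemma palg_eval1 : ev 1 = 1.
Proof. by rewrite [LHS](palg_evalE c_comm g_rel (Cst 1)) /= rmorph1. Qed.

End Eval.

Lemma palg_scaleAl a u v : a *: (u * v) = (a *: u) * v.
Proof. exact: palg_scalerAl. Qed.

Lemma palg_scaleAr a u v : a *: (u * v) = u * (a *: v).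
Proof. exact: palg_scalerAr. Qed.

(** The structure map, bundled as a ring morphism for the evaluation lemmas when the target is a
    presented algebra, as for [omega]. *)
Definition palg_cst (a : C) : palg r := a *: (1 : palg r).

Lemma palg_cst_zmod : zmod_morphism palg_cst.
Proof. by move=> a b; rewrite /palg_cst scalerBl. Qed.

Lemma palg_cst_mul : monoid_morphism palg_cst.
Proof.
by split=> [|a b]; rewrite /palg_cst ?scale1r // -palg_scaleAl mul1r scalerA.
Qed.

HB.instance Definition _ :=
  GRing.isZmodMorphism.Build C (palg r) palg_cst palg_cst_zmod.
HB.instance Definition _ :=
  GRing.isMonoidMorphism.Build C (palg r) palg_cst palg_cst_mul.

Lemma palg_cst_comm a u : GRing.comm (palg_cst a) u.
Proof. by rewrite /GRing.comm /palg_cst -palg_scaleAl -palg_scaleAr mul1r mulr1. Qed.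

End PresentedAlgebra.

Section LinearForms.
Variables (C : comNzRingType) (V W : lmodType C) (f : V -> W).
Hypothesis lf : linear f.

Lemma lin0 : f 0 = 0.
Proof. by have := lf (-1) 0 0; rewrite scaler0 addr0 scaleN1r addNr. Qed.

Lemma linD u v : f (u + v) = f u + f v.
Proof. by have := lf 1 u v; rewrite !scale1r. Qed.

Lemma linZ a u : f (a *: u) = a *: f u.
Proof. by have := lf a u 0; rewrite lin0 !addr0. Qed.

Lemma linB u v : f (u - v) = f u - f v.
Proof. by rewrite -scaleN1r linD linZ scaleN1r. Qed.

Lemma lin_sum I (r : seq I) P (F : I -> V) :
  f (\sum_(i <- r | P i) F i) = \sum_(i <- r | P i) f (F i).
Proof. exact: (big_morph f linD lin0). Qed.

End LinearForms.

Section TensorTheory.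
Variables (C : comNzRingType) (A B : lmodType C).
Implicit Types (a : A) (b : B).

Lemma tpureDl a a' b : tpure (a + a') b = tpure a b + tpure a' b.
Proof.
rewrite [RHS]taddE; apply/tensP => V f [fl fr].
rewrite /fsum /= !big_cons !big_nil !addr0 /=.
by have := fl b 1 a a'; rewrite !scale1r.
Qed.

Lemma tpureDr a b b' : tpure a (b + b') = tpure a b + tpure a b'.
Proof.
rewrite [RHS]taddE; apply/tensP => V f [fl fr].
rewrite /fsum /= !big_cons !big_nil !addr0 /=.
by have := fr a 1 b b'; rewrite !scale1r.
Qed.

Lemma tpureZl (k : C) a b : tpure (k *: a) b = k *: tpure a b.
Proof. by rewrite [RHS]tscaleE. Qed.

Lemma tpureZr (k : C) a b : tpure a (k *: b) = k *: tpure a b.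
Proof.
rewrite [RHS]tscaleE; apply/tensP => V f bf; have [fl fr] := bf.
rewrite fsum_scale // /fsum !big_cons !big_nil !addr0 /=.
have f0 : f a 0 = 0.
  by have := fr a (-1) 0 0; rewrite scaler0 addr0 scaleN1r addNr.
by have := fr a k b 0; rewrite f0 !addr0.
Qed.

Variables (V : lmodType C) (f : A -> B -> V).
Hypothesis bf : bilin f.

Lemma tens_eval_pure a b : tens_eval f (tpure a b) = f a b.
Proof. by rewrite tens_evalE // /fsum big_cons big_nil addr0. Qed.

Lemma tens_evalD : {morph tens_eval f : s t / s + t}.
Proof.
elim/tens_ind=> s; elim/tens_ind=> t.
by rewrite {1}/GRing.add /= taddE !tens_evalE // fsum_cat.
Qed.

Lemma tens_evalZ (k : C) t : tens_eval f (k *: t) = k *: tens_eval f t.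
Proof.
elim/tens_ind: t => s.
by rewrite {1}/GRing.scale /= tscaleE !tens_evalE // fsum_scale.
Qed.

End TensorTheory.

Lemma tens_pure_ind (C : comNzRingType) (A B : lmodType C) (P : tens A B -> Prop) :
  P 0 -> (forall s t, P s -> P t -> P (s + t)) ->
  (forall a b, P (tpure a b)) -> forall t, P t.
Proof.
move=> P0 PD Pp; elim/tens_ind; elim=> [|[a b] s IH]; first exact: P0.
have -> : tcls ((a, b) :: s) = tpure a b + tcls s.
  by rewrite /GRing.add /= taddE.
exact: PD.
Qed.

Section TensorAlgTheory.
Variables (C : comNzRingType) (X Y : Type).
Variables (r : term C X -> term C X -> Prop) (r' : term C Y -> term C Y -> Prop).
Local Notation A := (palg r).
Local Notation B := (palg r').
Local Notation T := (tens A B).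

Lemma tpureM (a a' : A) (b b' : B) :
  (tpure a b : T) * tpure a' b' = tpure (a * a') (b * b').
Proof. by rewrite /GRing.mul /= tmulE. Qed.

Lemma tpure1 : tpure (1 : A) (1 : B) = 1 :> T.
Proof. by []. Qed.

Lemma tens_scaleAl (k : C) (s t : T) : k *: (s * t) = (k *: s) * t.
Proof.
elim/tens_pure_ind: s => [|s s' IH IH'|a b]; first by rewrite scaler0 mul0r scaler0.
  by rewrite mulrDl !scalerDr mulrDl IH IH'.
elim/tens_pure_ind: t => [|t t' IH IH'|a' b']; first by rewrite !mulr0 scaler0.
  by rewrite !mulrDr scalerDr IH IH'.
by rewrite -tpureZl !tpureM -tpureZl palg_scaleAl.
Qed.

Lemma tens_scaleAr (k : C) (s t : T) : k *: (s * t) = s * (k *: t).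
Proof.
elim/tens_pure_ind: s => [|s s' IH IH'|a b]; first by rewrite !mul0r scaler0.
  by rewrite !mulrDl scalerDr IH IH'.
elim/tens_pure_ind: t => [|t t' IH IH'|a' b']; first by rewrite scaler0 mulr0 scaler0.
  by rewrite mulrDr !scalerDr mulrDr IH IH'.
by rewrite -tpureZl !tpureM -tpureZl palg_scaleAr.
Qed.

Definition tens_cst (a : C) : T := a *: tpure (1 : A) (1 : B).

Lemma tens_cst_zmod : zmod_morphism tens_cst.
Proof. by move=> a b; rewrite /tens_cst scalerBl. Qed.

Lemma tens_cst_mul : monoid_morphism tens_cst.
Proof.
by split=> [|a b]; rewrite /tens_cst ?scale1r // -tens_scaleAl mul1r scalerA.
Qed.

HB.instance Definition _ := GRing.isZmodMorphism.Build C T tens_cst tens_cst_zmod.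
HB.instance Definition _ := GRing.isMonoidMorphism.Build C T tens_cst tens_cst_mul.

Lemma tens_cst_comm a u : GRing.comm (tens_cst a) u.
Proof. by rewrite /GRing.comm /tens_cst -tens_scaleAl -tens_scaleAr mul1r mulr1. Qed.

End TensorAlgTheory.

(** * Gaussian binomial coefficients at roots of unity *)

Section QBinomial.
Variable F : fieldType.
Variable w : F.

(** Gaussian binomial coefficients through the $q$-Pascal rule, which makes sense at roots of unity,
    where a quotient of $q$-factorials may read $0/0$. *)
Fixpoint gbin (n k : nat) : F :=
  match n, k with
  | _, 0 => 1
  | 0, _.+1 => 0
  | n'.+1, k'.+1 => gbin n' k' + w ^+ k * gbin n' k
  end.

Lemma gbin_small n k : (n < k)%N -> gbin n k = 0.
Proof.
elim: n k => [|n IH] [|k] //= lt_nk.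
by rewrite !IH ?mulr0 ?addr0 // ltnW.
Qed.

Lemma gbin0 n : gbin n 0 = 1.
Proof. by case: n. Qed.

Lemma gbinn n : gbin n n = 1.
Proof. by elim: n => //= n ->; rewrite gbin_small // mulr0 addr0. Qed.

Lemma gbinS n k : gbin n.+1 k.+1 = gbin n k + w ^+ k.+1 * gbin n k.+1.
Proof. by []. Qed.

(** The $q$-analogue of $k\binom nk=n\binom{n-1}{k-1}$. At a root of unity of order $n$ it forces
    the inner coefficients to vanish. *)
Lemma gbin_absorb n k :
  (1 - w ^+ k.+1) * gbin n.+1 k.+1 = (1 - w ^+ n.+1) * gbin n k.
Proof.
elim: n k => [|n IH] k.
  by case: k => [|k]; rewrite gbinS /= ?(mulr0, addr0, mulr1).
case: k => [|k].
  have IH0 : (1 - w) * gbin n.+1 1 = 1 - w ^+ n.+1.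
    by have := IH 0; rewrite !gbin0 !mulr1 !expr1.
  rewrite gbinS !gbin0 mulr1 expr1 mulrDr mulr1 mulrCA IH0 !exprS.
  by ring.
have IH1 := IH k; have IH2 := IH k.+1.
rewrite gbinS [LHS](_ : _ = (1 - w ^+ k.+2) * gbin n.+1 k.+1 +
   w ^+ k.+2 * ((1 - w ^+ k.+2) * gbin n.+1 k.+2)); last first.
  by move: (gbin _ _) (gbin n.+1 k.+2) => g h; ring.
(* The two sides agree only modulo [IH1], so $-w$ times the difference of its sides is inserted as a
   zero term before [ring]. *)
apply/eqP; rewrite IH2 -subr_eq0 -[_ - _]addr0 -[X in _ + X](mulr0 (- w)).
rewrite -[X in _ + _ * X](subrr ((1 - w ^+ k.+1) * gbin n.+1 k.+1)) {2}IH1.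
apply/eqP; rewrite gbinS !exprS.
by move: (gbin _ _) (gbin n k.+1) => g h; ring.
Qed.

Lemma gbin_root n k : (0 < k < n)%N -> w ^+ n = 1 ->
  (forall i, (0 < i < n)%N -> w ^+ i != 1) -> gbin n k = 0.
Proof.
case: n k => [|n] [|k] //= lt_kn wn prim.
have := gbin_absorb n k; rewrite wn subrr mul0r => /eqP.
by rewrite mulf_eq0 subr_eq0 eq_sym (negPf (prim _ _)) //= => /eqP.
Qed.

End QBinomial.

Section QBinomialRing.
Variables (F : fieldType) (T : pzRingType) (c : {rmorphism F -> T}).
Hypothesis c_comm : forall a b, GRing.comm (c a) b.
Variables (w : F) (x y : T).
Hypothesis yx : y * x = c w * (x * y).

Let mulrcA a u v : u * (c a * v) = c a * (u * v).
Proof. by rewrite mulrA -(c_comm a u) mulrA. Qed.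

Lemma qcommX k : y ^+ k * x = c (w ^+ k) * (x * y ^+ k).
Proof.
elim: k => [|k IH]; first by rewrite !expr0 rmorph1 !mul1r mulr1.
rewrite exprS -mulrA IH mulrcA (mulrA y) yx.
by rewrite -(mulrA (c w)) -(mulrA x) (mulrA (c _) (c w)) -rmorphM -exprSr -exprS.
Qed.

Lemma qbinomial n :
  (x + y) ^+ n = \sum_(k < n.+1) c (gbin w n k) * (x ^+ (n - k) * y ^+ k).
Proof.
elim: n => [|n IH]; first by rewrite big_ord1 /= rmorph1 !mul1r.
rewrite exprSr IH mulrDr !mulr_suml [LHS]addrC.
rewrite [X in _ + X](_ : _ = \sum_(k < n.+1) c (w ^+ k * gbin w n k) *
    (x ^+ (n.+1 - k) * y ^+ k)); last first.
  apply: eq_bigr => k _; rewrite [w ^+ k * _]mulrC rmorphM.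
  rewrite -2!(mulrA _ _ x) qcommX mulrcA !mulrA -(mulrA _ _ x) -exprSr.
  by rewrite subSn // -ltnS.
rewrite [X in X + _](_ : _ = \sum_(k < n.+1) c (gbin w n k) *
    (x ^+ (n.+1 - k.+1) * y ^+ k.+1)); last first.
  by apply: eq_bigr => k _; rewrite subSS exprSr !mulrA.
rewrite [RHS]big_ord_recl gbin0 subn0 rmorph1 mul1r.
rewrite [X in _ + X]big_ord_recl !expr0 !mul1r gbin0 rmorph1 mul1r subn0.
rewrite addrCA; congr (_ + _).
have -> : \sum_(i < n) c (w ^+ bump 0 i * gbin w n (bump 0 i)) *
     (x ^+ (n.+1 - bump 0 i) * y ^+ bump 0 i) =
   \sum_(i < n.+1) c (w ^+ i.+1 * gbin w n i.+1) *
     (x ^+ (n.+1 - i.+1) * y ^+ i.+1).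
  rewrite [RHS]big_ord_recr /= gbin_small // mulr0 rmorph0 mul0r addr0.
  by apply: eq_bigr.
rewrite -big_split; apply: eq_bigr => i _ /=.
by rewrite -mulrDl -rmorphD.
Qed.

(** Used with $w=q^2$, of order $p$, on the two summands of $\Delta(E)$ and of $\Delta(F)$: it makes
    $E^p=F^p=0$ compatible with the coproduct. *)
Lemma qbinomial_root n : (0 < n)%N -> w ^+ n = 1 ->
  (forall i, (0 < i < n)%N -> w ^+ i != 1) -> (x + y) ^+ n = x ^+ n + y ^+ n.
Proof.
case: n => // n _ wn prim; rewrite qbinomial big_ord_recl big_ord_recr.
rewrite big1 => [|i _]; last first.
  by rewrite gbin_root ?rmorph0 ?mul0r //; have := ltn_ord i; rewrite /= /bump; lia.
rewrite gbin0 rmorph1 subn0 expr0 mulr1 mul1r.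
by rewrite (gbinn w n.+1) subnn expr0 rmorph1 !mul1r /= add0r.
Qed.

End QBinomialRing.

(** * The root of unity *)

Section RootOfUnity.
Variables (R : realType) (p : nat).
Hypothesis p_ge2 : (2 <= p)%N.
Local Notation C := R[i].
Local Notation q := (qpar R p).
Local Notation th := (pi / p%:R : R).

Lemma qparX n : q ^+ n = Complex (cos (th *+ n)) (sin (th *+ n)).
Proof.
elim: n => [|n IH]; first by apply/eqP; rewrite mulr0n cos0 sin0 eq_complex /= !eqxx.
rewrite exprS IH mulrS cosD sinD /qpar; congr Complex.
by rewrite addrC.
Qed.

Let p_gt0 : 0 < p%:R :> R.
Proof. by rewrite ltr0n; lia. Qed.

Lemma qpar_half : q ^+ p = -1.
Proof.
rewrite qparX -(mulr_natr th) -mulrA mulVf ?gt_eqF // mulr1 cospi sinpi.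
by apply/eqP; rewrite eq_complex /= oppr0 !eqxx.
Qed.

Lemma qpar_order : q ^+ (2 * p) = 1.
Proof. by rewrite mulnC exprM qpar_half sqrrN expr1n. Qed.

Lemma qpar_neq0 : q != 0.
Proof.
apply/eqP => q0; have := qpar_order; rewrite q0 expr0n.
have -> : (2 * p == 0)%N = false by lia.
by move/eqP; rewrite eq_sym oner_eq0.
Qed.

Lemma qparX_neq0 n : q ^+ n != 0.
Proof. by rewrite expf_neq0 // qpar_neq0. Qed.

(** For $0<m<p$ the imaginary part $\sin(\pi m/p)$ is positive, so $q^m\ne\pm1$; $q^p=-1$ carries
    this over to exponents above $p$. *)
Lemma qparX_neq1 n : (0 < n < 2 * p)%N -> q ^+ n != 1.
Proof.
have small m : (0 < m < p)%N -> q ^+ m != 1 /\ q ^+ m != -1.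
  case/andP => m0 mp.
  have sm : 0 < sin (th *+ m).
    apply: sin_gt0_pi.
    rewrite pmulrn_lgt0 // divr_gt0 ?pi_gt0 //=.
    rewrite -(mulr_natr th) -mulrA gtr_pMr ?pi_gt0 //.
    by rewrite mulrC ltr_pdivrMr // mul1r ltr_nat.
  rewrite qparX !eq_complex /= oppr0.
  by split; rewrite negb_and (gt_eqF sm) orbT.
case/andP => n0 n2p; case: (ltngtP n p) => [np|pn|->].
- by have [] := small n; rewrite ?n0.
- have -> : n = (p + (n - p))%N by lia.
  rewrite exprD qpar_half mulN1r eqr_oppLR.
  by have [] := small (n - p)%N; rewrite ?subn_gt0 ?pn //=; lia.
- rewrite qpar_half -subr_eq0 -opprD oppr_eq0 -mulr2n.
  by rewrite pnatr_eq0.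
Qed.

Lemma qparX_inj m n : (m < n)%N -> (n - m < 2 * p)%N -> q ^+ n != q ^+ m.
Proof.
move=> mn nm; have -> : n = (m + (n - m))%N by lia.
rewrite exprD -[X in _ != X]mulr1 (inj_eq (mulfI (qparX_neq0 m))).
by apply: qparX_neq1; lia.
Qed.

(** Up to the sign of the module, the Casimir value on the simple module of dimension $n$; it equals
    $2\cos(\pi n/p)$. *)
Definition cval (n : nat) : C := q ^+ n + q ^- n.

Lemma qint_den_neq0 : q - q^-1 != 0.
Proof.
rewrite subr_eq0; apply/eqP => e.
have : q ^+ 2 != 1 by apply: qparX_neq1; lia.
by rewrite expr2 {1}e mulVf ?qpar_neq0 // eqxx.
Qed.

Lemma qintE n : (q - q^-1) * qint R p n = q ^+ n - q ^- n.
Proof. by rewrite /qint mulrC divfK // qint_den_neq0. Qed.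

Lemma qint_neq0 n : (0 < n < p)%N -> qint R p n != 0.
Proof.
move=> np; rewrite -(inj_eq (mulfI qint_den_neq0)) qintE mulr0 subr_eq0.
rewrite -(inj_eq (mulfI (qparX_neq0 n))) divff ?qparX_neq0 // -exprD.
by apply: qparX_neq1; lia.
Qed.

Lemma qint0 : qint R p 0 = 0.
Proof. by rewrite /qint expr0 invr1 subrr mul0r. Qed.

Lemma qint1 : qint R p 1 = 1.
Proof. by rewrite /qint expr1 divff // qint_den_neq0. Qed.

Lemma qparXB n : (n <= p)%N -> q ^+ (p - n) = - q ^- n.
Proof.
move=> np; apply: (mulIf (qparX_neq0 n)).
by rewrite -exprD subnK // qpar_half mulNr mulVf ?qparX_neq0.
Qed.

Lemma qint_sub n : (n <= p)%N -> qint R p (p - n) = qint R p n.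
Proof.
move=> np; rewrite /qint; congr (_ / _).
rewrite qparXB //.
by rewrite invrN invrK opprK addrC.
Qed.

Lemma qintp : qint R p p = 0.
Proof. by have := qint_sub (leqnn p); rewrite subnn qint0. Qed.

Lemma cval_sub n : (n <= p)%N -> cval (p - n) = - cval n.
Proof.
move=> np; rewrite /cval.
rewrite qparXB //.
by rewrite invrN invrK opprD addrC.
Qed.

(** The difference factors, and $0<m+n<2p$ makes both factors nonzero. The root counts for $G_sG_t$
    rest on these values being distinct. *)
Lemma cval_inj m n : (m < n <= p)%N -> cval m != cval n.
Proof.
move=> mnp; rewrite -subr_eq0.
have -> : cval m - cval n = (q ^+ m - q ^+ n) * (1 - q ^- (m + n)).
  rewrite /cval exprD; field.
  by rewrite !qparX_neq0.
rewrite mulf_neq0 // subr_eq0; first by rewrite eq_sym; apply: qparX_inj; lia.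
rewrite eq_sym invr_eq1; apply: qparX_neq1; lia.
Qed.

End RootOfUnity.

(** * Matrices of the simple and projective modules *)

Lemma teval_tpow (C : comNzRingType) (X : Type) (B : pzRingType)
    (c : {rmorphism C -> B}) (g : X -> B) t n :
  teval c g (tpow t n) = teval c g t ^+ n.
Proof. by elim: n => [|n IH] /=; rewrite ?rmorph1 // IH exprS. Qed.

Section MatrixTools.
Variable F : fieldType.

Lemma sum_if_eq s c (f : nat -> F) :
  \sum_(k < s) (if k == c :> nat then f k else 0) = if (c < s)%N then f c else 0.
Proof.
by rewrite -big_mkcond big_ord1_eq.
Qed.

Definition dgm s (f : nat -> F) : 'M[F]_s :=
  \matrix_(i, j) (if i == j :> nat then f i else 0).

Lemma mul_dgm m n f (M : 'M[F]_(m, n)) i j : (dgm m f *m M) i j = f i * M i j.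
Proof.
rewrite mxE (bigD1 i) //= mxE eqxx big1 ?addr0 // => k ki.
by rewrite mxE eq_sym -val_eqE /= in ki *; rewrite (negPf ki) mul0r.
Qed.

Lemma mul_mdg m n f (M : 'M[F]_(m, n)) i j : (M *m dgm n f) i j = M i j * f j.
Proof.
rewrite mxE (bigD1 j) //= mxE eqxx big1 ?addr0 // => k kj.
by rewrite mxE; rewrite -val_eqE /= in kj; rewrite (negPf kj) mulr0.
Qed.

Lemma dgmM s f g : dgm s f *m dgm s g = dgm s (fun i => f i * g i).
Proof.
by apply/matrixP => i j; rewrite mul_dgm !mxE; case: eqP; rewrite ?mulr0.
Qed.

Lemma dgm1 s : dgm s (fun=> 1) = 1%:M.
Proof.
by apply/matrixP => i j; rewrite !mxE -val_eqE; case: eqP.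
Qed.

Lemma dgm_ext s f g : (forall i, (i < s)%N -> f i = g i) -> dgm s f = dgm s g.
Proof.
by move=> e; apply/matrixP => i j; rewrite !mxE e.
Qed.

Lemma dgmX s f n : dgm s f ^+ n = dgm s (fun i => f i ^+ n).
Proof.
elim: n => [|n IH]; first by rewrite expr0 -[LHS]dgm1.
rewrite exprS IH; transitivity (dgm s f *m dgm s (fun i => f i ^+ n)) => //.
by rewrite dgmM; apply: dgm_ext => i _; rewrite exprS.
Qed.

Lemma dgmD s f g : dgm s f + dgm s g = dgm s (fun i => f i + g i).
Proof.
by apply/matrixP => i j; rewrite !mxE; case: eqP; rewrite ?addr0.
Qed.

Lemma dgmZ s c f : c%:M *m dgm s f = dgm s (fun i => c * f i).
Proof.
by apply/matrixP => i j; rewrite mul_scalar_mx !mxE; case: eqP; rewrite ?mulr0.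
Qed.

Lemma dgm_const s c : dgm s (fun=> c) = c%:M.
Proof.
by apply/matrixP => i j; rewrite !mxE -val_eqE /=; case: eqP.
Qed.

Lemma dgm_tr s f : \tr (dgm s f) = \sum_(i < s) f i.
Proof. by apply: eq_bigr => i _; rewrite mxE eqxx. Qed.

Lemma dgm_twist m n (f g : nat -> F) c (M : 'M[F]_(m, n)) :
  (forall (i : 'I_m) (j : 'I_n), M i j != 0 -> f i = c * g j) ->
  dgm m f *m M = c%:M *m (M *m dgm n g).
Proof.
move=> H; apply/matrixP => i j; rewrite mul_dgm mul_scalar_mx [RHS]mxE mul_mdg.
have [->|nz] := eqVneq (M i j) 0; first by rewrite mul0r !mulr0.
by rewrite (H _ _ nz) mulrA mulrAC.
Qed.

(** Columns are images, so [M] strictly lowers the height of basis vectors, and there are only [p]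
    heights. Triangularity alone would give the exponent [N], which is $2p$ for the projective
    modules. *)
Lemma height_nilp N (h : 'I_N -> nat) (M : 'M[F]_N) p :
  (forall i j, M i j != 0 -> (h i < h j)%N) -> (forall i, (h i < p)%N) ->
  M ^+ p = 0.
Proof.
move=> hM hp; suff H k i j : (h j < h i + k)%N -> (M ^+ k) i j = 0.
  by apply/matrixP => i j; rewrite mxE H // (leq_trans (hp j)) ?leq_addl.
elim: k i j => [|k IH] i j.
  by rewrite addn0 mxE; case: eqP => [->|]; rewrite ?ltnn.
rewrite exprS => lt; rewrite mxE big1 // => l _.
have [->|nz] := eqVneq (M i l) 0; first by rewrite mul0r.
by rewrite IH ?mulr0 //; have := hM _ _ nz; lia.
Qed.

Section PBlock.
Variables (m n : nat).

(* The shape of the action on a projective module in the basis (b, x, y, a). *)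
Definition projblock (A : 'M[F]_m) (B : 'M[F]_n) (X Y : 'M[F]_(n, m))
    (X' Y' : 'M[F]_(m, n)) (N : 'M[F]_m) : 'M[F]_(m + n + (n + m)) :=
  block_mx (block_mx A 0 X B) 0 (block_mx Y 0 N X') (block_mx B 0 Y' A).

Lemma projblockM A1 B1 X1 Y1 X1' Y1' N1 A2 B2 X2 Y2 X2' Y2' N2 :
  projblock A1 B1 X1 Y1 X1' Y1' N1 *m projblock A2 B2 X2 Y2 X2' Y2' N2 =
  projblock (A1 *m A2) (B1 *m B2) (X1 *m A2 + B1 *m X2) (Y1 *m A2 + B1 *m Y2)
    (X1' *m B2 + A1 *m X2') (Y1' *m B2 + A1 *m Y2')
    (N1 *m A2 + X1' *m X2 + Y1' *m Y2 + A1 *m N2).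
Proof.
rewrite /projblock !mulmx_block.
rewrite !(mul0mx, mulmx0, addr0, add0r) !add_block_mx !(addr0, add0r).
by rewrite !addrA.
Qed.

Lemma projblockD A1 B1 X1 Y1 X1' Y1' N1 A2 B2 X2 Y2 X2' Y2' N2 :
  projblock A1 B1 X1 Y1 X1' Y1' N1 + projblock A2 B2 X2 Y2 X2' Y2' N2 =
  projblock (A1 + A2) (B1 + B2) (X1 + X2) (Y1 + Y2) (X1' + X2') (Y1' + Y2') (N1 + N2).
Proof. by rewrite /projblock !add_block_mx !addr0. Qed.

Lemma projblock_scalar c : projblock c%:M c%:M 0 0 0 0 0 = c%:M.
Proof.
by rewrite /projblock block_mx0 -!scalar_mx_block.
Qed.

Lemma projblock_mull D D' A B X Y X' Y' N :
  projblock D D' 0 0 0 0 0 *m projblock A B X Y X' Y' N =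
  projblock (D *m A) (D' *m B) (D' *m X) (D' *m Y) (D *m X') (D *m Y') (D *m N).
Proof. by rewrite projblockM !(mul0mx, mulmx0, addr0, add0r). Qed.

Lemma projblock_mulr D D' A B X Y X' Y' N :
  projblock A B X Y X' Y' N *m projblock D D' 0 0 0 0 0 =
  projblock (A *m D) (B *m D') (X *m D) (Y *m D) (X' *m D') (Y' *m D') (N *m D).
Proof. by rewrite projblockM !(mul0mx, mulmx0, addr0, add0r). Qed.

Lemma projblock_scale c A B X Y X' Y' N :
  c%:M *m projblock A B X Y X' Y' N = projblock (c%:M *m A) (c%:M *m B) (c%:M *m X)
    (c%:M *m Y) (c%:M *m X') (c%:M *m Y') (c%:M *m N).
Proof. by rewrite -projblock_scalar projblock_mull. Qed.

Lemma projblock_mulFE f g Y X' A B X Y' N :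
  projblock f g 0 Y X' 0 0 *m projblock A B X 0 0 Y' N =
  projblock (f *m A) (g *m B) (g *m X) (Y *m A) (X' *m B) (f *m Y') (X' *m X + f *m N).
Proof. by rewrite projblockM !(mul0mx, mulmx0, addr0, add0r). Qed.

Lemma projblock_mulEF f g Y X' A B X Y' N :
  projblock A B X 0 0 Y' N *m projblock f g 0 Y X' 0 0 =
  projblock (A *m f) (B *m g) (X *m f) (B *m Y) (A *m X') (Y' *m g) (N *m f + Y' *m Y).
Proof. by rewrite projblockM !(mul0mx, mulmx0, addr0, add0r). Qed.

Lemma projblock_addN D D' L L' :
  projblock D D' 0 0 0 0 0 - projblock L L' 0 0 0 0 0 =
  projblock (D - L) (D' - L') 0 0 0 0 0.
Proof.
by rewrite /projblock opp_block_mx !add_block_mx !opp_block_mx !oppr0 !add_block_mx !addr0.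
Qed.

Lemma projblock_addl D D' A B X Y X' Y' N :
  projblock A B X Y X' Y' N + projblock D D' 0 0 0 0 0 =
  projblock (A + D) (B + D') X Y X' Y' N.
Proof. by rewrite projblockD !addr0. Qed.

Lemma projblock_scale0 c D D' :
  c%:M *m projblock D D' 0 0 0 0 0 = projblock (c%:M *m D) (c%:M *m D') 0 0 0 0 0.
Proof. by rewrite projblock_scale !mulmx0. Qed.

Lemma projblockX D D' k :
  projblock D D' 0 0 0 0 0 ^+ k = projblock (D ^+ k) (D' ^+ k) 0 0 0 0 0.
Proof.
elim: k => [|k IH]; first by rewrite !expr0 [RHS]projblock_scalar.
by rewrite exprS IH [LHS]projblock_mull !mulmx0 !exprS.
Qed.

Lemma projblock_twist c D D' A B X Y X' Y' N :
  D *m A = c%:M *m (A *m D) -> D' *m B = c%:M *m (B *m D') ->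
  D' *m X = c%:M *m (X *m D) -> D' *m Y = c%:M *m (Y *m D) ->
  D *m X' = c%:M *m (X' *m D') -> D *m Y' = c%:M *m (Y' *m D') ->
  D *m N = c%:M *m (N *m D) ->
  projblock D D' 0 0 0 0 0 *m projblock A B X Y X' Y' N =
  c%:M *m (projblock A B X Y X' Y' N *m projblock D D' 0 0 0 0 0).
Proof.
by rewrite projblock_mull projblock_mulr projblock_scale => -> -> -> -> -> -> ->.
Qed.

Lemma twist0 k l c (D : 'M[F]_k) (D' : 'M[F]_l) :
  D *m 0 = c%:M *m (0 *m D') :> 'M_(k, l).
Proof. by rewrite mul0mx !mulmx0. Qed.

Lemma projblock_corner A B X Y X' Y' N :
  dlsubmx (dlsubmx (projblock A B X Y X' Y' N)) = N.
Proof. by rewrite !block_mxKdl. Qed.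

Lemma projblock_nilp (hb hx hy ha : nat -> nat) (A : 'M[F]_m) (B : 'M[F]_n)
    (X Y : 'M[F]_(n, m)) (X' Y' : 'M[F]_(m, n)) (N : 'M[F]_m) p :
  (forall i, i < m -> hb i < p)%N -> (forall i, i < n -> hx i < p)%N ->
  (forall i, i < n -> hy i < p)%N -> (forall i, i < m -> ha i < p)%N ->
  (forall i j, A i j != 0 -> (hb i < hb j)%N && (ha i < ha j)%N) ->
  (forall i j, B i j != 0 -> (hx i < hx j)%N && (hy i < hy j)%N) ->
  (forall i j, X i j != 0 -> (hx i < hb j)%N) ->
  (forall i j, Y i j != 0 -> (hy i < hb j)%N) ->
  (forall i j, X' i j != 0 -> (ha i < hx j)%N) ->
  (forall i j, Y' i j != 0 -> (ha i < hy j)%N) ->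
  (forall i j, N i j != 0 -> (ha i < hb j)%N) ->
  projblock A B X Y X' Y' N ^+ p = 0.
Proof.
move=> pb px py pa HA HB HX HY HX' HY' HN.
pose h (i : 'I_(m + n + (n + m))) := match fintype.split i with
  | inl i => match fintype.split i with inl i => hb i | inr i => hx i end
  | inr i => match fintype.split i with inl i => hy i | inr i => ha i end end.
apply: (@height_nilp _ h) => [i j|i]; last first.
  rewrite /h; case: (fintype.split i) => i'; case: (fintype.split i') => i'';
  first [exact: pb (ltn_ord _)|exact: px (ltn_ord _)|exact: py (ltn_ord _)
    |exact: pa (ltn_ord _)].
rewrite /projblock /h.
case: (split_ordP i) => {}i ->; case: (split_ordP i) => {}i ->;
case: (split_ordP j) => {}j ->; case: (split_ordP j) => {}j ->;
rewrite ?(block_mxEul, block_mxEur, block_mxEdl, block_mxEdr)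
  ?(block_mxEul, block_mxEur, block_mxEdl, block_mxEdr) ?[_ (_ 0 _ _) _]mxE ?eqxx //.
all: first [by move/HA/andP=> [] | by move/HB/andP=> [] | by move/HX | by move/HY
  | by move/HX' | by move/HY' | by move/HN | by rewrite mxE eqxx].
Qed.

End PBlock.
End MatrixTools.

(** * The defining relations on the simple and projective modules *)

Section Representations.
Variables (R : realType) (p : nat).
Hypothesis p_ge2 : (2 <= p)%N.
Local Notation C := R[i].
Local Notation q := (qpar R p).
Local Notation qn := (qint R p).
Let q0 : q != 0 := qpar_neq0 R p_ge2.
Let qX0 n : q ^+ n != 0 := qparX_neq0 R p_ge2 n.
Let dq0 : q - q^-1 != 0 := qint_den_neq0 R p_ge2.

(* [K]-weights of the simple module of sign [a] and dimension [s]. *)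
Definition wgt (a : bool) (s i : nat) : C := sgn R a * (q ^+ s / q / q ^+ (2 * i)).

Lemma sgn_sqr a : sgn R a * sgn R a = 1.
Proof. by case: a; rewrite /sgn ?expr0 ?expr1 ?mulrNN mulr1. Qed.

Lemma sgn_neq0 a : sgn R a != 0.
Proof. by rewrite signr_eq0. Qed.

Lemma sgnV a : (sgn R a)^-1 = sgn R a.
Proof. by apply: (mulfI (sgn_neq0 a)); rewrite sgn_sqr divff // sgn_neq0. Qed.

Lemma sgnN a : sgn R (~~ a) = - sgn R a.
Proof. exact: signrN. Qed.

Lemma wgt_neq0 a s i : wgt a s i != 0.
Proof. by rewrite !mulf_neq0 ?invr_eq0 ?sgn_neq0. Qed.

Lemma simpleKE a s : simpleK R p a s = dgm s (wgt a s).
Proof.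
apply/matrixP => i j; rewrite !mxE -val_eqE /=.
case: eqP => // ->; congr (_ * _).
by rewrite expfzDr // expfzDr // -!exprnN -!exprnP expr1.
Qed.

Lemma qnB s i : (i <= s)%N -> qn (s - i) = (q ^+ s / q ^+ i - q ^+ i / q ^+ s) / (q - q^-1).
Proof.
move=> is_; rewrite /qint; have -> : q ^+ (s - i) = q ^+ s / q ^+ i.
  by apply: (mulIf (qX0 i)); rewrite -exprD subnK // divfK.
by rewrite invf_div.
Qed.

(** The coefficient of $v_{i-1}$ in $Ev_i$; also the eigenvalue of $FE$ at $v_i$ and of $EF$ at
    $v_{i-1}$. *)
Definition ent a s i : C := sgn R a * qn i * qn (s - i).

(** The right side is a constant of the module minus terms in the weight; that constant becomes the
    Casimir value. *)
Lemma entE a s i : (i <= s)%N -> (q - q^-1) ^+ 2 * ent a s i =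
  sgn R a * cval R p s - q * wgt a s i - q^-1 * (wgt a s i)^-1.
Proof.
move=> is_; rewrite /ent qnB // /qint /wgt !invfM !invrK sgnV.
rewrite mulnC exprM /cval.
by field; rewrite !qX0 q0 /= -[_ - 1](_ : q * (q - q^-1) = _) ?mulf_neq0 // mulrBr divff // expr2.
Qed.

Lemma wgtS a s i : wgt a s i = q ^+ 2 * wgt a s i.+1.
Proof. by rewrite /wgt mulnS exprD; field; rewrite !qX0 q0. Qed.

Lemma wgt_order a s i : wgt a s i ^+ (2 * p) = 1.
Proof.
have qX n : (q ^+ n) ^+ (2 * p) = 1.
  by rewrite -exprM mulnC exprM qpar_order ?expr1n.
rewrite /wgt !exprMn !exprVn (qX 1) !qX invr1 !mulr1.
by rewrite exprM expr2 sgn_sqr expr1n.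
Qed.

Lemma wgtV a s i : wgt a s i ^+ (2 * p).-1 = (wgt a s i)^-1.
Proof.
apply: (mulIf (wgt_neq0 a s i)); rewrite mulVf ?wgt_neq0 // -exprSr prednK ?wgt_order //.
by lia.
Qed.

Lemma ent_step a s i : (i < s)%N ->
  ent a s i.+1 = ent a s i + (q - q^-1)^-1 * (wgt a s i - (wgt a s i)^-1).
Proof.
move=> is_; apply: (mulfI (expf_neq0 2 dq0)).
rewrite mulrDr !entE ?(ltnW is_) // (_ : _ ^+ 2 * (_ * _) =
  (q - q^-1) * (wgt a s i - (wgt a s i)^-1)); last by rewrite expr2 -mulrA mulVKf.
rewrite (wgtS a s i); field.
by rewrite q0 wgt_neq0.
Qed.

Lemma ent0 a s : ent a s 0 = 0.
Proof. by rewrite /ent qint0 mulr0 mul0r. Qed.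

Lemma entss a s : ent a s s = 0.
Proof. by rewrite /ent subnn qint0 mulr0. Qed.

Lemma simple_mulFE a s : simpleF R s *m simpleE R p a s = dgm s (ent a s).
Proof.
apply/matrixP => i j; rewrite !mxE.
under eq_bigr => k _ do rewrite !mxE.
case: i => -[|i] /= lt_is.
  rewrite big1 => [|k _]; last by rewrite mul0r.
  by case: eqP => // _; rewrite ent0.
rewrite (eq_bigr (fun k : 'I_s => if k == i :> nat then
    (if i.+1 == j then ent a s j else 0) else 0)) => [|k _]; last first.
  by rewrite eqSS eq_sym; case: eqP => [->|]; rewrite ?mul1r ?mul0r.
rewrite (sum_if_eq s i (fun=> if i.+1 == j then ent a s j else 0)) ltnW //.
by case: eqP => // ->.
Qed.

Lemma simple_mulEF a s : simpleE R p a s *m simpleF R s = dgm s (fun i => ent a s i.+1).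
Proof.
apply/matrixP => i j; rewrite !mxE.
under eq_bigr => k _ do rewrite !mxE.
rewrite (eq_bigr (fun k : 'I_s => if k == i.+1 :> nat then
    (if i == j then ent a s i.+1 else 0) else 0)) => [|k _]; last first.
  rewrite eq_sym; case: eqP => [->|]; rewrite ?mul0r // eqSS -val_eqE.
  by case: eqP; rewrite ?mulr1 ?mulr0.
rewrite (sum_if_eq s i.+1 (fun=> if i == j then ent a s i.+1 else 0)) -val_eqE.
have := ltn_ord i; rewrite leq_eqVlt => /predU1P[e|->] //.
by rewrite e ltnn entss; case: eqP.
Qed.

Definition uq_matrices N (E F K : 'M[C]_N) :=
  [/\ E ^+ p = 0, F ^+ p = 0, K ^+ (2 * p) = 1 &
  [/\ K *m E = (q ^+ 2)%:M *m (E *m K), K *m F = (q ^- 2)%:M *m (F *m K) &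
   E *m F = F *m E + ((q - q^-1)^-1)%:M *m (K - K ^+ (2 * p).-1)]].

Definition uq_sel (T : Type) (E F K : T) (g : uq_gen) : T :=
  match g with genE => E | genF => F | genK => K end.

Lemma uq_matrices_rel N (E F K : 'M[C]_N) : uq_matrices E F K ->
  forall s t, @uq_rel R p s t ->
    teval (@scalar_mx C N) (uq_sel E F K) s = teval (@scalar_mx C N) (uq_sel E F K) t.
Proof.
case=> Ep Fp Kp [KE KF EF] s t [||||| ].
- by rewrite teval_tpow [LHS]Ep [RHS]raddf0.
- by rewrite teval_tpow [LHS]Fp [RHS]raddf0.
- by rewrite teval_tpow [LHS]Kp.
- exact: KE.
- exact: KF.
rewrite [LHS]EF [RHS]/=; congr (_ + _ *m (_ + _)).
by rewrite teval_tpow [RHS]mul_scalar_mx scaleN1r.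
Qed.

Lemma simple_height_E a s : (s <= p)%N -> simpleE R p a s ^+ p = 0.
Proof.
move=> sp; apply: (@height_nilp _ _ (fun i => i)) => [i j|i]; last first.
  exact: leq_trans sp.
by rewrite !mxE; case: (i.+1 =P j) => [<-|]; rewrite ?eqxx.
Qed.

Lemma simple_height_F s : (s <= p)%N -> simpleF R s ^+ p = 0.
Proof.
move=> sp; apply: (@height_nilp _ _ (fun i => (s - i.+1)%N)) => [i j|i].
  by have := ltn_ord i; rewrite !mxE; case: (i =P j.+1 :> nat); rewrite ?mulr0n ?eqxx //; lia.
by case: i => i /=; lia.
Qed.

Lemma simple_twistE a s :
  simpleK R p a s *m simpleE R p a s = (q ^+ 2)%:M *m (simpleE R p a s *m simpleK R p a s).
Proof.
rewrite simpleKE; apply: dgm_twist => i j.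
by rewrite !mxE; case: (i.+1 =P j) => [<- _|]; rewrite ?eqxx // wgtS.
Qed.

Lemma simple_twistF a s :
  simpleK R p a s *m simpleF R s = (q ^- 2)%:M *m (simpleF R s *m simpleK R p a s).
Proof.
rewrite simpleKE; apply: dgm_twist => i j.
rewrite !mxE; case: (i =P j.+1 :> nat) => [-> _|]; rewrite ?mulr0n ?eqxx //.
by rewrite (wgtS a s j) mulKf.
Qed.

Lemma simple_commutator a s :
  simpleE R p a s *m simpleF R s = simpleF R s *m simpleE R p a s +
    ((q - q^-1)^-1)%:M *m (simpleK R p a s - simpleK R p a s ^+ (2 * p).-1).
Proof.
rewrite simple_mulEF simple_mulFE simpleKE dgmX.
rewrite (_ : - dgm _ _ = dgm s (fun i => - (wgt a s i)^-1)); last first.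
  apply/matrixP => i j; rewrite !mxE; case: eqP; rewrite ?oppr0 //.
  by rewrite wgtV.
by rewrite dgmD dgmZ dgmD; apply: dgm_ext => i; apply: ent_step.
Qed.

Lemma simple_matrices a s : (s <= p)%N ->
  uq_matrices (simpleE R p a s) (simpleF R s) (simpleK R p a s).
Proof.
move=> sp; split; first exact: simple_height_E.
- exact: simple_height_F.
- rewrite simpleKE dgmX -[RHS]dgm1; apply: dgm_ext => i _; exact: wgt_order.
- by split; [exact: simple_twistE|exact: simple_twistF|exact: simple_commutator].
Qed.

Section Projective.
Variables (m n : nat).
Hypotheses (m_gt0 : (0 < m)%N) (n_gt0 : (0 < n)%N) (mnp : (m + n = p)%N).
Variable a : bool.

Let S (k l i j : nat) := single_mx R k l i j.
Let D : 'M[C]_m := \matrix_(l, i) (l.+1 == i :> nat)%:R.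

Definition gprojE := projblock (simpleE R p a m) (simpleE R p (~~ a) n)
  (S n m n.-1 0) 0 0 (S m n m.-1 0) D.
Definition gprojF := projblock (simpleF R m) (simpleF R n)
  0 (S n m 0 m.-1) (S m n 0 n.-1) 0 0.
Definition gprojK := projblock (simpleK R p a m) (simpleK R p (~~ a) n) 0 0 0 0 0.

Lemma single_mxE k l i j (x : 'I_k) (y : 'I_l) :
  S k l i j x y = if (x == i :> nat) && (y == j :> nat) then 1 else 0.
Proof. by rewrite mxE; case: andb. Qed.

Lemma gproj_nilpE : gprojE ^+ p = 0.
Proof.
(* $E$ leads from the end of $b$ into $x$ and from the end of $y$ into $a$, each pair being a chain
   of length $m+n=p$; the extra terms $b_i\mapsto a_{i-1}$ also lower the height. *)
apply: (projblock_nilp (hb := fun i => (n + i)%N) (hx := id) (hy := fun i => (m + i)%N) (ha := id)).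
1-4: by move=> i /=; lia.
- move=> i j; rewrite !mxE.
  by case: (i.+1 =P j :> nat) => [<-|]; rewrite ?mulr0n ?eqxx //=; lia.
- move=> i j; rewrite !mxE.
  by case: (i.+1 =P j :> nat) => [<-|]; rewrite ?mulr0n ?eqxx //=; lia.
- move=> i j; have := ltn_ord i; have := ltn_ord j; rewrite single_mxE.
  by case: ifP => [/andP[/eqP-> /eqP->]|];
    rewrite ?eqxx //=; lia.
- by move=> i j; rewrite mxE eqxx.
- by move=> i j; rewrite mxE eqxx.
- move=> i j; have := ltn_ord i; have := ltn_ord j; rewrite single_mxE.
  by case: ifP => [/andP[/eqP-> /eqP->]|];
    rewrite ?eqxx //=; lia.
- move=> i j; rewrite !mxE.
  by case: (i.+1 =P j :> nat) => [<-|]; rewrite ?mulr0n ?eqxx //=; lia.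
Qed.

Lemma gproj_nilpF : gprojF ^+ p = 0.
Proof.
(* $F$ leads from $b$ into $y$ and from $x$ into $a$, and it raises indices, so heights are counted
   from the end of each chain. *)
apply: (projblock_nilp (hb := fun i => (n + (m - i.+1))%N) (hx := fun i => (m + (n - i.+1))%N)
  (hy := fun i => (n - i.+1)%N) (ha := fun i => (m - i.+1)%N)).
1-4: by move=> i /=; lia.
- move=> i j; have := ltn_ord i; rewrite !mxE.
  by case: (i =P j.+1 :> nat) => [->|]; rewrite ?mulr0n ?eqxx //=; lia.
- move=> i j; have := ltn_ord i; rewrite !mxE.
  by case: (i =P j.+1 :> nat) => [->|]; rewrite ?mulr0n ?eqxx //=; lia.
- by move=> i j; rewrite mxE eqxx.
- move=> i j; have := ltn_ord i; have := ltn_ord j; rewrite single_mxE.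
  by case: ifP => [/andP[/eqP-> /eqP->]|];
    rewrite ?eqxx //=; lia.
- move=> i j; have := ltn_ord i; have := ltn_ord j; rewrite single_mxE.
  by case: ifP => [/andP[/eqP-> /eqP->]|];
    rewrite ?eqxx //=; lia.
- by move=> i j; rewrite mxE eqxx.
- by move=> i j; rewrite mxE eqxx.
Qed.

Lemma mul_single k l r i j (M : 'M[C]_(l, r)) x y (jl : (j < l)%N) :
  (S k l i j *m M) x y = if x == i :> nat then M (Ordinal jl) y else 0.
Proof.
rewrite mxE (bigD1 (Ordinal jl)) //= big1 => [|u uj]; last first.
  rewrite single_mxE; rewrite -val_eqE /= in uj.
  by rewrite (negPf uj) andbF mul0r.
by rewrite single_mxE eqxx andbT addr0; case: eqP; rewrite ?mul1r ?mul0r.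
Qed.

Lemma mul_singler k l r i j (M : 'M[C]_(r, k)) x y (ik : (i < k)%N) :
  (M *m S k l i j) x y = if y == j :> nat then M x (Ordinal ik) else 0.
Proof.
rewrite mxE (bigD1 (Ordinal ik)) //= big1 => [|u ui]; last first.
  rewrite single_mxE; rewrite -val_eqE /= in ui.
  by rewrite (negPf ui) mulr0.
by rewrite single_mxE eqxx addr0; case: eqP; rewrite ?mulr1 ?mulr0.
Qed.

Let m1 : (m.-1 < m)%N. Proof. by rewrite prednK. Qed.
Let n1 : (n.-1 < n)%N. Proof. by rewrite prednK. Qed.

(** This and the next three lemmas are edge facts: $E$ kills the first basis vector and never
    reaches the last one, and $F$ does the opposite. They cancel the off-diagonal blocks of $EF$ and
    $FE$ other than the corner. *)
Lemma E_last b k l j (kk : (k.-1 < k)%N) : simpleE R p b k *m S k l 0 j = 0.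
Proof.
have k0 : (0 < k)%N by lia.
apply/matrixP => x y; rewrite (mul_singler _ _ _ _ k0) !mxE /=.
by case: ifP.
Qed.

Lemma last_E b k l i (l0 : (0 < l)%N) : S k l i l.-1 *m simpleE R p b l = 0.
Proof.
have ll : (l.-1 < l)%N by lia.
apply/matrixP => x y; rewrite (mul_single _ _ _ _ ll) !mxE /=.
by have := ltn_ord y; case: ifP => // _; case: eqP => //; lia.
Qed.

Lemma first_F k l i (l0 : (0 < l)%N) : S k l i 0 *m simpleF R l = 0.
Proof.
by apply/matrixP => x y; rewrite (mul_single _ _ _ _ l0) !mxE /=; case: ifP.
Qed.

Lemma F_last k l j (k0 : (0 < k)%N) : simpleF R k *m S k l k.-1 j = 0.
Proof.
have kk : (k.-1 < k)%N by lia.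
apply/matrixP => x y; rewrite (mul_singler _ _ _ _ kk) !mxE /=.
by have := ltn_ord x; case: ifP => // _; case: eqP => //; lia.
Qed.

Lemma single_mul k l r i j' j (jl : (j < l)%N) :
  S k l i j *m S l r j j' = S k r i j'.
Proof.
apply/matrixP => x y; rewrite (mul_single _ _ _ _ jl) !single_mxE /= eqxx.
by case: ifP.
Qed.

(** $EFb_i$ contains $a_i$: through the extra term of $Eb_{i+1}$ if $i<m-1$, and through
    $Fb_{m-1}=y_0$ and $Ey_0=a_{m-1}$ for the last index. *)
Lemma D_F : D *m simpleF R m + S m m m.-1 m.-1 = 1%:M.
Proof.
apply/matrixP => i j; rewrite !mxE.
under eq_bigr => k _ do rewrite !mxE.
rewrite (eq_bigr (fun k : 'I_m => if k == i.+1 :> nat then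
    (if i == j then 1 else 0) else 0)) => [|k _]; last first.
  rewrite eq_sym; case: eqP => [->|]; rewrite ?mul0r // eqSS -val_eqE.
  by case: eqP; rewrite ?mulr1 ?mulr0.
rewrite (sum_if_eq m i.+1 (fun=> if i == j then 1 else 0)) -val_eqE.
move: (ltn_ord i) (ltn_ord j) => lt_i lt_j; rewrite -?val_eqE /=.
case: ltnP => ?; case: (i =P j :> nat) => ?; case: (i =P m.-1 :> nat) => ?;
  case: (j =P m.-1 :> nat) => ?; rewrite /= ?addr0 ?add0r //; lia.
Qed.

(** Likewise $FEb_i$ contains $a_i$, the index $0$ being reached through $x$. As both corners are
    the identity, they cancel in the commutator of $E$ and $F$. *)
Lemma F_D : S m m 0 0 + simpleF R m *m D = 1%:M.
Proof.
apply/matrixP => i j; rewrite !mxE.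
under eq_bigr => k _ do rewrite !mxE.
case: i => -[|i] /= lt_i.
  rewrite big1 => [|k _]; last by rewrite mul0r.
  by rewrite addr0 -val_eqE /= eq_sym.
rewrite (eq_bigr (fun k : 'I_m => if k == i :> nat then
    (if i.+1 == j then 1 else 0) else 0)) => [|k _]; last first.
  by rewrite eqSS eq_sym; case: eqP => [->|]; rewrite ?mul1r ?mul0r //; case: eqP.
rewrite (sum_if_eq m i (fun=> if i.+1 == j then 1 else 0)) ltnW // add0r -val_eqE /=.
by case: eqP.
Qed.

(** Where simple factors of opposite sign meet, $q^p=-1$ absorbs the sign, and the weight still
    changes by $q^2$. *)
Lemma wgt_edge b s t : (0 < t)%N -> (s + t = p)%N ->
  wgt (~~ b) t t.-1 = q ^+ 2 * wgt b s 0.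
Proof.
case: t => // t _ stp; rewrite /wgt sgnN /=.
have -> : q ^+ s = - q ^- t.+1 by rewrite -(qparXB R p_ge2) -?stp ?leq_addl // addnK.
rewrite mulnC muln2 -addnn exprD muln0 expr0 invr1 mulr1 exprS.
by field; rewrite !qX0 q0.
Qed.

Lemma gprojK_E : gprojK *m gprojE = (q ^+ 2)%:M *m (gprojE *m gprojK).
Proof.
apply: projblock_twist; try exact: simple_twistE; try exact: twist0;
  rewrite !simpleKE; apply: dgm_twist => i j.
- rewrite single_mxE; case: ifP => [/andP[/eqP-> /eqP->] _|]; rewrite ?eqxx //.
  exact: wgt_edge.
- rewrite single_mxE; case: ifP => [/andP[/eqP-> /eqP->] _|]; rewrite ?eqxx //.
  by rewrite -{1}(negbK a); apply: wgt_edge => //; rewrite addnC.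
- rewrite !mxE; case: (i.+1 =P j :> nat) => [<- _|]; rewrite ?mulr0n ?eqxx //.
  exact: wgtS.
Qed.

Lemma gprojK_F : gprojK *m gprojF = (q ^- 2)%:M *m (gprojF *m gprojK).
Proof.
apply: projblock_twist; try exact: simple_twistF; try exact: twist0;
  rewrite !simpleKE; apply: dgm_twist => i j.
- rewrite single_mxE; case: ifP => [/andP[/eqP-> /eqP->] _|]; rewrite ?eqxx //.
  by rewrite -{2}(negbK a) (@wgt_edge _ n) ?mulKf // addnC.
- rewrite single_mxE; case: ifP => [/andP[/eqP-> /eqP->] _|]; rewrite ?eqxx //.
  by rewrite (@wgt_edge _ m) ?mulKf.
Qed.

Lemma gprojKX k : gprojK ^+ k =
  projblock (simpleK R p a m ^+ k) (simpleK R p (~~ a) n ^+ k) 0 0 0 0 0.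
Proof. exact: projblockX. Qed.

Lemma gproj_FE : gprojF *m gprojE =
  projblock (dgm m (ent a m)) (dgm n (ent (~~ a) n)) 0 0 0 0 1%:M.
Proof.
rewrite /gprojF /gprojE projblock_mulFE !simple_mulFE.
by rewrite last_E // last_E // F_last // F_last // single_mul ?F_D.
Qed.

Lemma gproj_EF : gprojE *m gprojF =
  projblock (dgm m (fun i => ent a m i.+1)) (dgm n (fun i => ent (~~ a) n i.+1)) 0 0 0 0 1%:M.
Proof.
rewrite /gprojF /gprojE projblock_mulEF !simple_mulEF.
by rewrite first_F // first_F // E_last // E_last // single_mul ?D_F.
Qed.

Lemma gproj_matrices : uq_matrices gprojE gprojF gprojK.
Proof.
have nm : (m <= p)%N && (n <= p)%N by lia.
case/andP: nm => mp np.
have [_ _ Ka _] := simple_matrices a mp.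
have [_ _ Kb _] := simple_matrices (~~ a) np.
split; first exact: gproj_nilpE.
- exact: gproj_nilpF.
- by rewrite gprojKX Ka Kb [LHS]projblock_scalar.
split; [exact: gprojK_E|exact: gprojK_F|].
have := simple_commutator a m; have := simple_commutator (~~ a) n.
rewrite !simple_mulEF !simple_mulFE => Cb Ca.
rewrite gproj_EF gproj_FE Ca Cb gprojKX /gprojK projblock_addN.
by rewrite projblock_scale0 projblock_addl.
Qed.

End Projective.
End Representations.

(** * The coproduct, and the involution exchanging E and F *)

Section Hopf.
Variables (R : realType) (p : nat).
Hypothesis p_ge2 : (2 <= p)%N.
Local Notation C := R[i].
Local Notation q := (qpar R p).
Local Notation Uq := (palg (@uq_rel R p)).
Local Notation UU := (tens Uq Uq).
Let q0 : q != 0 := qpar_neq0 R p_ge2.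
Let qX0 n : q ^+ n != 0 := qparX_neq0 R p_ge2 n.
Let dq0 : q - q^-1 != 0 := qint_den_neq0 R p_ge2.

Definition uE : Uq := uqE R p.
Definition uF : Uq := uqF R p.
Definition uK : Uq := uqK R p.
Definition uKi : Uq := uK ^+ (2 * p).-1.

Lemma uq_relP s t : @uq_rel R p s t -> pcls (@uq_rel R p) s = pcls (@uq_rel R p) t.
Proof. by move=> st; apply/palgP/alg_eq_rel. Qed.

Lemma uEp : uE ^+ p = 0.
Proof. by have := uq_relP (uq_relEp R p); rewrite pcls_tpow. Qed.

Lemma uFp : uF ^+ p = 0.
Proof. by have := uq_relP (uq_relFp R p); rewrite pcls_tpow. Qed.

Lemma uKp : uK ^+ (2 * p) = 1.
Proof. by have := uq_relP (uq_relKp R p); rewrite pcls_tpow. Qed.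

Lemma uKE : uK * uE = q ^+ 2 *: (uE * uK).
Proof. by have := uq_relP (uq_relKE R p); rewrite pcls_CstM !pcls_Mul. Qed.

Lemma uKF : uK * uF = q ^- 2 *: (uF * uK).
Proof. by have := uq_relP (uq_relKF R p); rewrite pcls_CstM !pcls_Mul. Qed.

Lemma uEF : uE * uF = uF * uE + (q - q^-1)^-1 *: (uK - uKi).
Proof.
have := uq_relP (uq_relEF R p); rewrite pcls_Add pcls_CstM pcls_Add pcls_CstM.
by rewrite !pcls_Mul pcls_tpow scaleN1r.
Qed.

Lemma uKKi : uK * uKi = 1.
Proof. by rewrite -exprS prednK ?uKp //; lia. Qed.

Lemma uKiK : uKi * uK = 1.
Proof. by rewrite -exprSr prednK ?uKp //; lia. Qed.

Lemma uKiE : uKi * uE = q ^- 2 *: (uE * uKi).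
Proof.
have e : uE * uK = q ^- 2 *: (uK * uE).
  by rewrite uKE scalerA mulVf ?expf_neq0 // scale1r.
rewrite -[uE in LHS]mulr1 -uKKi (mulrA uE) e.
by rewrite -palg_scaleAl -palg_scaleAr -!mulrA (mulrA uKi) uKiK mul1r.
Qed.

Lemma uKiF : uKi * uF = q ^+ 2 *: (uF * uKi).
Proof.
have e : uF * uK = q ^+ 2 *: (uK * uF) by rewrite uKF scalerA divff ?expf_neq0 // scale1r.
rewrite -[uF in LHS]mulr1 -uKKi (mulrA uF) e.
by rewrite -palg_scaleAl -palg_scaleAr -!mulrA (mulrA uKi) uKiK mul1r.
Qed.

Definition is_rep N (rho : Uq -> 'M[C]_N) :=
  [/\ forall a u v, rho (a *: u + v) = a *: rho u + rho v, rho 1 = 1%:M &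
      forall u v, rho (u * v) = rho u *m rho v].

Lemma uq_eval_rep N (E F K : 'M[C]_N) : uq_matrices p E F K ->
  let rho := palg_eval (r := @uq_rel R p) (@scalar_mx C N) (uq_sel E F K) in
  is_rep rho /\ [/\ rho uE = E, rho uF = F & rho uK = K].
Proof.
move=> m rho; have rel := uq_matrices_rel m.
have comm a (b : 'M[C]_N) : GRing.comm (a%:M) b by exact: (esym (scalar_mxC _ _)).
split; last by split; exact: (palg_eval_gen comm rel).
split=> [a u v||u v].
- by rewrite /rho (palg_evalD comm rel) (palg_evalZ comm rel) [_ * _]mul_scalar_mx.
- exact: (palg_eval1 comm rel).
- exact: (palg_evalM comm rel).
Qed.

Lemma simple_repP a s : (s <= p)%N -> is_rep (simple_rep a s : Uq -> _) /\
  [/\ simple_rep a s uE = simpleE R p a s, simple_rep a s uF = simpleF R s &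
      simple_rep a s uK = simpleK R p a s].
Proof. by move=> sp; have H := uq_eval_rep (simple_matrices R p_ge2 a sp); exact: H. Qed.

(* [proj_rep a m] with [n] in place of [p - m], so that the blocks of the two
   modules entering [Gform] can be compared without casts. *)
Definition grep a m n : Uq -> 'M[C]_(m + n + (n + m)) :=
  palg_eval (@scalar_mx C _) (uq_sel (gprojE R p m n a) (gprojF R m n) (gprojK R p m n a)).

Lemma grepP a m n : (0 < m)%N -> (0 < n)%N -> (m + n = p)%N ->
  is_rep (grep a m n) /\
  [/\ grep a m n uE = gprojE R p m n a, grep a m n uF = gprojF R m n &
      grep a m n uK = gprojK R p m n a].
Proof. by move=> m0 n0 mnp; have H := uq_eval_rep (gproj_matrices R p_ge2 m0 n0 mnp a); exact: H. Qed.

Lemma proj_repE a s x : proj_rep a s x = grep a s (p - s) x.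
Proof.
rewrite /proj_rep /grep; congr (palg_eval _ _ _); apply/funext => -[] //=.
by rewrite /gprojK /projblock block_mx0.
Qed.

Lemma GformE s x : (0 < s < p)%N -> Gform R p s x =
  \tr (dlsubmx (dlsubmx (grep false s (p - s) x))) +
  \tr (dlsubmx (dlsubmx (grep true (p - s) s x))).
Proof.
move=> sp; rewrite /Gform sp /Hmx !proj_repE; congr (_ + _).
by rewrite subKn //; lia.
Qed.

Lemma tpureX (a b : Uq) n : (tpure a b : UU) ^+ n = tpure (a ^+ n) (b ^+ n).
Proof. by elim: n => // n IH; rewrite !exprS IH tpureM. Qed.

Lemma tpure0l (b : Uq) : tpure (0 : Uq) b = 0 :> UU.
Proof. by rewrite -(scale0r (0 : Uq)) tpureZl scale0r. Qed.

Lemma tpure0r (a : Uq) : tpure a (0 : Uq) = 0 :> UU.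
Proof. by rewrite -(scale0r (0 : Uq)) tpureZr scale0r. Qed.

Lemma tpureBl (a a' b : Uq) : tpure (a - a') b = tpure a b - tpure a' b :> UU.
Proof. by rewrite tpureDl -scaleN1r tpureZl scaleN1r. Qed.

Lemma tpureBr (a b b' : Uq) : tpure a (b - b') = tpure a b - tpure a b' :> UU.
Proof. by rewrite tpureDr -scaleN1r tpureZr scaleN1r. Qed.

Definition DE : UU := tpure (1 : Uq) uE + tpure uE uK.
Definition DF : UU := tpure uF (1 : Uq) + tpure uKi uF.
Definition DK : UU := tpure uK uK.

Let w := q ^+ 2.
Let wp : w ^+ p = 1. Proof. by rewrite /w -exprM qpar_order. Qed.
Let wprim i : (0 < i < p)%N -> w ^+ i != 1.
Proof. by move=> ip; rewrite /w -exprM qparX_neq1 //; lia. Qed.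

Local Notation Dcst := (@tens_cst C uq_gen uq_gen (@uq_rel R p) (@uq_rel R p)).

Lemma Delta_rel s t : @uq_rel R p s t ->
  teval (Dcst) (uq_sel DE DF DK) s =
  teval (Dcst) (uq_sel DE DF DK) t.
Proof.
have p0 : (0 < p)%N by lia.
have cstM a (b : UU) : Dcst a * b = a *: b.
  by rewrite /tens_cst -tens_scaleAl mul1r.
case.
- rewrite teval_tpow [RHS]raddf0 /= /DE.
  rewrite (qbinomial_root (@tens_cst_comm _ _ _ _ _) _ p0 wp wprim); last first.
    by rewrite cstM !tpureM !mul1r !mulr1 uKE tpureZr.
  by rewrite !tpureX uEp tpure0l tpure0r addr0.
- rewrite teval_tpow [RHS]raddf0 /= /DF.
  rewrite (qbinomial_root (@tens_cst_comm _ _ _ _ _) _ p0 wp wprim); last first.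
    by rewrite cstM !tpureM !mul1r !mulr1 uKiF tpureZl.
  by rewrite !tpureX uFp tpure0l tpure0r addr0.
- by rewrite teval_tpow [LHS]tpureX uKp [RHS]rmorph1.
- rewrite /= cstM /DE /DK mulrDr mulrDl !tpureM !mul1r !mulr1 uKE.
  by rewrite tpureZl tpureZr scalerDr.
- rewrite /= cstM /DF /DK mulrDr mulrDl !tpureM !mul1r !mulr1 uKF.
  by rewrite tpureZl tpureZr scalerDr uKKi uKiK.
rewrite /= teval_tpow !cstM scaleN1r /DE /DF /DK !(mulrDr, mulrDl) !tpureM !mul1r !mulr1.
rewrite /= tpureX -/uKi uEF uKF uKiE tpureDr tpureDl !tpureZl !tpureZr tpureBl tpureBr.
(* The two commutators contribute $(K-K^{-1})\otimes K$ and $K^{-1}\otimes(K-K^{-1})$, which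
   telescope through $K^{-1}\otimes K$. *)
have scB (V : lmodType C) (k : C) (a b c : V) :
    k *: (a - b) + k *: (b - c) = k *: (a - c).
  by rewrite -scalerDr addrA subrK.
rewrite -[X in _ = _ + X](scB _ _ _ (tpure uKi uK)).
by rewrite [LHS](AC ((1*2)*3) (((1*4)*(2*6))*(3*5))).
Qed.

Local Notation Delta := (@uqDelta R p).

Lemma DeltaEval : Delta = palg_eval (r := @uq_rel R p) Dcst (uq_sel DE DF DK).
Proof. by congr (palg_eval _ _); apply/funext => -[]. Qed.

Lemma DeltaM : {morph Delta : u v / u * v}.
Proof. by rewrite DeltaEval; apply: palg_evalM (@tens_cst_comm _ _ _ _ _) Delta_rel. Qed.

Lemma DeltaD : {morph Delta : u v / u + v}.
Proof. by rewrite DeltaEval; apply: palg_evalD (@tens_cst_comm _ _ _ _ _) Delta_rel. Qed.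

Lemma DeltaZ a u : Delta (a *: u) = a *: Delta u.
Proof.
rewrite DeltaEval (palg_evalZ (@tens_cst_comm _ _ _ _ _) Delta_rel).
by rewrite -tens_scaleAl mul1r.
Qed.

Lemma Delta1 : Delta 1 = 1.
Proof. by rewrite DeltaEval; apply: palg_eval1 (@tens_cst_comm _ _ _ _ _) Delta_rel. Qed.

Lemma DeltaE : Delta uE = DE.
Proof. by rewrite DeltaEval (palg_eval_gen (@tens_cst_comm _ _ _ _ _) Delta_rel). Qed.

Lemma DeltaF : Delta uF = DF.
Proof. by rewrite DeltaEval (palg_eval_gen (@tens_cst_comm _ _ _ _ _) Delta_rel). Qed.

Lemma DeltaK : Delta uK = DK.
Proof. by rewrite DeltaEval (palg_eval_gen (@tens_cst_comm _ _ _ _ _) Delta_rel). Qed.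

Lemma uKip : uKi ^+ (2 * p) = 1.
Proof. by rewrite /uKi -exprM mulnC exprM uKp expr1n. Qed.

Lemma uKi_pred : uKi ^+ (2 * p).-1 = uK.
Proof.
rewrite -[LHS]mulr1 -uKiK mulrA -exprSr prednK ?uKip ?mul1r //; lia.
Qed.

Definition omega : Uq -> Uq :=
  palg_eval (@palg_cst C uq_gen (@uq_rel R p)) (uq_sel uF uE uKi).

Local Notation Ucst := (@palg_cst C uq_gen (@uq_rel R p)).

Lemma omega_rel s t : @uq_rel R p s t ->
  teval Ucst (uq_sel uF uE uKi) s = teval Ucst (uq_sel uF uE uKi) t.
Proof.
have cstM a (b : Uq) : Ucst a * b = a *: b by rewrite /palg_cst -palg_scaleAl mul1r.
case.
- by rewrite teval_tpow [LHS]uFp [RHS]raddf0.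
- by rewrite teval_tpow [LHS]uEp [RHS]raddf0.
- by rewrite teval_tpow [LHS]uKip [RHS]rmorph1.
- by rewrite /= cstM uKiF.
- by rewrite /= cstM uKiE.
rewrite /= teval_tpow /= !cstM scaleN1r uKi_pred uEF -addrA -scalerDr addrA.
by rewrite subrK addrN scaler0 addr0.
Qed.

Lemma omegaM : {morph omega : u v / u * v}.
Proof. exact: palg_evalM (@palg_cst_comm _ _ _) omega_rel. Qed.

Lemma omegaD : {morph omega : u v / u + v}.
Proof. exact: palg_evalD (@palg_cst_comm _ _ _) omega_rel. Qed.

Lemma omegaZ a u : omega (a *: u) = a *: omega u.
Proof.
rewrite [LHS](palg_evalZ (@palg_cst_comm _ _ _) omega_rel).
by rewrite -palg_scaleAl mul1r.
Qed.

Lemma omega1 : omega 1 = 1.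
Proof. exact: palg_eval1 (@palg_cst_comm _ _ _) omega_rel. Qed.

Lemma omegaE : omega uE = uF.
Proof. exact: (palg_eval_gen (@palg_cst_comm _ _ _) omega_rel). Qed.

Lemma omegaF : omega uF = uE.
Proof. exact: (palg_eval_gen (@palg_cst_comm _ _ _) omega_rel). Qed.

Lemma omegaK : omega uK = uKi.
Proof. exact: (palg_eval_gen (@palg_cst_comm _ _ _) omega_rel). Qed.

Lemma uq_ind (P : Uq -> Prop) : P uE -> P uF -> P uK -> P 1 ->
  (forall a u, P u -> P (a *: u)) -> (forall u v, P u -> P v -> P (u + v)) ->
  (forall u v, P u -> P v -> P (u * v)) -> forall u, P u.
Proof.
move=> PE PF PK P1 PZ PD PM; apply: palg_gen_ind => //; first by case.
by move=> a; apply: PZ.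
Qed.

End Hopf.

(** * Products of linear forms *)

Section Convolution.
Variables (R : realType) (p : nat).
Hypothesis p_ge2 : (2 <= p)%N.
Local Notation C := R[i].
Local Notation Uq := (palg (@uq_rel R p)).
Local Notation UU := (tens Uq Uq).
Local Notation Delta := (@uqDelta R p).
Local Notation E := (uE R p).
Local Notation F := (uF R p).
Local Notation K := (uK R p).
Local Notation Ki := (uKi R p).

Lemma tens_eval_lin (V W : lmodType C) (g : V -> W) (f : Uq -> Uq -> V) t :
  linear g -> g (tens_eval f t) = tens_eval (fun a b => g (f a b)) t.
Proof. by move=> lg; rewrite /tens_eval /fsum lin_sum. Qed.

Lemma tens_eval_linear (V : lmodType C) (f : Uq -> Uq -> V) :
  bilin f -> linear (tens_eval f).
Proof. by move=> bf a u v; rewrite tens_evalD // tens_evalZ. Qed.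

Lemma bilin_tpure (f g : Uq -> Uq) : linear f -> linear g ->
  bilin (fun a b => tpure (f a) (g b)).
Proof.
move=> lf lg; split=> [b a u v|b a u v].
  by rewrite lf tpureDl tpureZl.
by rewrite lg tpureDr tpureZr.
Qed.

Lemma bilin_forms (f g : Uq -> C^o) : linear f -> linear g ->
  bilin (fun a b => f a * g b : C^o).
Proof.
move=> lf lg; split=> [b a u v|b a u v].
  by rewrite lf mulrDl -[a *: f u]/(a * f u) -mulrA.
by rewrite lg mulrDr -[a *: g u]/(a * g u) mulrCA.
Qed.

Lemma slf_mul_linear (f g : Uq -> C^o) :
  linear f -> linear g -> linear (slf_mul f g).
Proof.
move=> lf lg a u v; rewrite /slf_mul DeltaD // DeltaZ // tens_evalD ?tens_evalZ //;
  exact: bilin_forms.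
Qed.

Lemma slf_mul_SLF (f g : Uq -> C^o) : SLF f -> SLF g -> SLF (slf_mul f g).
Proof.
move=> [lf sf] [lg sg]; split=> [|x y]; first exact: slf_mul_linear.
have bf := bilin_forms lf lg.
rewrite /slf_mul !DeltaM //; move: (Delta x) (Delta y) => s t.
elim/tens_pure_ind: s => [|s s' IH IH'|a b]; first by rewrite mul0r mulr0.
  by rewrite mulrDl mulrDr !tens_evalD // IH IH'.
elim/tens_pure_ind: t => [|t t' IH IH'|a' b']; first by rewrite mul0r mulr0.
  by rewrite mulrDl mulrDr !tens_evalD // IH IH'.
by rewrite !tpureM !tens_eval_pure // sf sg.
Qed.

Lemma slf_mulDl (f g h : Uq -> C^o) : slf_mul (f + g) h = slf_mul f h + slf_mul g h.
Proof.
apply/funext => x; rewrite /slf_mul /tens_eval /fsum -[RHS]big_split.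
by apply: eq_bigr => ab _ /=; rewrite mulrDl.
Qed.

Lemma slf_mulZl a (f h : Uq -> C^o) : slf_mul (a *: f) h = a *: slf_mul f h.
Proof.
apply/funext => x; rewrite /slf_mul /tens_eval /fsum -[RHS]/(a *: _) scaler_sumr.
by apply: eq_bigr => ab _ /=; rewrite -mulrA.
Qed.

Lemma slf_mulDr (f g h : Uq -> C^o) : slf_mul h (f + g) = slf_mul h f + slf_mul h g.
Proof.
apply/funext => x; rewrite /slf_mul /tens_eval /fsum -[RHS]big_split.
by apply: eq_bigr => ab _ /=; rewrite mulrDr.
Qed.

Lemma slf_mulZr a (f h : Uq -> C^o) : slf_mul h (a *: f) = a *: slf_mul h f.
Proof.
apply/funext => x; rewrite /slf_mul /tens_eval /fsum -[RHS]/(a *: _) scaler_sumr.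
by apply: eq_bigr => ab _ /=; rewrite mulrCA.
Qed.

Lemma slf_mul0l (h : Uq -> C^o) : slf_mul 0 h = 0.
Proof. by have := slf_mulZl 0 0 h; rewrite !scale0r. Qed.

Lemma slf_mul0r (h : Uq -> C^o) : slf_mul h 0 = 0.
Proof. by have := slf_mulZr 0 0 h; rewrite !scale0r. Qed.

Lemma slf_mulNl (f h : Uq -> C^o) : slf_mul (- f) h = - slf_mul f h.
Proof. by rewrite -scaleN1r slf_mulZl scaleN1r. Qed.

Lemma slf_mul_sumr I (r : seq I) (G : I -> Uq -> C^o) (h : Uq -> C^o) :
  slf_mul h (\sum_(i <- r) G i) = \sum_(i <- r) slf_mul h (G i).
Proof. exact: (big_morph (slf_mul h) (fun f g => slf_mulDr f g h) (slf_mul0r h)). Qed.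

(** * Tensoring with a matrix representation *)

Section MatrixCoefficients.
Variables (N : nat) (rho : Uq -> 'M[C]_N).
Hypothesis rep : is_rep rho.

Let rhoL a u v : rho (a *: u + v) = a *: rho u + rho v. Proof. by case: rep. Qed.
Let rho1 : rho 1 = 1%:M. Proof. by case: rep. Qed.
Let rhoM u v : rho (u * v) = rho u *m rho v. Proof. by case: rep. Qed.

Lemma repX u n : rho (u ^+ n) = rho u ^+ n.
Proof. by elim: n => [|n IH]; rewrite ?expr0 // !exprS rhoM IH. Qed.

(** This is $(\rho_{ij}\otimes\mathrm{id})\Delta(x)$. The matrix with these entries describes $x$ on
    a tensor product with $\rho$, the second factor being left universal. *)
Definition mcoef i j (x : Uq) : Uq := tens_eval (fun a b => rho a i j *: b) (Delta x).

Lemma bilin_mcoef i j : bilin (fun a b => rho a i j *: b : Uq).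
Proof.
split=> [b a u v|b a u v].
  by rewrite rhoL !mxE scalerDl scalerA.
by rewrite scalerDr !scalerA mulrC.
Qed.
Local Hint Resolve bilin_mcoef : core.

Lemma mcoef_linear i j : linear (mcoef i j).
Proof.
by move=> a u v; rewrite /mcoef DeltaD // DeltaZ // tens_evalD // tens_evalZ.
Qed.

Lemma mcoefM i j x y : mcoef i j (x * y) = \sum_k mcoef i k x * mcoef k j y.
Proof.
rewrite /mcoef DeltaM //; move: (Delta x) (Delta y) => s t.
have lc i' j' := tens_eval_linear (bilin_mcoef i' j').
elim/tens_pure_ind: s => [|s s' IH IH'|a b].
- rewrite mul0r lin0 // big1 // => k _.
  by rewrite lin0 // mul0r.
- rewrite mulrDl linD // IH IH' -big_split; apply: eq_bigr => k _ /=.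
  by rewrite [tens_eval _ (s + s')]linD // mulrDl.
elim/tens_pure_ind: t => [|t t' IH IH'|a' b'].
- rewrite mulr0 lin0 // big1 // => k _.
  by rewrite [tens_eval _ 0]lin0 // mulr0.
- rewrite mulrDr linD // IH IH' -big_split; apply: eq_bigr => k _ /=.
  by rewrite [tens_eval _ (t + t')]linD // mulrDr.
rewrite tpureM tens_eval_pure // rhoM mxE scaler_suml; apply: eq_bigr => k _.
by rewrite !tens_eval_pure // -palg_scaleAl -palg_scaleAr scalerA.
Qed.

Lemma mcoef1 i j : mcoef i j 1 = (i == j)%:R *: (1 : Uq).
Proof. by rewrite /mcoef Delta1 // -tpure1 tens_eval_pure // rho1 mxE. Qed.

Lemma mcoefE i j : mcoef i j E = (i == j)%:R *: E + rho E i j *: K.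
Proof.
by rewrite /mcoef DeltaE // /DE tens_evalD // !tens_eval_pure // rho1 mxE.
Qed.

Lemma mcoefF i j : mcoef i j F = rho F i j *: (1 : Uq) + rho Ki i j *: F.
Proof. by rewrite /mcoef DeltaF // /DF tens_evalD // !tens_eval_pure. Qed.

Lemma DeltaKX n : Delta (K ^+ n) = tpure (K ^+ n) (K ^+ n).
Proof.
by elim: n => [|n IH]; rewrite ?expr0 ?Delta1 // !exprS DeltaM // IH DeltaK // tpureM.
Qed.

Lemma mcoefKX i j n : mcoef i j (K ^+ n) = rho (K ^+ n) i j *: K ^+ n.
Proof. by rewrite /mcoef DeltaKX tens_eval_pure. Qed.

Lemma trace_linear : linear (fun x => \tr (rho x) : C^o).
Proof. by move=> a u v; rewrite rhoL linearP. Qed.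

Lemma trace_SLF : SLF (fun x => \tr (rho x) : C^o).
Proof. by split=> [|x y]; [exact: trace_linear | rewrite !rhoM mxtrace_mulC]. Qed.

(** Products by a character thereby reduce to the diagonal entries [mcoef i i], without tensors. *)
Lemma trace_mul (f : Uq -> C^o) x : linear f ->
  slf_mul (fun x => \tr (rho x) : C^o) f x = \sum_i f (mcoef i i x).
Proof.
move=> lf; rewrite /slf_mul /mcoef.
under [RHS]eq_bigr => i _ do rewrite (tens_eval_lin _ _ lf).
rewrite /tens_eval /fsum exchange_big; apply: eq_bigr => ab _ /=.
by rewrite mulr_suml; apply: eq_bigr => i _; rewrite linZ.
Qed.

(** The same contraction after applying $\Delta$ to the first factor; it stands in for a triple
    tensor product. *)
Definition tcoef i j (t : UU) : UU :=
  tens_eval (fun a b => tpure (mcoef i j a) b) t.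

Lemma bilin_tcoef i j : bilin (fun a b : Uq => tpure (mcoef i j a) b).
Proof. by apply: (bilin_tpure (g := id)) => //; exact: mcoef_linear. Qed.
Local Hint Resolve bilin_tcoef : core.

Lemma tcoefM i j s t : tcoef i j (s * t) = \sum_k tcoef i k s * tcoef k j t.
Proof.
have lc i' j' := tens_eval_linear (bilin_tcoef i' j').
rewrite /tcoef; elim/tens_pure_ind: s => [|s s' IH IH'|a b].
- rewrite mul0r lin0 // big1 // => k _.
  by rewrite lin0 // mul0r.
- rewrite mulrDl linD // IH IH' -big_split; apply: eq_bigr => k _ /=.
  by rewrite [tens_eval _ (s + s')]linD // mulrDl.
elim/tens_pure_ind: t => [|t t' IH IH'|a' b'].
- rewrite mulr0 lin0 // big1 // => k _.
  by rewrite [tens_eval _ 0]lin0 // mulr0.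
- rewrite mulrDr linD // IH IH' -big_split; apply: eq_bigr => k _ /=.
  by rewrite [tens_eval _ (t + t')]linD // mulrDr.
rewrite tpureM tens_eval_pure // mcoefM.
rewrite (big_morph (fun u => tpure u (b * b')) (fun u v => tpureDl u v _) (tpure0l _)).
by apply: eq_bigr => k _; rewrite !tens_eval_pure // tpureM.
Qed.

(* Coassociativity, applied to a matrix coefficient in the first factor. *)
Lemma Delta_mcoef x i j : Delta (mcoef i j x) = tcoef i j (Delta x).
Proof.
have lc i' j' := tens_eval_linear (bilin_tcoef i' j').
elim/(uq_ind (R := R) (p := p)): x i j => [i j|i j|i j|i j|a u IH i j|u v IHu IHv i j|u v IHu IHv i j].
- rewrite mcoefE DeltaD // !DeltaZ // DeltaE // DeltaK // /tcoef /DE /DK tens_evalD //.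
  rewrite !tens_eval_pure // mcoefE mcoef1 tpureDl !tpureZl scalerDr addrA.
  by [].
- rewrite mcoefF DeltaD // !DeltaZ // DeltaF // Delta1 // /tcoef /DF tens_evalD //.
  rewrite !tens_eval_pure // mcoefF /uKi mcoefKX tpureDl !tpureZl scalerDr addrA.
  by [].
- by rewrite -(expr1 K) mcoefKX DeltaZ // DeltaKX /tcoef tens_eval_pure // mcoefKX tpureZl.
- by rewrite mcoef1 DeltaZ // Delta1 // /tcoef -tpure1 tens_eval_pure // mcoef1 tpureZl.
- by rewrite linZ ?DeltaZ // ?IH /tcoef ?linZ //; exact: mcoef_linear.
- by rewrite linD ?DeltaD // ?IHu ?IHv /tcoef ?linD //; exact: mcoef_linear.
rewrite mcoefM DeltaM // tcoefM.
have lD : linear Delta by move=> a x y; rewrite DeltaD // DeltaZ.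
by rewrite lin_sum //; apply: eq_bigr => k _; rewrite DeltaM // IHu IHv.
Qed.

(** Associativity with a character in front suffices later: products are always unfolded from a
    simple character on the left. *)
Lemma trace_mulA (f g : Uq -> C^o) : linear f -> linear g ->
  slf_mul (slf_mul (fun x => \tr (rho x) : C^o) f) g =
  slf_mul (fun x => \tr (rho x) : C^o) (slf_mul f g).
Proof.
move=> lf lg; apply/funext => x; rewrite trace_mul; last exact: slf_mul_linear.
have bfg := bilin_forms lf lg.
have e i : slf_mul f g (mcoef i i x) =
    tens_eval (fun a b => f (mcoef i i a) * g b : C^o) (Delta x).
  rewrite /slf_mul Delta_mcoef /tcoef (tens_eval_lin _ _ (tens_eval_linear bfg)).
  congr (tens_eval _ _); apply/funext => a; apply/funext => b.
  exact: (tens_eval_pure bfg).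
under eq_bigr => i _ do rewrite e.
rewrite /slf_mul -/(slf_mul _ f) /tens_eval /fsum exchange_big.
apply: eq_bigr => ab _ /=; rewrite -mulr_suml; congr (_ * _).
exact: trace_mul.
Qed.

End MatrixCoefficients.

(** * The involution reverses the coproduct *)

Section Flip.
Local Notation om := (@omega R p).

Definition tflip (t : UU) : UU := tens_eval (fun a b => tpure (om b) (om a)) t.

Lemma omega_linear : linear om.
Proof. by move=> a u v; rewrite omegaD // omegaZ. Qed.

Lemma bilin_flip : bilin (fun a b : Uq => tpure (om b) (om a) : UU).
Proof.
by have [l r] := bilin_tpure omega_linear omega_linear; split.
Qed.
Local Hint Resolve bilin_flip : core.

Lemma tflipM s t : tflip (s * t) = tflip s * tflip t.
Proof.
have lc := tens_eval_linear bilin_flip.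
rewrite /tflip; elim/tens_pure_ind: s => [|s s' IH IH'|a b].
- by rewrite mul0r [tens_eval _ 0]lin0 // mul0r.
- by rewrite mulrDl [LHS]linD // IH IH' [tens_eval _ (s + s')]linD // mulrDl.
elim/tens_pure_ind: t => [|t t' IH IH'|a' b'].
- by rewrite mulr0 [tens_eval _ 0]lin0 // mulr0.
- by rewrite mulrDr [LHS]linD // IH IH' [tens_eval _ (t + t')]linD // mulrDr.
by rewrite tpureM !tens_eval_pure // !omegaM // tpureM.
Qed.

Lemma omegaKi : om Ki = K.
Proof.
suff -> : om Ki = Ki ^+ (2 * p).-1 by exact: uKi_pred.
rewrite {1}/uKi; elim: (_.-1) => [|n IH]; first by rewrite omega1.
by rewrite !exprS omegaM // IH omegaK.
Qed.

Lemma Delta_omega x : Delta (om x) = tflip (Delta x).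
Proof.
have lc := tens_eval_linear bilin_flip.
elim/(uq_ind (R := R) (p := p)): x => [||||a u IH|u v IHu IHv|u v IHu IHv].
- rewrite omegaE // DeltaE // DeltaF // /tflip /DE /DF tens_evalD // !tens_eval_pure //.
  by rewrite omega1 // omegaE // omegaK.
- rewrite omegaF // DeltaE // DeltaF // /tflip /DE /DF tens_evalD // !tens_eval_pure //.
  by rewrite omega1 // omegaF // omegaKi.
- rewrite omegaK // /uKi DeltaKX DeltaK // /tflip /DK tens_eval_pure // omegaK //.
- by rewrite omega1 // Delta1 // -tpure1 /tflip tens_eval_pure // omega1.
- by rewrite omegaZ // !DeltaZ // IH /tflip linZ.
- by rewrite omegaD // !DeltaD // IHu IHv /tflip linD.
- by rewrite omegaM // !DeltaM // IHu IHv tflipM.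
Qed.

Lemma slf_mul_omega (f g : Uq -> C^o) x : linear f -> linear g ->
  slf_mul f g (om x) = slf_mul (g \o om) (f \o om) x.
Proof.
move=> lf lg; have bfg := bilin_forms lf lg.
rewrite /slf_mul Delta_omega /tflip (tens_eval_lin _ _ (tens_eval_linear bfg)).
congr (tens_eval _ _); apply/funext => a; apply/funext => b.
by rewrite [LHS](tens_eval_pure bfg) mulrC.
Qed.

End Flip.
End Convolution.

(** * The Casimir element *)

Section Span.
Variables (C : comNzRingType) (V : lmodType C).
Implicit Types S T : V -> Prop.

Inductive lspan S : V -> Prop :=
| lspan0 : lspan S 0
| lspanD (c : C) (m x : V) of S m & lspan S x : lspan S (c *: m + x).

Lemma lspan_gen S m : S m -> lspan S m.
Proof. by move=> Sm; rewrite -[m]addr0 -[m]scale1r; apply: lspanD => //; apply: lspan0. Qed.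

Lemma lspan_add S x y : lspan S x -> lspan S y -> lspan S (x + y).
Proof.
elim=> [|c m {}x Sm _ IH] Sy; first by rewrite add0r.
by rewrite -addrA; apply: lspanD => //; apply: IH.
Qed.

Lemma lspan_scale S a x : lspan S x -> lspan S (a *: x).
Proof.
elim=> [|c m {}x Sm _ IH]; first by rewrite scaler0; apply: lspan0.
by rewrite scalerDr scalerA; apply: lspanD.
Qed.

Lemma lspan_opp S x : lspan S x -> lspan S (- x).
Proof. by rewrite -scaleN1r; apply: lspan_scale. Qed.

Lemma lspan_sub S T x : (forall m, S m -> T m) -> lspan S x -> lspan T x.
Proof.
move=> ST; elim=> [|c m {}x Sm _ IH]; first exact: lspan0.
by apply: lspanD => //; apply: ST.
Qed.

Lemma lspan_map S T (f : V -> V) x : linear f ->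
  (forall m, S m -> lspan T (f m)) -> lspan S x -> lspan T (f x).
Proof.
move=> lf ST; elim=> [|c m {}x Sm _ IH]; first by rewrite lin0 //; apply: lspan0.
by rewrite lf; apply: lspan_add => //; apply: lspan_scale; apply: ST.
Qed.

Lemma lspan_eq (W : lmodType C) S (f g : V -> W) x : linear f -> linear g ->
  (forall m, S m -> f m = g m) -> lspan S x -> f x = g x.
Proof.
move=> lf lg fg; elim=> [|c m {}x Sm _ IH]; first by rewrite !lin0.
by rewrite lf lg IH fg.
Qed.

End Span.

Section Casimir.
Variables (R : realType) (p : nat).
Hypothesis p_ge2 : (2 <= p)%N.
Local Notation C := R[i].
Local Notation q := (qpar R p).
Local Notation Uq := (palg (@uq_rel R p)).
Local Notation E := (uE R p).
Local Notation F := (uF R p).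
Local Notation K := (uK R p).
Local Notation Ki := (uKi R p).
Let q0 : q != 0 := qpar_neq0 R p_ge2.
Let qX0 n : q ^+ n != 0 := qparX_neq0 R p_ge2 n.
Let dq0 : q - q^-1 != 0 := qint_den_neq0 R p_ge2.

(** The normalization giving the Casimir element the values $\pm(q^s+q^{-s})$. *)
Definition theta : C := (q - q^-1) ^+ 2.

Lemma theta_neq0 : theta != 0. Proof. exact: expf_neq0. Qed.

Definition cas : Uq := theta *: (F * E) + q *: K + q^-1 *: Ki.

Lemma casFE : theta *: (F * E) = cas - q *: K - q^-1 *: Ki.
Proof. by rewrite /cas addrAC addrK addrK. Qed.

(** Exchanging $E$ and $F$ exchanges $q$ and $q^{-1}$. Hence the invariance under [omega], which
    deduces commutation with $F$ from that with $E$. *)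
Lemma cas_eqEF : cas = theta *: (E * F) + q^-1 *: K + q *: Ki.
Proof.
rewrite uEF // scalerDr scalerA scalerBr /cas -!addrA; congr (_ + _).
have -> : theta * (q - q^-1)^-1 = q - q^-1 by rewrite /theta expr2 mulfK.
have e x : q *: x = (q - q^-1) *: x + q^-1 *: x :> Uq by rewrite -scalerDl subrK.
rewrite (e K) (e Ki) [RHS](AC (1*(1*(1*2))) ((1*3)*((2*4)*5))).
by rewrite [RHS]/= addNr add0r.
Qed.

Lemma casEF : theta *: (E * F) = cas - q^-1 *: K - q *: Ki.
Proof. by rewrite cas_eqEF [_ + q *: Ki]addrC [q *: Ki + _]addrC addrAC addrK addrK. Qed.

Lemma omega_cas : omega cas = cas.
Proof.
rewrite {1}/cas !omegaD // !omegaZ // omegaM // omegaE // omegaF // omegaK // omegaKi //.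
by rewrite cas_eqEF addrAC.
Qed.

Lemma cas_K : cas * K = K * cas.
Proof.
rewrite /cas !(mulrDl, mulrDr) -!palg_scaleAl -!palg_scaleAr uKKi // uKiK //.
congr (_ *: _ + _ + _); rewrite mulrA uKF -palg_scaleAl -!mulrA uKE -palg_scaleAr.
by rewrite scalerA mulVf ?scale1r // expf_neq0.
Qed.

Lemma cas_E : cas * E = E * cas.
Proof.
rewrite {1}cas_eqEF /cas !(mulrDl, mulrDr) -!palg_scaleAl -!palg_scaleAr mulrA.
rewrite uKE // uKiE // !scalerA; congr (_ + _ *: _ + _ *: _).
  by rewrite expr2 mulKf.
by rewrite -exprVn expr2 mulVKf.
Qed.

Lemma cas_F : cas * F = F * cas.
Proof.
have := congr1 (@omega R p) cas_E.
by rewrite !omegaM // omegaE // omega_cas.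
Qed.

Lemma cas_central x : cas * x = x * cas.
Proof.
elim/(uq_ind (R := R) (p := p)): x => [||||a u IH|u v IHu IHv|u v IHu IHv].
- exact: cas_E.
- exact: cas_F.
- exact: cas_K.
- by rewrite mul1r mulr1.
- by rewrite -palg_scaleAr -palg_scaleAl IH.
- by rewrite [LHS]mulrDr [RHS]mulrDl IHu IHv.
- by rewrite (mulrA cas) IHu -(mulrA u) IHv (mulrA u).
Qed.

Lemma casX_central n x : cas ^+ n * x = x * cas ^+ n.
Proof.
elim: n => [|n IH]; first by rewrite !expr0 mul1r mulr1.
by rewrite exprS -mulrA IH mulrA cas_central -mulrA.
Qed.

Definition cvalue (f : Uq -> C^o) n j : C := f (cas ^+ n * K ^+ j).

Lemma KX_E l : K ^+ l * E = (q ^+ 2) ^+ l *: (E * K ^+ l).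
Proof.
elim: l => [|l IH]; first by rewrite !expr0 mul1r mulr1 scale1r.
rewrite exprSr -mulrA uKE -palg_scaleAr (mulrA _ E) IH -palg_scaleAl scalerA -mulrA.
by rewrite -exprS.
Qed.

Lemma KX_F l : K ^+ l * F = (q ^- 2) ^+ l *: (F * K ^+ l).
Proof.
elim: l => [|l IH]; first by rewrite !expr0 mul1r mulr1 scale1r.
rewrite exprSr -mulrA uKF -palg_scaleAr (mulrA _ F) IH -palg_scaleAl scalerA -mulrA.
by rewrite -exprS.
Qed.

Lemma E_KX l : E * K ^+ l = (q ^- 2) ^+ l *: (K ^+ l * E).
Proof. by rewrite KX_E scalerA -exprMn mulVf ?expf_neq0 // expr1n scale1r. Qed.

Lemma F_KX l : F * K ^+ l = (q ^+ 2) ^+ l *: (K ^+ l * F).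
Proof. by rewrite KX_F scalerA -exprMn mulfV ?expf_neq0 // expr1n scale1r. Qed.

Lemma K_FX n : F ^+ n * K = (q ^+ 2) ^+ n *: (K * F ^+ n).
Proof.
elim: n => [|n IH]; first by rewrite !expr0 mul1r mulr1 scale1r.
rewrite exprSr -mulrA -{1}[K]expr1 F_KX !expr1 -palg_scaleAr (mulrA _ K) IH.
by rewrite -palg_scaleAl scalerA -exprS -mulrA.
Qed.

Lemma Ki_FX n : F ^+ n * Ki = (q ^- 2) ^+ n *: (Ki * F ^+ n).
Proof.
rewrite -[F ^+ n in LHS]mul1r -(uKiK R p_ge2) -!mulrA (mulrA K) -[K * _]scale1r.
have <- : (q ^- 2) ^+ n * (q ^+ 2) ^+ n = 1 by rewrite -exprMn mulVf ?expf_neq0 // expr1n.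
by rewrite -scalerA -K_FX -palg_scaleAl -palg_scaleAr -(mulrA _ K) uKKi // mulr1.
Qed.

(* The spanning monomials of degree at most [d], [E] and [F] having degree 1
   and the Casimir element degree 2. *)
Definition mon_le (d : nat) (x : Uq) : Prop :=
  exists (a l w : nat) (b : bool), (2 * a + w <= d)%N /\
    x = cas ^+ a * (K ^+ l * (if b then E else F) ^+ w).

Definition nform d : Uq -> Prop := lspan (mon_le d).

Lemma nform_mon d a l w (b : bool) : (2 * a + w <= d)%N ->
  nform d (cas ^+ a * (K ^+ l * (if b then E else F) ^+ w)).
Proof. by move=> ?; apply: lspan_gen; exists a, l, w, b. Qed.

Lemma nform_le d d' x : (d <= d')%N -> nform d x -> nform d' x.
Proof.
move=> le; apply: lspan_sub => m [a [l [w [b [ad ->]]]]].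
by exists a, l, w, b; split=> //; apply: leq_trans le.
Qed.

Lemma mull_linear (u : Uq) : linear (fun x : Uq => u * x).
Proof. by move=> a x y; rewrite mulrDr -palg_scaleAr. Qed.

Lemma nform_casl d x : nform d x -> nform d.+2 (cas * x).
Proof.
apply: lspan_map; first exact: mull_linear.
move=> m [a [l [w [b [ad ->]]]]]; rewrite mulrA -exprS; apply: nform_mon; lia.
Qed.

Lemma nform_Kl d x : nform d x -> nform d (K * x).
Proof.
apply: lspan_map; first exact: mull_linear.
move=> m [a [l [w [b [ad ->]]]]]; rewrite mulrA -casX_central -mulrA (mulrA K) -exprS.
exact: nform_mon.
Qed.

Lemma nform_KXl d n x : nform d x -> nform d (K ^+ n * x).
Proof.
move=> nx; elim: n => [|n IH]; first by rewrite mul1r.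
by rewrite exprS -mulrA; apply: nform_Kl.
Qed.

Lemma nform_shift d a l x : nform d x -> nform (2 * a + d) (cas ^+ a * (K ^+ l * x)).
Proof.
move=> nx; elim: a => [|a IH]; first by rewrite mul1r; apply: nform_KXl.
by rewrite exprS -mulrA mulnS -addnA; apply: (nform_casl IH).
Qed.

Lemma scaled_FE x : F * E * x = theta^-1 *: (cas * x - q *: (K * x) - q^-1 *: (Ki * x)).
Proof.
rewrite -[F * E](scalerK theta_neq0) casFE -palg_scaleAl !mulrDl !mulNr.
by rewrite -!palg_scaleAl.
Qed.

Lemma scaled_EF x : E * F * x = theta^-1 *: (cas * x - q^-1 *: (K * x) - q *: (Ki * x)).
Proof.
rewrite -[E * F](scalerK theta_neq0) casEF -palg_scaleAl !mulrDl !mulNr.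
by rewrite -!palg_scaleAl.
Qed.

(** When $E$ meets a power of $F$, the product $EF$, of degree 2, becomes a combination of the
    Casimir element, also of degree 2, and of $K^{\pm1}$, of degree 0. *)
Lemma nform_El d x : nform d x -> nform d.+1 (E * x).
Proof.
apply: lspan_map; first exact: mull_linear.
move=> m [a [l [w [b [ad ->]]]]]; rewrite mulrA -casX_central -mulrA (mulrA E) E_KX.
rewrite -palg_scaleAl -palg_scaleAr; apply: lspan_scale; rewrite -mulrA.
case: b w ad => [w ad|[|w] ad].
- by rewrite -exprS; apply: (@nform_mon _ a l w.+1 true); lia.
- by rewrite expr0 -(expr0 E) -exprS; apply: (@nform_mon _ a l 1 true); lia.
rewrite exprS (mulrA E) scaled_EF -!palg_scaleAr; apply: lspan_scale.
have n0 : nform (d - 2 * a).-1 (F ^+ w).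
  by have := @nform_mon (d - 2 * a).-1 0 0 w false; rewrite !mul1r; apply; lia.
apply: (@nform_le (2 * a + (d - 2 * a).-1.+2)); first by lia.
apply: nform_shift; apply: lspan_add; [apply: lspan_add|].
- exact: nform_casl.
- by apply/lspan_opp/lspan_scale; apply: nform_le (nform_Kl n0); lia.
- by apply/lspan_opp/lspan_scale; apply: nform_le (nform_KXl _ n0); lia.
Qed.

Lemma nform_Fl d x : nform d x -> nform d.+1 (F * x).
Proof.
apply: lspan_map; first exact: mull_linear.
move=> m [a [l [w [b [ad ->]]]]]; rewrite mulrA -casX_central -mulrA (mulrA F) F_KX.
rewrite -palg_scaleAl -palg_scaleAr; apply: lspan_scale; rewrite -mulrA.
case: b w ad => [[|w] ad|w ad]; last first.
- by rewrite -exprS; apply: (@nform_mon _ a l w.+1 false); lia.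
- rewrite exprS (mulrA F) scaled_FE -!palg_scaleAr; apply: lspan_scale.
have n0 : nform (d - 2 * a).-1 (E ^+ w).
  by have := @nform_mon (d - 2 * a).-1 0 0 w true; rewrite !mul1r; apply; lia.
apply: (@nform_le (2 * a + (d - 2 * a).-1.+2)); first by lia.
apply: nform_shift; apply: lspan_add; [apply: lspan_add|].
- exact: nform_casl.
- by apply/lspan_opp/lspan_scale; apply: nform_le (nform_Kl n0); lia.
- by apply/lspan_opp/lspan_scale; apply: nform_le (nform_KXl _ n0); lia.
by rewrite expr0 -(expr0 F) -exprS; apply: (@nform_mon _ a l 1 false); lia.
Qed.

Lemma nform_all x : exists d, nform d x.
Proof.
(* Stability under left multiplication passes through products; the claim is the case $y=1$. *)
suff H d y : nform d y -> exists d', nform d' (x * y).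
  have n1 : nform 0 1 by have := @nform_mon 0 0 0 0 true; rewrite !mul1r; apply.
  by have [d' n'] := H _ _ n1; exists d'; rewrite mulr1 in n'.
elim/(uq_ind (R := R) (p := p)): x d y => [||||a u IH|u v IHu IHv|u v IHu IHv] d y ny.
- by exists d.+1; apply: nform_El.
- by exists d.+1; apply: nform_Fl.
- by exists d; apply: nform_Kl.
- by exists d; rewrite mul1r.
- by have [d' n'] := IH d y ny; exists d'; rewrite -palg_scaleAl; apply: lspan_scale.
- have [d1 n1] := IHu d y ny; have [d2 n2] := IHv d y ny; exists (maxn d1 d2).
  rewrite mulrDl; apply: lspan_add; [apply: nform_le n1|apply: nform_le n2]; lia.
have [d1 n1] := IHv d y ny; have [d2 n2] := IHu _ _ n1.
by exists d2; rewrite -mulrA.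
Qed.

End Casimir.

(** * Values of symmetric linear forms *)

Section Values.
Variables (R : realType) (p : nat).
Hypothesis p_ge2 : (2 <= p)%N.
Local Notation C := R[i].
Local Notation q := (qpar R p).
Local Notation Uq := (palg (@uq_rel R p)).
Local Notation E := (uE R p).
Local Notation F := (uF R p).
Local Notation K := (uK R p).
Local Notation Ki := (uKi R p).
Local Notation cas := (cas R p).
Local Notation theta := (theta R p).
Local Notation cval := (cval R p).
Local Notation wgt := (@wgt R p).
Let q0 : q != 0 := qpar_neq0 R p_ge2.
Let qX0 n : q ^+ n != 0 := qparX_neq0 R p_ge2 n.
Let dq0 : q - q^-1 != 0 := qint_den_neq0 R p_ge2.

Lemma K_EX n : E ^+ n * K = (q ^- 2) ^+ n *: (K * E ^+ n).
Proof.
elim: n => [|n IH]; first by rewrite !expr0 mul1r mulr1 scale1r.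
rewrite exprSr -mulrA -{1}[K]expr1 E_KX // !expr1 -palg_scaleAr (mulrA _ K) IH.
by rewrite -palg_scaleAl scalerA -exprS -mulrA.
Qed.

(** By symmetry, $f(m)=f(mKK^{-1})=c\,f(KmK^{-1})=c\,f(m)$. *)
Lemma slf_twist (f : Uq -> C^o) m c : SLF f -> m * K = c *: (K * m) -> c != 1 -> f m = 0.
Proof.
move=> [lf sf] mK c1.
have e : f m = c * f m.
  rewrite -{1}[m]mulr1 -(uKKi R p_ge2) mulrA mK -palg_scaleAl linZ // -mulrA sf.
  by rewrite -mulrA uKiK // mulr1.
apply/eqP; rewrite -(inj_eq (mulfI (_ : 1 - c != 0))) ?mulr0 ?subr_eq0 1?eq_sym //.
by rewrite mulrBl mul1r -e subrr.
Qed.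

(** For $0<w<p$ the weight $q^{\pm2w}$ differs from 1; from $w=p$ on the monomial is zero. *)
Lemma slf_mon (f : Uq -> C^o) a l w (b : bool) : SLF f -> (0 < w)%N ->
  f (cas ^+ a * (K ^+ l * (if b then E else F) ^+ w)) = 0.
Proof.
move=> sf w0; have [lf _] := sf.
have [pw|wp] := leqP p w.
  have -> : (if b then E else F) ^+ w = 0.
    by rewrite -(subnK pw) exprD; case: b; rewrite ?uEp ?uFp // mulr0.
  by rewrite !mulr0 lin0.
apply: (@slf_twist _ _ ((if b then q ^- 2 else q ^+ 2) ^+ w)) => //; last first.
  case: b; rewrite ?exprVn ?invr_eq1 -exprM; apply: qparX_neq1 => //; lia.
have -> : (if b then E else F) ^+ w = if b then E ^+ w else F ^+ w by case: b.
rewrite -!mulrA.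
have -> : (if b then E ^+ w else F ^+ w) * K =
    (if b then q ^- 2 else q ^+ 2) ^+ w *: (K * if b then E ^+ w else F ^+ w).
  by case: b; [exact: K_EX|exact: K_FX].
rewrite -!palg_scaleAr; congr (_ *: _).
by rewrite [RHS]mulrA -casX_central // -!mulrA; congr (_ * _); rewrite !mulrA -exprS -exprSr.
Qed.

Definition low n : Uq -> Prop :=
  lspan (fun x => exists a l, (a < n)%N /\ x = cas ^+ a * K ^+ l).

Lemma low_mon n a l : (a < n)%N -> low n (cas ^+ a * K ^+ l).
Proof. by move=> an; apply: lspan_gen; exists a, l. Qed.

Lemma low_le n n' x : (n <= n')%N -> low n x -> low n' x.
Proof.
move=> le; apply: lspan_sub => m [a [l [an ->]]].
by exists a, l; split=> //; apply: leq_trans le.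
Qed.

Lemma low_cas n x : low n x -> low n.+1 (cas * x).
Proof.
apply: lspan_map; first exact: mull_linear.
by move=> m [a [l [an ->]]]; rewrite mulrA -exprS; apply: low_mon.
Qed.

Lemma low_KX n k x : low n x -> low n (K ^+ k * x).
Proof.
apply: lspan_map; first exact: mull_linear.
move=> m [a [l [an ->]]]; rewrite mulrA -casX_central // -mulrA -exprD.
exact: low_mon.
Qed.

Lemma low_mulr n b l x : low n x -> low (n + b) (x * (cas ^+ b * K ^+ l)).
Proof.
apply: (lspan_map (f := fun y : Uq => y * (cas ^+ b * K ^+ l))) => [a x' y|m [a [k [an ->]]]].
  by rewrite mulrDl -palg_scaleAl.
rewrite -mulrA (mulrA (K ^+ k)) -casX_central // -mulrA mulrA -!exprD.
by apply: low_mon; rewrite ltn_add2r.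
Qed.

(** The innermost $FE$ of $F^{n+1}E^{n+1}$ is expressed by the central element $c$ and by
    $K^{\pm1}$, which moves left through $F^n$. At $n=p$ the left side vanishes, and $c^p$ reduces
    to lower powers. *)
Lemma theta_FXEX n : exists2 x, low n x & theta ^+ n *: (F ^+ n * E ^+ n) = cas ^+ n + x.
Proof.
elim: n => [|n [x nx e]].
  by exists 0; [exact: lspan0|rewrite !expr0 scale1r mulr1 addr0].
have step : theta ^+ n.+1 *: (F ^+ n.+1 * E ^+ n.+1) =
    cas * (cas ^+ n + x) - (q * (q ^+ 2) ^+ n) *: (K * (cas ^+ n + x))
    - (q^-1 * (q ^- 2) ^+ n) *: (Ki * (cas ^+ n + x)).
  rewrite -e -!palg_scaleAr !(scalerA _ (theta ^+ n)) !(mulrC _ (theta ^+ n)).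
  rewrite -!scalerA -!scalerBr (exprSr F) (exprS E) -mulrA (mulrA F) scaled_FE //.
  rewrite -palg_scaleAr [LHS]scalerA (exprSr theta) mulfK ?theta_neq0 //; congr (_ *: _).
  rewrite !mulrBr -!palg_scaleAr !(mulrA (F ^+ n)) -cas_central // K_FX // Ki_FX //.
  by rewrite -!palg_scaleAl !scalerA -!mulrA.
exists (cas * x - (q * (q ^+ 2) ^+ n) *: (K * (cas ^+ n + x))
    - (q^-1 * (q ^- 2) ^+ n) *: (Ki * (cas ^+ n + x))); last first.
  by rewrite step mulrDr -exprS !addrA.
have n1 : low n.+1 (cas ^+ n + x).
  apply: lspan_add; last exact: low_le nx.
  by rewrite -[cas ^+ n]mulr1 -(expr0 K); apply: low_mon.
apply: lspan_add; [apply: lspan_add|]; first exact: low_cas.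
  by apply/lspan_opp/lspan_scale; rewrite -[K in K * _]expr1; apply: low_KX.
by apply/lspan_opp/lspan_scale; apply: low_KX.
Qed.

Lemma low_casp a l : (p <= a)%N -> low a (cas ^+ a * K ^+ l).
Proof.
move=> pa; have [x px] := theta_FXEX p.
rewrite uEp mulr0 scaler0 => /esym/eqP; rewrite addr_eq0 => /eqP e.
rewrite -(subnKC pa) exprD -mulrA e mulNr; apply: lspan_opp.
exact: low_mulr.
Qed.

Lemma slf_ext (f g : Uq -> C^o) : SLF f -> SLF g ->
  (forall n j, (n < p)%N -> cvalue f n j = cvalue g n j) -> f = g.
Proof.
move=> sf sg fg; have [lf _] := sf; have [lg _] := sg.
have fg' n j : cvalue f n j = cvalue g n j.
  (* Exponents $n\ge p$ descend by [low_casp]. *)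
  elim/ltn_ind: n j => n IH j; have [pn|] := leqP p n; last exact: fg.
  apply: lspan_eq (low_casp j pn) => // m [a [l [an ->]]]; exact: IH.
apply/funext => x; have [d nx] := nform_all p_ge2 x.
apply: lspan_eq nx => // m [a [l [w [b [_ ->]]]]].
case: w => [|w]; last by rewrite !slf_mon.
by rewrite expr0 mulr1; apply: fg'.
Qed.

Definition wsum a s j : C := \sum_(i < s) wgt a s i ^+ j.

Lemma simple_cas a s : (s <= p)%N ->
  simple_rep a s cas = (sgn R a * cval s)%:M.
Proof.
move=> sp; have [rep [rE rF rK]] := simple_repP R p_ge2 a sp.
have [rL r1 rM] := rep.
have rl : linear (simple_rep a s : Uq -> _) by [].
rewrite /cas !(linD rl) !(linZ rl) rM rF rE /uKi (repX rep) rK.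
rewrite simple_mulFE // simpleKE // dgmX -!mul_scalar_mx !dgmZ !dgmD -dgm_const.
apply: dgm_ext => i lt_is; rewrite entE ?(ltnW lt_is) // wgtV //; ring.
Qed.

Lemma val_chi a s n j : (s <= p)%N ->
  cvalue (chi R p a s) n j = (sgn R a * cval s) ^+ n * wsum a s j.
Proof.
move=> sp; have [rep [rE rF rK]] := simple_repP R p_ge2 a sp.
have [rL r1 rM] := rep.
rewrite /cvalue /chi rM !(repX rep) simple_cas // rK simpleKE // dgmX.
rewrite -rmorphXn mul_scalar_mx mxtraceZ dgm_tr.
by [].
Qed.

Section ProjectiveValues.
Variables (a : bool) (m n : nat).
Hypotheses (m_gt0 : (0 < m)%N) (n_gt0 : (0 < n)%N) (mnp : (m + n = p)%N).

(** The two kinds of simple factors of a projective module share their Casimir value. *)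
Lemma sgn_cval_opp : sgn R (~~ a) * cval n = sgn R a * cval m.
Proof.
by rewrite sgnN (_ : n = (p - m)%N) ?cval_sub ?mulrNN //; lia.
Qed.

Lemma grep_cas : grep a m n cas =
  projblock (sgn R a * cval m)%:M (sgn R a * cval m)%:M 0 0 0 0 theta%:M.
Proof.
have [rep [rE rF rK]] := grepP R p_ge2 a m_gt0 n_gt0 mnp.
have [rL r1 rM] := rep.
have rl : linear (grep a m n : Uq -> _) by [].
rewrite /cas !(linD rl) !(linZ rl) rM rF rE /uKi (repX rep) rK.
rewrite gproj_FE // gprojKX /gprojK !simpleKE // !dgmX -!mul_scalar_mx.
rewrite projblock_scale !projblock_scale0 !projblock_addl !mulmx0 mulmx1 !dgmZ !dgmD.
rewrite -{2}sgn_cval_opp -!dgm_const.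
congr projblock; apply: dgm_ext => i lt_is; rewrite entE ?(ltnW lt_is) // wgtV //; ring.
Qed.

(** The corner squares to zero, so a power is a first-order Taylor expansion: the origin of the
    derivative in $G_s$. At [i = 0] the factor [i%:R] neutralizes the truncated exponent. *)
Lemma projblock_casX (F0 : fieldType) k l (x t : F0) i :
  projblock (x%:M : 'M_k) (x%:M : 'M_l) 0 0 0 0 t%:M ^+ i =
  projblock (x ^+ i)%:M (x ^+ i)%:M 0 0 0 0 (i%:R * x ^+ i.-1 * t)%:M.
Proof.
elim: i => [|i IH]; first by rewrite !expr0 mul0r mul0r raddf0 [RHS]projblock_scalar.
rewrite exprS IH [LHS]projblockM !mulmx0 !mul0mx !addr0 -!scalar_mxM -!raddfD /= -exprS.
congr projblock; congr _%:M; case: i {IH} => [|i] /=; rewrite ?exprS; ring.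
Qed.

Lemma val_grep i j :
  \tr (dlsubmx (dlsubmx (grep a m n (cas ^+ i * K ^+ j)))) =
  theta * (i%:R * (sgn R a * cval m) ^+ i.-1) * wsum a m j.
Proof.
have [rep [rE rF rK]] := grepP R p_ge2 a m_gt0 n_gt0 mnp.
have [rL r1 rM] := rep.
rewrite rM !(repX rep) rK grep_cas projblock_casX gprojKX projblock_mulr projblock_corner.
by rewrite simpleKE // dgmX mul_scalar_mx mxtraceZ dgm_tr [X in X * _]mulrC.
Qed.

End ProjectiveValues.

Lemma val_G s n j : (0 < s < p)%N -> cvalue (Gform R p s) n j =
  theta * (n%:R * cval s ^+ n.-1) * (wsum false s j + wsum true (p - s) j).
Proof.
move=> sp; rewrite /cvalue GformE // !val_grep //; try lia.
have -> : sgn R true * cval (p - s) = cval s.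
  by rewrite cval_sub ?mulrNN ?mul1r //; lia.
by rewrite /sgn expr0 mul1r mulrDr.
Qed.

End Values.

(** * Multiplication by the two-dimensional character *)

Section FusionOperator.
Variables (F : fieldType) (q : F).
Hypothesis q0 : q != 0.

(* The effect of multiplying a form by [chi^+_2] on its values at the elements
   [cas ^+ n * K ^+ j]; the recursion is the quadratic equation satisfied by
   the action of the Casimir element on the tensor product with the
   2-dimensional module. *)
Fixpoint fus (n : nat) (v : nat -> nat -> F) (j : nat) {struct n} : F :=
  match n with
  | 0 => (q ^+ j + q ^- j) * v 0 j
  | m.+1 => match m with
    | 0 => (q ^+ j / q + q / q ^+ j) * v 1 j +
        ((q ^+ 2 - 1) * q ^+ j + (q ^- 2 - 1) / q ^+ j) * v 0 j.+1
    | k.+1 => (q + q^-1) * fus m (fun n => v n.+1) j - fus k (fun n => v n.+2) j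
        - (q - q^-1) ^+ 2 * fus k v j
    end
  end.

Lemma fusSS n v j : fus n.+2 v j =
  (q + q^-1) * fus n.+1 (fun n => v n.+1) j - fus n (fun n => v n.+2) j
    - (q - q^-1) ^+ 2 * fus n v j.
Proof. by []. Qed.

Lemma nat_ind2 (P : nat -> Prop) :
  P 0%N -> P 1%N -> (forall n, P n -> P n.+1 -> P n.+2) -> forall n, P n.
Proof.
move=> P0 P1 PS n; suff [] : P n /\ P n.+1 by [].
by elim: n => [|n [? ?]]; split=> //; apply: PS.
Qed.

Lemma fus_lin a b n v w j :
  fus n (fun n j => a * v n j + b * w n j) j = a * fus n v j + b * fus n w j.
Proof.
elim/nat_ind2: n v w => [v w|v w|n IH IH1 v w].
- by rewrite /=; ring.
- by rewrite /=; move: (q ^- 2) (q ^- j) (q^-1) => x y z; ring.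
have e1 := IH1 (fun n => v n.+1) (fun n => w n.+1); cbv beta in e1.
have e2 := IH (fun n => v n.+2) (fun n => w n.+2); cbv beta in e2.
by rewrite !fusSS e1 e2 IH; move: (fus _ _) => f; ring.
Qed.

Lemma fus_scale a n v j : fus n (fun n j => a * v n j) j = a * fus n v j.
Proof.
rewrite -[RHS]addr0 -[X in _ + X](mul0r (fus n v j)) -fus_lin.
by congr (fus _ _ _); apply/funext => m; apply/funext => k; rewrite mul0r addr0.
Qed.

Section Geometric.
Variables (z : F) (w a b : nat -> F).
Hypothesis z0 : z != 0.
Let c := z + z^-1.
Let cp := q * z + (q * z)^-1.
Let cm := z / q + q / z.
Let rec1 : cp + cm = (q + q^-1) * c.
Proof. by rewrite /cp /cm /c; field; rewrite z0 q0. Qed.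
Let rec2 : cp * cm = c ^+ 2 + (q - q^-1) ^+ 2.
Proof. by rewrite /cp /cm /c; field; rewrite z0 q0. Qed.

(** On values geometric in $n$ with ratio $c=z+z^{-1}$, the recursion has characteristic polynomial
    $X^2-(q+q^{-1})cX+c^2+(q-q^{-1})^2$. Its roots [cp] and [cm] are the Casimir values for $qz$ and
    $z/q$; the hypotheses are the initial conditions. *)
Lemma fus_geom n j :
  (q ^+ j + q ^- j) * w j = a j + b j ->
  (q ^+ j / q + q / q ^+ j) * (c * w j) +
    ((q ^+ 2 - 1) * q ^+ j + (q ^- 2 - 1) / q ^+ j) * w j.+1 = cp * a j + cm * b j ->
  fus n (fun n j => c ^+ n * w j) j = cp ^+ n * a j + cm ^+ n * b j.
Proof.
move=> H0 H1; elim/nat_ind2: n => [||n IH IH1]; rewrite ?fusSS.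
- by rewrite /= !mul1r.
- by rewrite /= !expr1 mul1r.
rewrite [in fus n.+1 _ _](_ : (fun _ => _) = (fun n j => c * (c ^+ n * w j))); last first.
  by apply/funext => m; apply/funext => k; rewrite exprS mulrA.
rewrite [X in _ - X - _](_ : _ = fus n (fun n j => c ^+ 2 * (c ^+ n * w j)) j); last first.
  congr (fus _ _ _); apply/funext => m; apply/funext => k.
  by rewrite mulrA -exprD.
rewrite !fus_scale IH IH1 mulrA -rec1 -addrA -opprD -mulrDl -rec2 !exprS.
by move: cp cm (cp ^+ n) (cm ^+ n) => x y x' y'; ring.
Qed.

End Geometric.

Section Cyclic.
Variables (z : F) (w a : nat -> F).
Hypotheses (z0 : z != 0) (wa : forall j, q ^+ j * w j = a j)
  (wa' : forall j, q ^- j * w j = a j).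
Let c := z + z^-1.
Let cp := q * z + (q * z)^-1.
Let cm := z / q + q / z.

Let cyc_step j : ((q ^+ 2 - 1) * q ^+ j + (q ^- 2 - 1) / q ^+ j) * w j.+1 = 0.
Proof.
have e1 : q ^+ j * w j.+1 = q^-1 * a j.+1 by rewrite -wa exprS -mulrA mulKf.
have e2 : q ^- j * w j.+1 = q * a j.+1 by rewrite -wa' exprS invfM -mulrA mulVKf.
by rewrite mulrDl -!mulrA e1 e2; field.
Qed.

(** For weights forming a full cycle, multiplication by $q^j$ and by $q^{-j}$ agree, so the [j.+1]
    term of the recursion cancels and both roots carry the same weight sum. *)
Lemma fus_cyc n j :
  fus n (fun n j => c ^+ n * w j) j = cp ^+ n * a j + cm ^+ n * a j.
Proof.
apply: fus_geom => //; first by rewrite mulrDl wa wa'.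
rewrite cyc_step addr0 mulrDl.
rewrite (_ : q ^+ j / q * (c * w j) = q^-1 * c * (q ^+ j * w j)); last by ring.
rewrite (_ : q / q ^+ j * (c * w j) = q * c * (q ^- j * w j)); last by ring.
by rewrite wa wa' /c /cp /cm; field; rewrite z0 q0.
Qed.

(** The image of [fus_cyc] under $z\,d/dz$, as $z\,dc/dz=z-z^{-1}$ and similarly for [cp] and [cm].
    This explains the factors $q^k-q^{-k}$, hence the quantum integers, in the rules for $G$. *)
Lemma fus_cyc_deriv n j :
  fus n (fun n j => (z - z^-1) * (n%:R * c ^+ n.-1) * w j) j =
  (q * z - (q * z)^-1) * (n%:R * cp ^+ n.-1) * a j
  + (z / q - q / z) * (n%:R * cm ^+ n.-1) * a j.
Proof.
set v := fun n j => _; set d := z - z^-1.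
have v1 : (fun n => v n.+1) = fun n j => c * v n j + d * (c ^+ n * w j).
  apply/funext => m; apply/funext => k; rewrite /v -/d /=.
  by case: m => [|m] /=; rewrite ?exprS -?natr1; ring.
have v2 : (fun n => v n.+2) = fun n j => c ^+ 2 * v n j + (2 * c * d) * (c ^+ n * w j).
  apply/funext => m; apply/funext => k; rewrite /v -/d /=.
  by case: m => [|m] /=; rewrite ?exprS -?natr1; ring.
elim/nat_ind2: n => [||n IH IH1]; rewrite ?fusSS.
- by rewrite /= /v !mul0r !mulr0 !mul0r !mulr0 addr0.
- rewrite /= /v -/d !mul1r mul0r mulr0 mul0r mulr0 addr0 !mulr1 mulrDl.
  rewrite (_ : q ^+ j / q * (d * w j) = q^-1 * d * (q ^+ j * w j)); last by ring.
  rewrite (_ : q / q ^+ j * (d * w j) = q * d * (q ^- j * w j)); last by ring.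
  by rewrite wa wa' /d; field; rewrite z0 q0.
rewrite v1 v2 !fus_lin !fus_cyc IH IH1.
case: n {IH IH1} => [|n] /=; rewrite ?exprS -?natr1 ?(expr0, mul0r, mulr0).
  by rewrite /d /c /cp /cm; field; rewrite z0 q0.
move: (cp ^+ n) (cm ^+ n) => x y.
by rewrite /d /c /cp /cm; field; rewrite z0 q0.
Qed.

End Cyclic.
End FusionOperator.

(** * Power sums of weights and their fusion *)

Section WeightSums.
Variables (R : realType) (p : nat).
Hypothesis p_ge2 : (2 <= p)%N.
Local Notation C := R[i].
Local Notation q := (qpar R p).
Local Notation cval := (cval R p).
Local Notation wsum := (@wsum R p).
Let q0 : q != 0 := qpar_neq0 R p_ge2.
Let qX0 n : q ^+ n != 0 := qparX_neq0 R p_ge2 n.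

(* Power sums of the [K]-weights of a [p]-dimensional Verma module. *)
Definition cyc k j : C := \sum_(i < p) (q ^+ k / q / q ^+ (2 * i)) ^+ j.

Lemma cyc_up k j : q ^+ j * cyc k j = cyc k.+1 j.
Proof.
rewrite /cyc mulr_sumr; apply: eq_bigr => i _; rewrite -exprMn; congr (_ ^+ _).
by rewrite exprS !mulrA.
Qed.

(** Dividing the weights by $q$ shifts the index by one relative to the cycle of $k+1$; $q^{2p}=1$
    closes the cycle. *)
Lemma cyc_down k j : q ^- j * cyc k j = cyc k.+1 j.
Proof.
rewrite /cyc mulr_sumr.
rewrite (eq_bigr (fun i : 'I_p => (q ^+ k.+1 / q / q ^+ (2 * i.+1)) ^+ j)); last first.
  move=> i _; rewrite -exprVn -exprMn; congr (_ ^+ _).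
  by rewrite mulnS exprD !exprS; field; rewrite q0 qX0.
have /andP[/prednK <- _] : (0 < p <= p)%N by lia.
rewrite big_ord_recr [RHS]big_ord_recl /= addrC; congr (_ + _).
by rewrite prednK; [rewrite qpar_order // muln0 expr0|lia].
Qed.

Lemma cycSS k j : cyc k.+2 j = cyc k j.
Proof. by rewrite -cyc_up -cyc_down mulrA mulfV ?qX0 // mul1r. Qed.

(** The spectrum of $K$ on a Verma module consists of all $2p$-th roots of unity of one parity. This
    is the source of the parity classes. *)
Lemma cyc_parity k l j : odd k = odd l -> cyc k j = cyc l j.
Proof.
have H n : cyc n j = cyc (odd n) j.
  by elim/nat_ind2: n => // n IH _; rewrite cycSS IH /= negbK.
by move=> kl; rewrite H kl -H.
Qed.

Lemma wsum_cyc s j : (s <= p)%N -> wsum false s j + wsum true (p - s) j = cyc s j.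
Proof.
move=> sp.
have split (f : nat -> C) : \sum_(i < p) f i = \sum_(i < s) f i + \sum_(i < p - s) f (s + i)%N.
  transitivity (\sum_(i < s + (p - s)) f i); first by rewrite subnKC.
  by rewrite big_split_ord.
rewrite /cyc (split (fun i => (q ^+ s / q / q ^+ (2 * i)) ^+ j)); congr (_ + _).
  by apply: eq_bigr => i _; rewrite /wgt /sgn expr0 mul1r.
apply: eq_bigr => i _; rewrite /wgt qparXB // /sgn expr1 !mulN1r !mulNr opprK.
congr (_ ^+ _); have -> : q ^+ (2 * (s + i)) = q ^+ s * q ^+ s * q ^+ (2 * i).
  by rewrite -!exprD; congr (_ ^+ _); lia.
by field; rewrite !qX0 q0.
Qed.

Lemma fus_zeta k n j :
  fus q n (fun n j => cval k.+1 ^+ n * cyc k.+1 j) j =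
  cval k.+2 ^+ n * cyc k.+2 j + cval k ^+ n * cyc k j.
Proof.
rewrite (fus_cyc q0 (qX0 k.+1) (cyc_up k.+1) (cyc_down k.+1)).
have e : q ^+ k.+1 / q = q ^+ k by rewrite exprSr mulfK.
by rewrite -exprS e -invf_div e cycSS.
Qed.

Lemma fus_gval k n j :
  fus q n (fun n j => (q ^+ k.+1 - q ^- k.+1) * (n%:R * cval k.+1 ^+ n.-1) * cyc k.+1 j) j =
  (q ^+ k.+2 - q ^- k.+2) * (n%:R * cval k.+2 ^+ n.-1) * cyc k.+2 j +
  (q ^+ k - q ^- k) * (n%:R * cval k ^+ n.-1) * cyc k j.
Proof.
rewrite (fus_cyc_deriv q0 (qX0 k.+1) (cyc_up k.+1) (cyc_down k.+1)).
have e : q ^+ k.+1 / q = q ^+ k by rewrite exprSr mulfK.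
by rewrite -exprS e -invf_div e cycSS.
Qed.

Lemma fus_chi a t n j :
  fus q n (fun n j => (sgn R a * cval t.+1) ^+ n * wsum a t.+1 j) j =
  (sgn R a * cval t.+2) ^+ n * wsum a t.+2 j + (sgn R a * cval t) ^+ n * wsum a t j.
Proof.
pose z := sgn R a * q ^+ t.+1.
have z0 : z != 0 by rewrite mulf_neq0 // sgn_neq0.
have zV : z^-1 = sgn R a * q ^- t.+1 by rewrite invfM sgnV.
have e : q ^+ t.+1 / q = q ^+ t by rewrite exprSr mulfK.
have cE : sgn R a * cval t.+1 = z + z^-1 by rewrite zV -mulrDr.
have cpE : sgn R a * cval t.+2 = q * z + (q * z)^-1.
  by rewrite invfM zV /z /cval (exprS q t.+1) invfM; ring.
have cmE : sgn R a * cval t = z / q + q / z.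
  by rewrite zV /z -mulrA e /cval mulrCA -mulrDr -e invf_div.
rewrite cE cpE cmE.
(* The weights in dimension $t+2$. Those in dimension $t$ are the inner ones, and those in dimension
   $t+1$, times $q$ or $q^{-1}$, omit the last or the first. *)
pose mu i := z / q ^+ (2 * i).
have w1 i : wgt R p a t.+1 i = mu i / q by rewrite /wgt /mu /z; ring.
have w1' i : wgt R p a t.+1 i = mu i.+1 * q.
  by rewrite w1 /mu mulnS exprD; field; rewrite q0 qX0.
have w2 i : wgt R p a t.+2 i = mu i.
  by rewrite /wgt /mu /z (exprS q t.+1); field; rewrite q0 qX0.
have w0 i : wgt R p a t i = mu i.+1.
  by rewrite /wgt /mu /z (exprS q t) mulnS exprD; field; rewrite q0 qX0.
pose M j := \sum_(i < t) mu i.+1 ^+ j.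
have W0 k : wsum a t k = M k by apply: eq_bigr => i _; rewrite w0.
have W2 k : wsum a t.+2 k = mu 0%N ^+ k + (M k + mu t.+1 ^+ k).
  rewrite /wsum big_ord_recl /= w2; congr (_ + _); rewrite big_ord_recr /= w2.
  by congr (_ + _); apply: eq_bigr => i _; rewrite w2.
have W1 k : q ^+ k * wsum a t.+1 k = mu 0%N ^+ k + M k.
  rewrite /wsum mulr_sumr big_ord_recl /= -exprMn w1 mulrCA mulfV // mulr1.
  congr (_ + _); apply: eq_bigr => i _.
  by rewrite -exprMn w1 mulrCA mulfV // mulr1.
have W1' k : q ^- k * wsum a t.+1 k = M k + mu t.+1 ^+ k.
  rewrite /wsum mulr_sumr big_ord_recr /= -exprVn -exprMn w1' mulrCA mulVf // mulr1.
  congr (_ + _); apply: eq_bigr => i _.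
  by rewrite -exprMn w1' mulrCA mulVf // mulr1.
have mu0 : mu 0%N = z by rewrite /mu muln0 expr0 invr1 mulr1.
have mut : mu t.+1 = z^-1.
  rewrite zV /mu /z -mulrA; congr (_ * _); rewrite mul2n -addnn exprD.
  by field; rewrite !qX0.
apply: fus_geom => //; first by rewrite mulrDl W1 W1' W2 W0; ring.
rewrite mulrDl.
rewrite (_ : q ^+ j / q * _ = q^-1 * (z + z^-1) * (q ^+ j * wsum a t.+1 j)); last by ring.
rewrite (_ : q / q ^+ j * _ = q * (z + z^-1) * (q ^- j * wsum a t.+1 j)); last by ring.
rewrite W1 W1' W2 W0.
have -> : ((q ^+ 2 - 1) * q ^+ j + (q ^- 2 - 1) / q ^+ j) * wsum a t.+1 j.+1 =
  (q - q^-1) * (q ^+ j.+1 * wsum a t.+1 j.+1 - q ^- j.+1 * wsum a t.+1 j.+1).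
  by rewrite (exprS q j); field; rewrite q0 qX0.
rewrite W1 W1' (_ : mu 0%N ^+ j.+1 + M j.+1 - _ = mu 0%N ^+ j.+1 - mu t.+1 ^+ j.+1); last by ring.
rewrite !exprS mu0 mut.
by move: (M j) (z ^+ j) (z^-1 ^+ j) => x y y'; field; rewrite z0 q0.
Qed.

End WeightSums.

Section Fusion.
Variables (R : realType) (p : nat).
Hypothesis p_ge2 : (2 <= p)%N.
Local Notation C := R[i].
Local Notation q := (qpar R p).
Local Notation Uq := (palg (@uq_rel R p)).
Local Notation E := (uE R p).
Local Notation F := (uF R p).
Local Notation K := (uK R p).
Local Notation Ki := (uKi R p).
Local Notation cas := (cas R p).
Local Notation theta := (theta R p).
Let q0 : q != 0 := qpar_neq0 R p_ge2.
Let qX0 n : q ^+ n != 0 := qparX_neq0 R p_ge2 n.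
Let dq0 : q - q^-1 != 0 := qint_den_neq0 R p_ge2.

(** * The Casimir element on the tensor product with the two-dimensional module *)

Section TwoDimensional.
Local Notation rho := (@simple_rep R p false 2).
Let repP : is_rep rho /\ [/\ rho E = simpleE R p false 2, rho F = simpleF R 2 &
  rho K = simpleK R p false 2] := simple_repP R p_ge2 false p_ge2.
Let rep := proj1 repP.
Local Notation m := (mcoef rho).
Local Notation i0 := (ord0 : 'I_2).
Local Notation i1 := (ord_max : 'I_2).

Let sum2 (V : zmodType) (f : 'I_2 -> V) : \sum_i f i = f i0 + f i1.
Proof. by rewrite big_ord_recl big_ord1; congr (_ + f _); apply: val_inj. Qed.

Let mM i j x y : m i j (x * y) = m i i0 x * m i0 j y + m i i1 x * m i1 j y.
Proof. by rewrite (mcoefM p_ge2 rep) // sum2. Qed.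

Let w20 : wgt R p false 2 0 = q.
Proof. by rewrite /wgt muln0 expr0 invr1 mulr1 mul1r expr2 mulfK. Qed.

Let w21 : wgt R p false 2 1 = q^-1.
Proof. by rewrite /wgt muln1 /sgn expr0 mul1r; field; rewrite q0. Qed.

Let rhoKX n i j : rho (K ^+ n) i j = if i == j :> nat then wgt R p false 2 i ^+ n else 0.
Proof. by have [_ [_ _ rK]] := repP; rewrite (repX rep) rK simpleKE // dgmX mxE. Qed.

Let mKX n : [/\ m i0 i0 (K ^+ n) = q ^+ n *: K ^+ n, m i0 i1 (K ^+ n) = 0,
  m i1 i0 (K ^+ n) = 0 & m i1 i1 (K ^+ n) = q ^- n *: K ^+ n].
Proof. by split; rewrite (mcoefKX p_ge2 rep) // rhoKX /= ?w20 ?w21 ?exprVn ?scale0r. Qed.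

Let mK : [/\ m i0 i0 K = q *: K, m i0 i1 K = 0, m i1 i0 K = 0 & m i1 i1 K = q^-1 *: K].
Proof. by have := mKX 1; rewrite !expr1. Qed.

Let mKi : [/\ m i0 i0 Ki = q^-1 *: Ki, m i0 i1 Ki = 0, m i1 i0 Ki = 0 & m i1 i1 Ki = q *: Ki].
Proof.
have [-> -> -> ->] := mKX (2 * p).-1.
have -> : q ^+ (2 * p).-1 = q^-1.
  by apply: (mulIf q0); rewrite -exprSr prednK ?qpar_order ?mulVf //; lia.
by rewrite invrK.
Qed.

Let mE : [/\ m i0 i0 E = E, m i0 i1 E = K, m i1 i0 E = 0 & m i1 i1 E = E].
Proof.
have [_ [rE _ _]] := repP.
by split; rewrite (mcoefE p_ge2 rep) // rE mxE /= /sgn ?expr0 ?qint1 // ?mul1r ?scale1r ?scale0r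
  ?addr0 ?add0r.
Qed.

Let mF : [/\ m i0 i0 F = q^-1 *: F, m i0 i1 F = 0, m i1 i0 F = 1 & m i1 i1 F = q *: F].
Proof.
have [_ [_ rF _]] := repP.
have qi : q ^+ (2 * p).-1 = q^-1.
  by apply: (mulIf q0); rewrite -exprSr prednK ?qpar_order ?mulVf //; lia.
by split; rewrite (mcoefF p_ge2 rep) // rF mxE /= /uKi rhoKX /= ?w20 ?w21 ?exprVn ?qi ?invrK
  ?scale1r ?scale0r ?addr0 ?add0r.
Qed.

Let alpha : C := q ^+ 2 - 1.
Let beta : C := q ^- 2 - 1.

(** After $FE$ is replaced through [casFE], the terms in $K^{-1}$ cancel. *)
Let collect (u x y : Uq) (a b c d : C) :
  a *: (u - b *: x - c *: y) + d *: x + (a * c) *: y = a *: u + (d - a * b) *: x.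
Proof.
rewrite !scalerBr !scalerA [(d - _) *: x]scalerBl.
by rewrite [LHS](AC (3*1*1) (1*(4*2)*(3*5))) /= addNr addr0.
Qed.

Let mcas : [/\ m i0 i0 cas = q^-1 *: cas + alpha *: K, m i0 i1 cas = (theta / q) *: (F * K),
  m i1 i0 cas = theta *: E & m i1 i1 cas = q *: cas + beta *: K].
Proof.
have lm i j := mcoef_linear p_ge2 rep i j.
have [k00 k01 k10 k11] := mK; have [v00 v01 v10 v11] := mKi.
have [e00 e01 e10 e11] := mE; have [f00 f01 f10 f11] := mF.
have casE i j : m i j cas = theta *: m i j (F * E) + q *: m i j K + q^-1 *: m i j Ki.
  by rewrite /cas !(linD (lm _ _)) !(linZ (lm _ _)).
split; rewrite casE mM.
- rewrite e00 e10 f00 f01 k00 v00 mulr0 addr0 -palg_scaleAl !scalerA.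
  rewrite (mulrC theta) -(scalerA _ theta) casFE // collect; congr (_ + _ *: _).
  by rewrite /alpha mulVf // expr2.
- by rewrite e01 e11 f00 f01 k01 v01 mul0r !scaler0 !addr0 -palg_scaleAl scalerA.
- by rewrite e00 e10 f10 f11 k10 v10 mulr0 mul1r !scaler0 !addr0.
rewrite e01 e11 f10 f11 k11 v11 mul1r -palg_scaleAl scalerDr !scalerA.
rewrite (mulrC theta) -(scalerA _ theta) casFE // [LHS](AC (2*1*1) (2*(1*3)*4)) /=.
rewrite -scalerDl (mulrC q^-1 q) collect; congr (_ + _ *: _).
by rewrite /beta /theta; field.
Qed.

(** Coordinates in which the diagonal entries of the quadratic relation are compared. *)
Let comb (a b c d : C) : Uq :=
  a *: (cas * cas) + b *: (cas * K) + c *: (K * K) + d *: (1 : Uq).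

Let combD a b c d a' b' c' d' :
  comb a b c d + comb a' b' c' d' = comb (a + a') (b + b') (c + c') (d + d').
Proof. by rewrite /comb !scalerDl [LHS](AC (4*4) ((1*5)*(2*6)*(3*7)*(4*8))) /=. Qed.

Let combZ k a b c d : k *: comb a b c d = comb (k * a) (k * b) (k * c) (k * d).
Proof. by rewrite /comb !scalerDr !scalerA. Qed.

Let comm_mulD (u v : Uq) (a b a' b' : C) : u * v = v * u ->
  (a *: u + b *: v) * (a' *: u + b' *: v) =
  (a * a') *: (u * u) + (a * b' + b * a') *: (u * v) + (b * b') *: (v * v).
Proof.
move=> uv; rewrite !(mulrDl, mulrDr) -!palg_scaleAl -!palg_scaleAr !scalerA -uv.
by rewrite [in RHS]scalerDl !addrA.
Qed.

Let combM a b a' b' : (a *: cas + b *: K) * (a' *: cas + b' *: K) =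
  comb (a * a') (a * b' + b * a') (b * b') 0.
Proof. rewrite comm_mulD; last exact: cas_K. by rewrite /comb scale0r addr0. Qed.

Let combcas a b : cas * (a *: cas + b *: K) = comb a b 0 0.
Proof. by rewrite /comb [LHS]mulrDr -!palg_scaleAr !scale0r !addr0. Qed.

Let combquad : cas * cas + theta *: (1 : Uq) = comb 1 0 0 theta.
Proof. by rewrite /comb !scale0r !addr0 scale1r. Qed.

Let combFKE : theta *: (F * K * E) = comb 0 (q ^+ 2) (- q ^+ 3) (- q).
Proof.
have KFE : K * (F * E) = F * E * K.
  rewrite mulrA uKF -palg_scaleAl -mulrA uKE -palg_scaleAr scalerA.
  by rewrite mulVf ?expf_neq0 // scale1r mulrA.
have -> : F * K * E = q ^+ 2 *: (K * (F * E)).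
  by rewrite -mulrA uKE -palg_scaleAr mulrA KFE.
rewrite scalerA mulrC -scalerA palg_scaleAr casFE // !mulrBr -!palg_scaleAr uKKi //.
rewrite !scalerBr !scalerA -cas_K // /comb scale0r add0r !scaleNr -exprSr.
by rewrite (_ : q ^+ 2 / q = q) // expr2 mulfK.
Qed.

Let combEFK : theta *: (E * F * K) = comb 0 1 (- q^-1) (- q).
Proof.
rewrite palg_scaleAl casEF // !mulrBl -!palg_scaleAl uKiK //.
by rewrite /comb scale0r add0r !scaleNr scale1r.
Qed.

Let subcomb a b c d a' b' c' d' :
  comb a b c d - comb a' b' c' d' = comb (a - a') (b - b') (c - c') (d - d').
Proof. by rewrite -scaleN1r combZ combD !mulN1r. Qed.

(** With the next three, the entries of $M^2=(q+q^{-1})cM-(c^2+\theta)$ for the matrix $M$ of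
    [m i j cas]. The coefficients reflect the values $c_{s\pm1}$ over $c_s$: their sum is
    $(q+q^{-1})c_s$ and their product $c_s^2+\theta$. *)
Let quad00 : m i0 i0 cas * m i0 i0 cas + m i0 i1 cas * m i1 i0 cas =
  (q + q^-1) *: (cas * m i0 i0 cas) - (cas * cas + theta *: (1 : Uq)).
Proof.
have [-> -> -> _] := mcas.
rewrite combM -palg_scaleAl -palg_scaleAr combFKE combcas combquad !combZ combD subcomb.
by congr comb; rewrite /alpha /theta; field.
Qed.

Let quad11 : m i1 i0 cas * m i0 i1 cas + m i1 i1 cas * m i1 i1 cas =
  (q + q^-1) *: (cas * m i1 i1 cas) - (cas * cas + theta *: (1 : Uq)).
Proof.
have [_ -> -> ->] := mcas.
rewrite combM -palg_scaleAl -palg_scaleAr scalerA mulrC -scalerA mulrA.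
rewrite combEFK combcas combquad !combZ combD subcomb.
by congr comb; rewrite /beta /theta; field.
Qed.

Let quad01 : m i0 i0 cas * m i0 i1 cas + m i0 i1 cas * m i1 i1 cas =
  (q + q^-1) *: (cas * m i0 i1 cas).
Proof.
have [-> -> _ ->] := mcas.
have KFK : K * (F * K) = q ^- 2 *: (F * K * K) by rewrite mulrA uKF -palg_scaleAl.
rewrite -!palg_scaleAr -!palg_scaleAl -scalerDr [RHS]scalerA (mulrC (q + q^-1)) -[RHS]scalerA; congr (_ *: _).
have -> : (q^-1 *: cas + alpha *: K) * (F * K) =
    q^-1 *: (cas * (F * K)) + (alpha * q ^- 2) *: (F * K * K).
  by rewrite [LHS]mulrDl -!palg_scaleAl KFK scalerA.
have -> : F * K * (q *: cas + beta *: K) = q *: (cas * (F * K)) + beta *: (F * K * K).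
  by rewrite [LHS]mulrDr -!palg_scaleAr cas_central.
rewrite [LHS](AC (2*2) ((1*3)*(2*4))) /= -!scalerDl (_ : _ + beta = 0) ?scale0r ?addr0.
  by rewrite addrC.
by rewrite /alpha /beta; field.
Qed.

Let quad10 : m i1 i0 cas * m i0 i0 cas + m i1 i1 cas * m i1 i0 cas =
  (q + q^-1) *: (cas * m i1 i0 cas).
Proof.
have [-> _ -> ->] := mcas.
rewrite -!palg_scaleAr -!palg_scaleAl -scalerDr [RHS]scalerA (mulrC (q + q^-1)) -[RHS]scalerA; congr (_ *: _).
have -> : E * (q^-1 *: cas + alpha *: K) = q^-1 *: (cas * E) + alpha *: (E * K).
  by rewrite [LHS]mulrDr -!palg_scaleAr cas_central.
have -> : (q *: cas + beta *: K) * E = q *: (cas * E) + (beta * q ^+ 2) *: (E * K).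
  by rewrite [LHS]mulrDl -!palg_scaleAl uKE scalerA.
rewrite [LHS](AC (2*2) ((1*3)*(2*4))) /= -!scalerDl (_ : alpha + _ = 0) ?scale0r ?addr0.
  by rewrite addrC.
by rewrite /alpha /beta; field.
Qed.

Let quad_rec (A B A' B' X Y c : Uq) (k t : C) :
  A * A + B * A' = k *: (c * A) - (c * c + t *: (1 : Uq)) ->
  A * B + B * B' = k *: (c * B) ->
  A * (A * X + B * Y) + B * (A' * X + B' * Y) =
  k *: (c * (A * X + B * Y)) - c * (c * X) - t *: X.
Proof.
move=> HA HB; rewrite !mulrDr !mulrA [LHS](AC (2*2) ((1*3)*(2*4))) /= -!mulrDl HA HB.
rewrite !mulrDl mulNr mulrDl -!palg_scaleAl mul1r scalerDr.
by rewrite opprD [LHS](AC (1*2*1) (1*4*2*3)).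
Qed.

Let mrec0 x : m i0 i0 (cas * (cas * x)) =
  (q + q^-1) *: (cas * m i0 i0 (cas * x)) - cas * (cas * m i0 i0 x) - theta *: m i0 i0 x.
Proof. by rewrite !(mM _ _ cas) (quad_rec _ _ quad00 quad01). Qed.

Let mrec1 x : m i1 i1 (cas * (cas * x)) =
  (q + q^-1) *: (cas * m i1 i1 (cas * x)) - cas * (cas * m i1 i1 x) - theta *: m i1 i1 x.
Proof.
rewrite !(mM _ _ cas) ![m i1 i0 cas * _ + _]addrC ![m i0 i0 cas * _ + _]addrC.
apply: (@quad_rec (m i1 i1 cas) (m i1 i0 cas) (m i0 i1 cas) (m i0 i0 cas)).
  by rewrite addrC; exact: quad11.
by rewrite addrC; exact: quad10.
Qed.

Lemma cvalue_chi2_mul (f : Uq -> C^o) n j : linear f ->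
  cvalue (slf_mul (chi R p false 2) f) n j = fus q n (cvalue f) j.
Proof.
pose T (g : Uq -> C^o) x := g (m i0 i0 x) + g (m i1 i1 x) : C.
have TE g x : linear g -> slf_mul (chi R p false 2) g x = T g x.
  by move=> lg; rewrite [LHS](trace_mul rho) // sum2.
move=> lf; rewrite /cvalue TE //; elim/nat_ind2: n f lf => [f lf|f lf|n IH IH1 f lf].
- rewrite /= /T /cvalue ?expr0 !mul1r; have [-> _ _ ->] := mKX j.
  by rewrite !(linZ lf) mulrDl.
- have fD a b (u v w : Uq) : f ((a *: u + b *: v) * w) = a * f (u * w) + b * f (v * w).
    by rewrite mulrDl -!palg_scaleAl (linD lf) !(linZ lf).
  rewrite /= /T /cvalue !mM; have [-> -> -> ->] := mKX j; have [-> -> -> ->] := mcas.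
  rewrite !mulr0 addr0 add0r -!palg_scaleAr 2!(linZ lf) !fD mul1r (exprS K) (expr1 cas) -/alpha -/beta.
  by move: (f _) (f (K * _)) => u v; rewrite /GRing.scale /=; ring.
(* Passing to $f(c\,\cdot)$ shifts the Casimir exponent, which gives the shifted arguments of [fus];
   [mrec0] and [mrec1] then match the recursion. *)
rewrite fusSS; pose g x := f (cas * x).
have lg : linear g by move=> a x y; rewrite /g mulrDr -palg_scaleAr lf.
have gE k l : cvalue f k.+1 l = cvalue g k l by rewrite /cvalue /g mulrA -exprS.
pose h x := g (cas * x).
have lh : linear h by move=> a x y; rewrite /h mulrDr -palg_scaleAr lg.
have hE k l : cvalue f k.+2 l = cvalue h k l by rewrite gE /cvalue /h mulrA -exprS.
rewrite (_ : (fun n => cvalue f n.+1) = cvalue g); last first.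
  by apply/funext => k; apply/funext => l; exact: gE.
rewrite (_ : (fun n => cvalue f n.+2) = cvalue h); last first.
  by apply/funext => k; apply/funext => l; exact: hE.
rewrite -(IH1 _ lg) -(IH _ lh) -(IH _ lf) /T !exprS -!mulrA mrec0 mrec1.
rewrite !(linB lf) !(linZ lf) -/(theta) /h /g /GRing.scale /= -/theta /theta.
by move: (f _) => u; ring.
Qed.

End TwoDimensional.
End Fusion.

(** * Fusion rules *)

Section FusionRules.
Variables (R : realType) (p : nat).
Hypothesis p_ge2 : (2 <= p)%N.
Local Notation C := R[i].
Local Notation q := (qpar R p).
Local Notation Uq := (palg (@uq_rel R p)).
Local Notation E := (uE R p).
Local Notation F := (uF R p).
Local Notation K := (uK R p).
Local Notation Ki := (uKi R p).
Local Notation cas := (cas R p).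
Local Notation theta := (theta R p).
Local Notation cval := (cval R p).
Local Notation wsum := (@wsum R p).
Let q0 : q != 0 := qpar_neq0 R p_ge2.
Let qX0 n : q ^+ n != 0 := qparX_neq0 R p_ge2 n.

Lemma chi_SLF a s : (s <= p)%N -> SLF (chi R p a s).
Proof. by move=> sp; have [rep _] := simple_repP R p_ge2 a sp; exact: trace_SLF rep. Qed.

Lemma chi_mulA a s (f g : Uq -> C^o) : (s <= p)%N -> linear f -> linear g ->
  slf_mul (slf_mul (chi R p a s) f) g = slf_mul (chi R p a s) (slf_mul f g).
Proof.
by move=> sp; have [rep _] := simple_repP R p_ge2 a sp; exact: (trace_mulA p_ge2 rep).
Qed.

Section OneDimensional.
Variable a : bool.
Local Notation rho := (@simple_rep R p a 1).
Let p_gt0 : (0 < p)%N. Proof. by lia. Qed.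
Let repP := simple_repP R p_ge2 a p_gt0.
Let rep : is_rep rho := proj1 repP.
Local Notation M := (mcoef rho ord0 ord0).

Let rhoKX n : rho (K ^+ n) ord0 ord0 = sgn R a ^+ n.
Proof.
have [_ [_ _ rK]] := repP; rewrite (repX rep) rK simpleKE // dgmX mxE /=.
by rewrite /wgt muln0 expr0 invr1 expr1 mulfV // !mulr1.
Qed.

Let MM x y : M (x * y) = M x * M y.
Proof. by rewrite (mcoefM p_ge2 rep) big_ord1. Qed.

Let M1 : M 1 = 1.
Proof. by rewrite (mcoef1 p_ge2 rep) eqxx mulr1n scale1r. Qed.

Let ME : M E = E.
Proof.
have [_ [rE _ _]] := repP.
by rewrite (mcoefE p_ge2 rep) rE mxE eqxx mulr1n scale1r scale0r addr0.
Qed.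

Let MKX n : M (K ^+ n) = sgn R a ^+ n *: K ^+ n.
Proof. by rewrite (mcoefKX p_ge2 rep) rhoKX. Qed.

Let MKi : M Ki = sgn R a *: Ki.
Proof.
rewrite MKX; congr (_ *: _); apply: (mulIf (sgn_neq0 R a)).
by rewrite -exprSr prednK ?exprM ?expr2 ?sgn_sqr ?expr1n //; lia.
Qed.

Let MF : M F = sgn R a *: F.
Proof.
have [_ [_ rF _]] := repP.
rewrite (mcoefF p_ge2 rep) rF mxE scale0r add0r; congr (_ *: _).
rewrite rhoKX; apply: (mulIf (sgn_neq0 R a)).
by rewrite -exprSr prednK ?exprM ?expr2 ?sgn_sqr ?expr1n //; lia.
Qed.

Let MK : M K = sgn R a *: K.
Proof. by have := MKX 1; rewrite !expr1. Qed.

Let Mlin := mcoef_linear p_ge2 rep ord0 ord0.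

Let Mcas : M cas = sgn R a *: cas.
Proof.
rewrite /cas !(linD Mlin) !(linZ Mlin) MM ME MF MK MKi -palg_scaleAl !scalerDr.
by rewrite !scalerA !(mulrC _ (sgn R a)).
Qed.

Let MX n j : M (cas ^+ n * K ^+ j) = sgn R a ^+ (n + j) *: (cas ^+ n * K ^+ j).
Proof.
rewrite MM MKX exprD -scalerA palg_scaleAr palg_scaleAl; congr (_ * _).
elim: n => [|n IH]; first by rewrite !expr0 scale1r M1.
by rewrite !exprS MM IH Mcas -palg_scaleAl -palg_scaleAr scalerA mulrC.
Qed.

Lemma cvalue_chi1_mul (f : Uq -> C^o) n j : linear f ->
  cvalue (slf_mul (chi R p a 1) f) n j = sgn R a ^+ (n + j) * cvalue f n j.
Proof.
move=> lf; rewrite /cvalue [LHS](trace_mul rho) // big_ord1 MX linZ //.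
Qed.

End OneDimensional.

Lemma chi1_unit (f : Uq -> C^o) : SLF f -> slf_mul (chi R p false 1) f = f.
Proof.
move=> sf; have [lf _] := sf.
apply: (slf_ext p_ge2) => // [|n j _].
  by apply: slf_mul_SLF => //; apply: chi_SLF; lia.
by rewrite cvalue_chi1_mul // expr1n mul1r.
Qed.

(** The two linked projective modules share all blocks but the corner: the block from $b$ to $x$ in
    one is that from $y$ to $a$ in the other, and the block from $b$ to $y$ is that from $x$ to
    $a$. *)
Lemma grep_pair a m n (x : Uq) : (0 < m)%N -> (0 < n)%N -> (m + n = p)%N ->
  exists A B X Y X' Y' N N', grep a m n x = projblock A B X Y X' Y' N /\
    grep (~~ a) n m x = projblock B A Y' X' Y X N'.
Proof.
move=> m0 n0 mnp; have nmp : (n + m = p)%N by rewrite addnC.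
have [rep1 [E1 F1 K1]] := grepP R p_ge2 a m0 n0 mnp.
have [rep2 [E2 F2 K2]] := grepP R p_ge2 (~~ a) n0 m0 nmp.
elim/(uq_ind (R := R) (p := p)): x => [||||c u IH|u v IHu IHv|u v IHu IHv].
- rewrite E1 E2 /gprojE negbK.
  by do 8 eexists; split; reflexivity.
- rewrite F1 F2 /gprojF.
  by do 8 eexists; split; reflexivity.
- rewrite K1 K2 /gprojK negbK.
  by do 8 eexists; split; reflexivity.
- have [_ -> _] := rep1; have [_ -> _] := rep2.
  by rewrite -!projblock_scalar; do 8 eexists; split; reflexivity.
- have [A [B [X [Y [X' [Y' [N [N' [e1 e2]]]]]]]]] := IH.
  have [l1 _ _] := rep1; have [l2 _ _] := rep2.
  rewrite (linZ l1) (linZ l2) e1 e2 -!mul_scalar_mx !projblock_scale.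
  by do 8 eexists; split; reflexivity.
- have [A [B [X [Y [X' [Y' [N [N' [e1 e2]]]]]]]]] := IHu.
  have [A1 [B1 [X1 [Y1 [X1' [Y1' [N1 [N1' [f1 f2]]]]]]]]] := IHv.
  have [l1 _ _] := rep1; have [l2 _ _] := rep2.
  rewrite (linD l1) (linD l2) e1 e2 f1 f2 !projblockD.
  by do 8 eexists; split; reflexivity.
have [A [B [X [Y [X' [Y' [N [N' [e1 e2]]]]]]]]] := IHu.
have [A1 [B1 [X1 [Y1 [X1' [Y1' [N1 [N1' [f1 f2]]]]]]]]] := IHv.
have [_ _ r1] := rep1; have [_ _ r2] := rep2.
rewrite r1 r2 e1 e2 f1 f2 !projblockM.
by do 8 eexists; split; reflexivity.
Qed.

(* Neither trace is symmetric by itself: the off-diagonal contributions to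
   [tr (H (x * y))] from one projective module are matched by those to
   [tr (H (y * x))] from the other one. *)
Lemma Gform_SLF s : SLF (Gform R p s).
Proof.
have [sp|nsp] := boolP (0 < s < p)%N; last first.
  rewrite /Gform (negPf nsp); split=> [a u v|x y] //.
  by rewrite /= scaler0 addr0.
have [s0 sp'] := andP sp; have s1 : (0 < p - s)%N by lia.
have sps : (s + (p - s) = p)%N by lia.
have pss : (p - s + s = p)%N by lia.
have [[l1 _ r1] _] := grepP R p_ge2 false s0 s1 sps.
have [[l2 _ r2] _] := grepP R p_ge2 true s1 s0 pss.
have -> : Gform R p s = fun x => \tr (dlsubmx (dlsubmx (grep false s (p - s) x))) +
    \tr (dlsubmx (dlsubmx (grep true (p - s) s x))).
  by apply/funext => x; exact: GformE.
split=> [c u v|x y].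
  have dl m1 m2 n1 n2 (A B : 'M[C]_(m1 + m2, n1 + n2)) :
      dlsubmx (c *: A + B) = c *: dlsubmx A + dlsubmx B.
    by apply/matrixP => i j; rewrite !mxE.
  by rewrite l1 l2 !dl !linearP /= scalerDr addrACA.
have [A [B [X [Y [X' [Y' [N [N' [e1 e2]]]]]]]]] := grep_pair false x s0 s1 sps.
have [A1 [B1 [X1 [Y1 [X1' [Y1' [N1 [N1' [f1 f2]]]]]]]]] := grep_pair false y s0 s1 sps.
rewrite /= in e2 f2.
rewrite !r1 !r2 e1 e2 f1 f2 !projblockM !projblock_corner !mxtraceD.
rewrite (mxtrace_mulC N A1) (mxtrace_mulC X' X1) (mxtrace_mulC Y' Y1) (mxtrace_mulC A N1).
rewrite (mxtrace_mulC N' B1) (mxtrace_mulC Y Y1') (mxtrace_mulC X X1') (mxtrace_mulC B N1').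
by ring.
Qed.

End FusionRules.

(** * Products by the characters of the modules of dimensions 1 and 2 *)

Section SLFProducts.
Variables (R : realType) (p : nat).
Hypothesis p_ge2 : (2 <= p)%N.
Local Notation C := R[i].
Local Notation q := (qpar R p).
Local Notation Uq := (palg (@uq_rel R p)).
Local Notation cas := (cas R p).
Local Notation theta := (theta R p).
Local Notation cval := (cval R p).
Local Notation wsum := (@wsum R p).
Local Notation cyc := (@cyc R p).
Local Notation om := (@omega R p).
Local Notation chi := (chi R p).
Local Notation G := (Gform R p).
Let q0 : q != 0 := qpar_neq0 R p_ge2.
Let qX0 n : q ^+ n != 0 := qparX_neq0 R p_ge2 n.
Let dq0 : q - q^-1 != 0 := qint_den_neq0 R p_ge2.

Lemma SLF_add (f g : Uq -> C^o) : SLF f -> SLF g -> SLF (f + g).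
Proof.
move=> [lf sf] [lg sg]; split=> [c u v|x y].
  by rewrite -[(f + g) _]/(f _ + g _) lf lg addrACA -scalerDr.
by rewrite -[LHS]/(f _ + g _) sf sg.
Qed.

Lemma SLF_scale a (f : Uq -> C^o) : SLF f -> SLF (a *: f).
Proof.
move=> [lf sf]; split=> [c u v|x y].
  by rewrite -[(a *: f) _]/(a *: f _) lf scalerDr !scalerA mulrC -scalerA.
by rewrite -[LHS]/(a *: f _) sf.
Qed.

Lemma SLF_opp (f : Uq -> C^o) : SLF f -> SLF (- f).
Proof. by rewrite -scaleN1r; apply: SLF_scale. Qed.

Lemma SLF0 : SLF (0 : Uq -> C^o).
Proof. by split=> [c u v|//]; rewrite /= scaler0 addr0. Qed.

Lemma cvalueD (f g : Uq -> C^o) n j : cvalue (f + g) n j = cvalue f n j + cvalue g n j.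
Proof. by []. Qed.

Lemma cvalueZ a (f : Uq -> C^o) n j : cvalue (a *: f) n j = a * cvalue f n j.
Proof. by []. Qed.

Lemma cvalueN (f : Uq -> C^o) n j : cvalue (- f) n j = - cvalue f n j.
Proof. by []. Qed.

Lemma chi2_mul_chi a t : (t.+1 < p)%N ->
  slf_mul (chi false 2) (chi a t.+1) = chi a t + chi a t.+2.
Proof.
move=> tp; have st k : (k <= p)%N -> SLF (chi a k) by move=> kp; exact: chi_SLF.
apply: (slf_ext p_ge2) => [||n j _].
- by apply: slf_mul_SLF => //; [exact: chi_SLF|apply: st; lia].
- by apply: SLF_add; apply: st; lia.
have [lc _] := st t.+1 (ltnW tp).
rewrite (cvalue_chi2_mul p_ge2) // cvalueD !val_chi; try lia.
rewrite (_ : cvalue (chi a t.+1) = fun n j => (sgn R a * cval t.+1) ^+ n * wsum a t.+1 j).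
  by rewrite fus_chi // addrC.
by apply/funext => k; apply/funext => l; rewrite val_chi //; lia.
Qed.

(** [fus_chi] formally produces dimension $p+1$. Its $p-1$ inner weights are those of dimension
    $p-1$, both extreme ones are that of the one-dimensional module of opposite sign, and
    $c_{p+1}=c_{p-1}$. *)
Lemma chi2_mul_chip a :
  slf_mul (chi false 2) (chi a p) = 2 *: chi a p.-1 + 2 *: chi (~~ a) 1.
Proof.
have st b k : (k <= p)%N -> SLF (chi b k) by move=> kp; exact: chi_SLF.
have [lc _] := st a p (leqnn p).
apply: (slf_ext p_ge2) => [||n j _].
- by apply: slf_mul_SLF => //; apply: st; lia.
- by apply: SLF_add; apply: SLF_scale; apply: st; lia.
have p1 : p = p.-1.+1 by lia.
rewrite (cvalue_chi2_mul p_ge2) // cvalueD !cvalueZ !val_chi; try lia.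
rewrite (_ : cvalue (chi a p) = fun n j => (sgn R a * cval p.-1.+1) ^+ n * wsum a p.-1.+1 j); last first.
  by apply/funext => k; apply/funext => l; rewrite -p1 val_chi.
rewrite fus_chi //.
have q1 : q ^+ p.-1 = - q^-1.
  by apply: (mulIf q0); rewrite -exprSr -p1 qpar_half // mulNr mulVf.
have q2 : q ^+ p.-1.+2 = - q by rewrite -p1 exprS qpar_half // mulrN1.
have c1 : cval p.-1 = - cval 1 by rewrite /cval q1 invrN invrK expr1 opprD addrC.
have c2 : cval p.-1.+2 = - cval 1 by rewrite /cval q2 invrN expr1 opprD.
have -> : wsum a p.-1.+2 j = wsum a p.-1 j + 2 * wsum (~~ a) 1 j.
  rewrite /wsum big_ord_recl /= big_ord1 big_ord_recr /=.
  rewrite (eq_bigr (fun i : 'I_p.-1 => wgt R p a p.-1 i ^+ j)) => [|i _]; last first.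
    congr (_ ^+ _); rewrite /wgt q2 q1 /bump add1n mulnS exprD; field.
    by rewrite q0 qX0.
  have -> : wgt R p a p.-1.+2 (bump 0 p.-1) = wgt R p (~~ a) 1 0.
    rewrite /wgt sgnN /bump add1n q2 -p1 qpar_order // muln0 expr0 invr1 expr1.
    by rewrite !mulr1 divff // mulNr divff // mulrN1 mulr1.
  have -> : wgt R p a p.-1.+2 0 = wgt R p (~~ a) 1 0.
    rewrite /wgt sgnN q2 muln0 expr0 invr1 expr1.
    by rewrite !mulr1 divff // mulNr divff // mulrN1 mulr1.
  by ring.
by rewrite c1 c2 sgnN mulNr mulrN; ring.
Qed.

Lemma chi1_mul_chi a s : (s <= p)%N -> slf_mul (chi true 1) (chi a s) = chi (~~ a) s.
Proof.
move=> sp; have p0 : (1 <= p)%N by lia.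
have [lc _] := chi_SLF R p_ge2 a sp.
apply: (slf_ext p_ge2) => [||n j _].
- by apply: slf_mul_SLF => //; apply: chi_SLF.
- exact: chi_SLF.
have eS : wsum (~~ a) s j = (-1) ^+ j * wsum a s j.
  rewrite /wsum mulr_sumr; apply: eq_bigr => i _.
  by rewrite -exprMn mulN1r /wgt sgnN mulNr.
rewrite (cvalue_chi1_mul p_ge2) // !val_chi // eS sgnN mulNr exprD (exprNn (_ * _)).
by rewrite (_ : sgn R true = -1) //; ring.
Qed.

(** The factor $q^k-q^{-k}$ vanishes at $k=0$ and $k=p$, so the convention $G_0=G_p=0$ fits the
    general formula. *)
Lemma val_G_all k n j : (k <= p)%N ->
  cvalue ((q ^+ k - q ^- k) *: G k) n j =
  theta * ((q ^+ k - q ^- k) * (n%:R * cval k ^+ n.-1) * cyc k j).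
Proof.
move=> kp; rewrite cvalueZ.
have [kk|nk] := boolP (0 < k < p)%N.
  by rewrite val_G // (wsum_cyc R p_ge2 j kp); ring.
have -> : q ^+ k - q ^- k = 0.
  have [->|->] : k = 0%N \/ k = p by lia.
    by rewrite expr0 invr1 subrr.
  by rewrite qpar_half // invrN invr1 subrr.
by rewrite !mul0r mulr0.
Qed.

Lemma chi2_mul_G k : (k.+1 < p)%N ->
  slf_mul (chi false 2) ((q ^+ k.+1 - q ^- k.+1) *: G k.+1) =
  (q ^+ k.+2 - q ^- k.+2) *: G k.+2 + (q ^+ k - q ^- k) *: G k.
Proof.
move=> kp; have sG l : SLF ((q ^+ l - q ^- l) *: G l).
  by apply: SLF_scale; apply: Gform_SLF.
have [lG _] := sG k.+1.
apply: (slf_ext p_ge2) => [||n j _].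
- by apply: slf_mul_SLF => //; apply: chi_SLF.
- exact: SLF_add.
rewrite (cvalue_chi2_mul p_ge2) // cvalueD !val_G_all; try lia.
rewrite (_ : cvalue _ = fun n j => theta *
   ((q ^+ k.+1 - q ^- k.+1) * (n%:R * cval k.+1 ^+ n.-1) * cyc k.+1 j)); last first.
  by apply/funext => m; apply/funext => l; rewrite val_G_all //; lia.
by rewrite fus_scale (fus_gval R p_ge2) mulrDr.
Qed.

Lemma chi2_mul_G_qint s : (0 < s < p)%N ->
  qint R p s *: slf_mul (chi false 2) (G s) =
  qint R p s.-1 *: G s.-1 + qint R p s.+1 *: G s.+1.
Proof.
case: s => // k kp; have dV : (q - q^-1)^-1 != 0 by rewrite invr_eq0.
rewrite /qint !(mulrC _ (q - q^-1)^-1) -!scalerA -slf_mulZr chi2_mul_G; last by lia.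
by rewrite scalerDr [LHS]addrC.
Qed.

Lemma chi1_mul_G s : (0 < s < p)%N -> slf_mul (chi true 1) (G s) = - G (p - s).
Proof.
move=> sp; have p0 : (1 <= p)%N by lia.
have sps : (0 < p - s < p)%N by lia.
have [lG _] := Gform_SLF R p_ge2 s.
apply: (slf_ext p_ge2) => [||n j _].
- by apply: slf_mul_SLF => //; [exact: chi_SLF|exact: Gform_SLF].
- by apply: SLF_opp; exact: Gform_SLF.
have eS : cyc (p - s) j = (-1) ^+ j * cyc s j.
  (* $p-s$ and $p+s$ have the same parity, and $q^{p+s}=-q^s$ produces the sign. *)
  rewrite (cyc_parity R p_ge2 (l := (p + s)%N)); last by lia.
  rewrite /cyc mulr_sumr; apply: eq_bigr => i _; rewrite -exprMn; congr (_ ^+ _).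
  by rewrite exprD qpar_half // !mulNr !mul1r.
rewrite (cvalue_chi1_mul p_ge2) // cvalueN !val_G // (wsum_cyc R p_ge2 j (ltnW (proj2 (andP sp)))).
rewrite (wsum_cyc R p_ge2) ?leq_subr // eS (cval_sub R p_ge2 (ltnW (proj2 (andP sp)))).
rewrite (_ : sgn R true = -1) // exprD; case: n => [|n]; first by rewrite !(mul0r, mulr0) oppr0.
by rewrite /= (exprS (-1)) (exprNn (cval s)); ring.
Qed.

Section Commutation.

(** The exponent stands for $-j$; reversing the basis inverts the weights. *)
Lemma wsum_inv a s j : wsum a s ((2 * p).-1 * j) = wsum a s j.
Proof.
rewrite /wsum (reindex_inj rev_ord_inj) /=; apply: eq_bigr => i _.
rewrite exprM wgtV //; congr (_ ^+ _); rewrite /wgt !invfM !invrK sgnV -!mulrA; congr (_ * _).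
have -> : q ^+ (2 * (s - i.+1)) = q ^+ s * q ^+ s / q ^+ (2 * i) / q ^+ 2.
  apply: (mulIf (qX0 (2 * i + 2))); transitivity (q ^+ s * q ^+ s).
    by rewrite -!exprD; congr (_ ^+ _); have := ltn_ord i; lia.
  by rewrite exprD; field; rewrite !qX0 q0.
by field; rewrite !qX0 q0.
Qed.

Lemma cvalue_omega (f : Uq -> C^o) n j :
  cvalue (f \o om) n j = cvalue f n ((2 * p).-1 * j).
Proof.
rewrite /cvalue /= omegaM //; congr (f (_ * _)).
  by elim: n => [|n IH]; rewrite ?omega1 // !exprS omegaM // omega_cas // IH.
rewrite exprM; elim: j => [|j IH]; rewrite ?omega1 // !exprS omegaM // IH omegaK //.
Qed.

Lemma SLF_omega (f : Uq -> C^o) : SLF f -> SLF (f \o om).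
Proof.
move=> [lf sf]; split=> [c u v|x y] /=; first by rewrite omegaD // omegaZ // lf.
by rewrite !omegaM // sf.
Qed.

Lemma chi_omega a s : (s <= p)%N -> chi a s \o om = chi a s.
Proof.
move=> sp; apply: (slf_ext p_ge2) => [||n j _].
- by apply: SLF_omega; exact: chi_SLF.
- exact: chi_SLF.
by rewrite cvalue_omega !val_chi // wsum_inv.
Qed.

Lemma G_omega s : G s \o om = G s.
Proof.
have [sp|nsp] := boolP (0 < s < p)%N; last first.
  by rewrite /Gform (negPf nsp).
apply: (slf_ext p_ge2) => [||n j _].
- by apply: SLF_omega; exact: Gform_SLF.
- exact: Gform_SLF.
by rewrite cvalue_omega !val_G // !wsum_inv.
Qed.

(** Since [omega] reverses products, the invariance of the product is the crux; it holds once the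
    product is known to be a combination of basis forms. *)
Lemma slf_mulC (f g : Uq -> C^o) : SLF f -> SLF g -> f \o om = f -> g \o om = g ->
  slf_mul f g \o om = slf_mul f g -> slf_mul f g = slf_mul g f.
Proof.
move=> [lf _] [lg _] fo go fgo; rewrite -fgo; apply/funext => x /=.
by rewrite slf_mul_omega // fo go.
Qed.

End Commutation.
End SLFProducts.

(** * Characters of Verma modules *)

Section Zeta.
Variables (R : realType) (p : nat).
Hypothesis p_ge2 : (2 <= p)%N.
Local Notation C := R[i].
Local Notation q := (qpar R p).
Local Notation Uq := (palg (@uq_rel R p)).
Local Notation theta := (theta R p).
Local Notation cval := (cval R p).
Local Notation wsum := (@wsum R p).
Local Notation cyc := (@cyc R p).
Local Notation om := (@omega R p).
Local Notation chi := (chi R p).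
Local Notation G := (Gform R p).
Let qX0 n : q ^+ n != 0 := qparX_neq0 R p_ge2 n.

Lemma chi0 a : chi a 0 = 0.
Proof. by apply/funext => x; rewrite /Defs.chi /mxtrace big_ord0. Qed.

Lemma cvalP n : cval (n + 2 * p) = cval n.
Proof. by rewrite /cval exprD qpar_order // mulr1. Qed.

Lemma fus_sum s (h : nat -> nat -> nat -> C) n j :
  fus q n (fun n j => \sum_(i < s) h i n j) j = \sum_(i < s) fus q n (h i) j.
Proof.
elim: s => [|s IH].
  rewrite big_ord0 (_ : (fun _ _ => _) = fun n j => 0 * (h 0%N n j)).
    by rewrite fus_scale mul0r.
  by apply/funext => k; apply/funext => l; rewrite big_ord0 mul0r.
rewrite big_ord_recr /= -IH.
rewrite (_ : (fun _ _ => _) = fun n j => 1 * (\sum_(i < s) h i n j) + 1 * h s n j).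
  by rewrite (fus_lin q 1 1 n (fun n j => \sum_(i < s) h i n j)) !mul1r.
by apply/funext => k; apply/funext => l; rewrite big_ord_recr /= !mul1r.
Qed.

Section Iteration.
Variables (h : nat -> nat -> nat -> C) (f : Uq -> C^o) (b : nat).
Hypothesis h_fus : forall k n j, fus q n (h k.+1) j = h k.+2 n j + h k n j.
Hypotheses (sf : SLF f) (fh : forall n j, cvalue f n j = h (b + 2 * p) n j).

(** The Clebsch-Gordan string $b-s+1,b-s+3,\dots,b+s-1$, from
    $\chi^+_{s+2}=\chi^+_2\chi^+_{s+1}-\chi^+_s$. The offset $2p$, a period of the families used,
    avoids truncated subtraction. *)
Lemma chi_iter s n j : (s <= p)%N ->
  cvalue (slf_mul (chi false s) f) n j = \sum_(i < s) h (b + 2 * p + 1 - s + 2 * i) n j.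
Proof.
have [lf _] := sf.
elim/nat_ind2: s n j => [n j _|n j _|s IH IH1 n j sp].
- by rewrite chi0 slf_mul0l // big_ord0.
- by rewrite chi1_unit // big_ord1 fh; congr h => /=; lia.
have sC k : (k <= p)%N -> SLF (slf_mul (chi false k) f).
  by move=> kp; apply: slf_mul_SLF => //; exact: chi_SLF.
have [lc _] := chi_SLF R p_ge2 false (ltnW sp).
have [lm _] := sC _ (ltnW sp).
have e : slf_mul (chi false s.+2) f =
    slf_mul (chi false 2) (slf_mul (chi false s.+1) f) - slf_mul (chi false s) f.
  rewrite -chi_mulA // chi2_mul_chi // slf_mulDl addrC addKr //.
rewrite e cvalueD cvalueN (cvalue_chi2_mul p_ge2) // IH; last by lia.
rewrite (_ : cvalue _ = fun n j => \sum_(i < s.+1) h (b + 2 * p + 1 - s.+1 + 2 * i) n j); last first.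
  by apply/funext => k; apply/funext => l; rewrite IH1 //; lia.
rewrite (fus_sum _ (fun i => h (b + 2 * p + 1 - s.+1 + 2 * i))).
rewrite (eq_bigr (fun i : 'I_s.+1 => h (b + 2 * p + 1 - s + 2 * i) n j +
   h (b + 2 * p + 1 - s.+2 + 2 * i) n j)) => [|i _]; last first.
  have -> : (b + 2 * p + 1 - s.+1 + 2 * i)%N = (b + 2 * p + 1 - s.+2 + 2 * i).+1 by lia.
  by rewrite h_fus; congr (h _ _ _ + _); lia.
rewrite big_split /= big_ord_recr /= [RHS]big_ord_recr /=.
have -> : (b + 2 * p + 1 - s.+2 + 2 * s.+1 = b + 2 * p + 1 - s + 2 * s)%N by lia.
by ring.
Qed.

End Iteration.

(** For [h] of period $2p$, the sum over all residues with the parity of [c]. *)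
Definition period_sum (h : nat -> C) c : C := \sum_(i < p) h (c + 2 * i)%N.

Lemma period_sumSS h c : (forall k, h (k + 2 * p)%N = h k) ->
  period_sum h c.+2 = period_sum h c.
Proof.
move=> hp; rewrite /period_sum; have p1 : p = p.-1.+1 by lia.
have H m : m.+1 = p -> \sum_(i < m.+1) h (c.+2 + 2 * i)%N = \sum_(i < m.+1) h (c + 2 * i)%N.
  move=> mp; rewrite big_ord_recr [RHS]big_ord_recl /= addrC; congr (_ + _).
    by rewrite -[in RHS]hp; congr h; lia.
  by apply: eq_bigr => i _; congr h; rewrite /bump; lia.
by have := H p.-1 (esym p1); rewrite -p1.
Qed.

Lemma period_sum_parity h c c' : (forall k, h (k + 2 * p)%N = h k) -> odd c = odd c' ->
  period_sum h c = period_sum h c'.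
Proof.
move=> hp; have H n : period_sum h n = period_sum h (odd n).
  by elim/nat_ind2: n => // n IH _; rewrite period_sumSS // IH /= negbK.
by move=> cc; rewrite H cc -H.
Qed.

Lemma period_sum_odd h c : (forall k, h (k + 2 * p)%N = h k) ->
  (forall k l, (k + l = 6 * p)%N -> h k = - h l) -> (c < 4 * p)%N -> period_sum h c = 0.
Proof.
move=> hp ho cp.
have e : period_sum h c = - period_sum h c.
  (* This start has the parity of [c], and reversing the sum pairs indices adding up to $6p$, a
     multiple of the period. *)
  rewrite {2}(@period_sum_parity _ _ (4 * p + 2 - c)) //; last by lia.
  rewrite /period_sum (reindex_inj rev_ord_inj) -sumrN; apply: eq_bigr => i _ /=.
  by apply: ho; have := ltn_ord i; lia.
by apply/eqP; rewrite -eqNr -e.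
Qed.

Definition zval k n j : C := cval k ^+ n * cyc k j.

Lemma zvalP k n j : zval (k + 2 * p) n j = zval k n j.
Proof.
rewrite /zval cvalP (cyc_parity R p_ge2 (k := (k + 2 * p)%N) (l := k)) //; lia.
Qed.

Lemma fus_zval k n j : fus q n (zval k.+1) j = zval k.+2 n j + zval k n j.
Proof. exact: fus_zeta. Qed.

(* The character of a [p]-dimensional Verma module, with composition factors
   the simple modules of signs +, - and dimensions [s], [p - s]. *)
Definition zeta s : Uq -> C^o := chi false s + chi true (p - s).

Lemma zeta_SLF s : (s <= p)%N -> SLF (zeta s).
Proof. by move=> sp; apply: SLF_add; apply: chi_SLF => //; exact: leq_subr. Qed.

Lemma cvalue_zeta s n j : (s <= p)%N -> cvalue (zeta s) n j = zval s n j.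
Proof.
move=> sp; rewrite cvalueD !val_chi ?leq_subr // cval_sub // /zval -(wsum_cyc R p_ge2 _ sp).
by rewrite (_ : sgn R true = -1) // mulrNN !mul1r mulrDr.
Qed.

Lemma zeta_p : zeta p = chi false p.
Proof. by rewrite /zeta subnn chi0 addr0. Qed.

Lemma chi2_mul_zeta k : (k.+1 < p)%N ->
  slf_mul (chi false 2) (zeta k.+1) = zeta k + zeta k.+2.
Proof.
move=> kp; have [lz _] := zeta_SLF (ltnW kp).
apply: (slf_ext p_ge2) => [||n j _].
- by apply: slf_mul_SLF => //; [exact: chi_SLF|apply: zeta_SLF; lia].
- by apply: SLF_add; apply: zeta_SLF; lia.
rewrite (cvalue_chi2_mul p_ge2) // cvalueD !cvalue_zeta; try lia.
rewrite (_ : cvalue _ = zval k.+1) ?fus_zval 1?addrC //.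
by apply/funext => m; apply/funext => l; rewrite cvalue_zeta //; lia.
Qed.

(** The two terms coincide because $c_{p+1}=c_{p-1}$. Division by 2 then starts the descent from
    [zeta p]. *)
Lemma chi2_mul_zetap : slf_mul (chi false 2) (zeta p) = 2 *: zeta p.-1.
Proof.
have p1 : p = p.-1.+1 by lia.
have [lz _] := zeta_SLF (leqnn p).
apply: (slf_ext p_ge2) => [||n j _].
- by apply: slf_mul_SLF => //; [exact: chi_SLF|exact: zeta_SLF].
- by apply: SLF_scale; apply: zeta_SLF; lia.
rewrite (cvalue_chi2_mul p_ge2) // cvalueZ cvalue_zeta ?leq_pred //.
rewrite (_ : cvalue _ = zval p.-1.+1); last first.
  by apply/funext => m; apply/funext => l; rewrite cvalue_zeta // -p1.
rewrite fus_zval /zval (cyc_parity R p_ge2 (k := p.-1.+2) (l := p.-1)); last by rewrite /= negbK.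
have -> : cval p.-1.+2 = cval p.-1.
  transitivity (- cval 1); last by rewrite -subn1 cval_sub //; lia.
  by rewrite /cval -p1 exprS qpar_half // mulrN1 invrN expr1 opprD.
by ring.
Qed.

(** At $a=p$, [zeta p] is the simple character of dimension $p$, and its string covers a full parity
    class modulo $2p$. Multiplication by $\chi^+_2$ propagates this down to smaller [a]. *)
Lemma cvalue_zeta_mul a b n j : (a <= p)%N -> (b <= p)%N ->
  cvalue (slf_mul (zeta a) (zeta b)) n j = period_sum (fun k => zval k n j) (a + b + 1).
Proof.
move=> ap bp; have sb := zeta_SLF bp; have [lb _] := sb.
have hp n' j' k : zval (k + 2 * p) n' j' = zval k n' j' by exact: zvalP.
have fusD e n' j' : fus q n' (fun n j => period_sum (fun k => zval k n j) e.+1) j' =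
    2 * period_sum (fun k => zval k n' j') e.
  rewrite /period_sum (fus_sum _ (fun i => zval (e.+1 + 2 * i))).
  under eq_bigr => i _ do rewrite addSn fus_zval.
  rewrite big_split /= -/(period_sum (fun k => zval k n' j') e).
  have -> : \sum_(i < p) zval (e + 2 * i).+2 n' j' = period_sum (fun k => zval k n' j') e.+2 by [].
  by rewrite period_sumSS //; ring.
have base n' j' : cvalue (slf_mul (zeta p) (zeta b)) n' j' =
    period_sum (fun k => zval k n' j') (p + b + 1).
  rewrite zeta_p (@chi_iter zval (zeta b) b) //; last first.
  - by move=> m l; rewrite cvalue_zeta // zvalP.
  - exact: fus_zval.
  by apply: period_sum_parity => //; lia.
have lz k : (k <= p)%N -> linear (zeta k) by move=> /zeta_SLF [].
have lm k : (k <= p)%N -> linear (slf_mul (zeta k) (zeta b)).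
  by move=> kp; apply: slf_mul_linear => //; exact: lz.
suff H k n' j' : (k <= p)%N -> cvalue (slf_mul (zeta (p - k)) (zeta b)) n' j' =
    period_sum (fun k => zval k n' j') (p - k + b + 1).
  by rewrite -(subKn ap); apply: H; exact: leq_subr.
elim/nat_ind2: k n' j' => [n' j' _|n' j' _|k IH IH1 n' j' kp].
- by rewrite subn0.
- apply: (mulfI (_ : 2 != 0 :> C)); first by rewrite pnatr_eq0.
  rewrite -cvalueZ -slf_mulZl subn1 -chi2_mul_zetap chi_mulA //; last exact: lz.
  rewrite (cvalue_chi2_mul p_ge2); last exact: lm.
  rewrite (_ : cvalue _ = fun n j => period_sum (fun k => zval k n j) (p.-1 + b + 1).+1).
    exact: fusD.
  by apply/funext => m; apply/funext => l; rewrite base; congr period_sum; lia.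
have e : slf_mul (zeta (p - k.+2)) (zeta b) =
    slf_mul (chi false 2) (slf_mul (zeta (p - k.+1)) (zeta b)) - slf_mul (zeta (p - k)) (zeta b).
  rewrite -chi_mulA //; last by apply: lz; lia.
  have -> : (p - k.+1 = (p - k.+2).+1)%N by lia.
  rewrite chi2_mul_zeta; last by lia.
  have -> : ((p - k.+2).+2 = p - k)%N by lia.
  by rewrite slf_mulDl addrK.
rewrite e cvalueD cvalueN (cvalue_chi2_mul p_ge2); last by apply: lm; lia.
rewrite (_ : cvalue (slf_mul (zeta (p - k.+1)) (zeta b)) =
    fun n j => period_sum (fun k => zval k n j) (p - k.+2 + b + 1).+1); last first.
  by apply/funext => m; apply/funext => l; rewrite IH1; [congr period_sum; lia|lia].
rewrite fusD IH; last by lia.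
rewrite (_ : (p - k + b + 1 = (p - k.+2 + b + 1).+2)%N); last by lia.
by rewrite period_sumSS //; ring.
Qed.

Lemma zeta_mul_parity a a' b b' : (a <= p)%N -> (a' <= p)%N -> (b <= p)%N -> (b' <= p)%N ->
  odd a = odd a' -> odd b = odd b' ->
  slf_mul (zeta a) (zeta b) = slf_mul (zeta a') (zeta b').
Proof.
move=> ap ap' bp bp' oa ob.
apply: (slf_ext p_ge2) => [||n j _]; try by apply: slf_mul_SLF => //; exact: zeta_SLF.
rewrite !cvalue_zeta_mul //; apply: period_sum_parity; first by move=> k; exact: zvalP.
by rewrite !oddD oa ob.
Qed.

Definition gval k n j : C :=
  theta * ((q ^+ k - q ^- k) * (n%:R * cval k ^+ n.-1) * cyc k j).

Lemma gvalP k n j : gval (k + 2 * p) n j = gval k n j.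
Proof.
rewrite /gval cvalP exprD qpar_order // mulr1.
by rewrite (cyc_parity R p_ge2 (k := (k + 2 * p)%N) (l := k)) //; lia.
Qed.

Lemma gval_odd k l n j : (k + l = 6 * p)%N -> gval k n j = - gval l n j.
Proof.
move=> kl.
have e : q ^+ k = q ^- l.
  apply: (mulIf (qX0 l)); rewrite -exprD kl mulVf // (_ : 6 * p = 2 * p * 3)%N; last by lia.
  by rewrite exprM qpar_order // expr1n.
rewrite /gval (cyc_parity R p_ge2 (k := k) (l := l)); last by lia.
rewrite (_ : cval k = cval l); last by rewrite /cval e invrK addrC.
by rewrite e invrK; ring.
Qed.

(** The string of length $p$ sums [gval], which is odd under $k\mapsto -k$ modulo $2p$, over a full
    parity class. *)
Lemma zetap_mul_G b : (0 < b < p)%N -> slf_mul (zeta p) (G b) = 0.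
Proof.
move=> bp; have bp' : (b <= p)%N by lia.
pose d := q ^+ b - q ^- b.
have d0 : d != 0 by rewrite /d -(qintE R p_ge2) mulf_neq0 ?qint_den_neq0 ?qint_neq0.
apply: (scalerI d0); rewrite scaler0 -slf_mulZr zeta_p.
have sG : SLF (d *: G b) by apply: SLF_scale; exact: Gform_SLF.
apply: (slf_ext p_ge2) => [||n j _].
- by apply: slf_mul_SLF => //; exact: chi_SLF.
- exact: SLF0.
rewrite (@chi_iter gval (d *: G b) b) //.
- apply: (@period_sum_odd (fun k => gval k n j) (b + 2 * p + 1 - p)); last by lia.
    by move=> k; exact: gvalP.
  by move=> k l; exact: gval_odd.
- move=> k m l; rewrite /gval fus_scale (fus_gval R p_ge2); ring.
- by move=> m l; rewrite val_G_all // -/(gval b m l) gvalP.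
Qed.

Lemma zeta_mul_G a b : (a <= p)%N -> (0 < b < p)%N -> slf_mul (zeta a) (G b) = 0.
Proof.
move=> ap bp; have [lG _] := Gform_SLF R p_ge2 b.
have lz k : (k <= p)%N -> linear (zeta k) by move=> /zeta_SLF [].
suff H k : (k <= p)%N -> slf_mul (zeta (p - k)) (G b) = 0.
  by rewrite -(subKn ap); apply: H; exact: leq_subr.
elim/nat_ind2: k => [_|_|k IH IH1 kp].
- by rewrite subn0 zetap_mul_G.
- apply: (scalerI (_ : 2 != 0 :> C)); first by rewrite pnatr_eq0.
  rewrite scaler0 -slf_mulZl subn1 -chi2_mul_zetap chi_mulA //; last exact: lz.
  by rewrite zetap_mul_G // slf_mul0r.
have -> : zeta (p - k.+2) = slf_mul (chi false 2) (zeta (p - k.+1)) - zeta (p - k).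
  have -> : (p - k.+1 = (p - k.+2).+1)%N by lia.
  rewrite chi2_mul_zeta; last by lia.
  by have -> : ((p - k.+2).+2 = p - k)%N; [lia|rewrite addrK].
rewrite slf_mulDl slf_mulNl chi_mulA //; last by apply: lz; lia.
rewrite IH1; last by lia.
by rewrite IH ?slf_mul0r ?subr0 //; lia.
Qed.

Lemma zeta_omega s : (s <= p)%N -> zeta s \o om = zeta s.
Proof.
move=> sp; have h1 := chi_omega R p_ge2 false sp.
have h2 := chi_omega R p_ge2 true (leq_subr s p).
by rewrite /zeta -{2}h1 -{2}h2.
Qed.

Lemma G_mul_zeta a b : (a <= p)%N -> (0 < b < p)%N -> slf_mul (G b) (zeta a) = 0.
Proof.
move=> ap bp; rewrite -(slf_mulC p_ge2 (zeta_SLF ap) (Gform_SLF R p_ge2 b)).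
- exact: zeta_mul_G.
- exact: zeta_omega.
- exact: G_omega.
by rewrite zeta_mul_G.
Qed.

End Zeta.

(** * The products of the forms G *)

Section PolynomialVanishing.
Variable F : fieldType.

(** Roots counted with multiplicity: simple on [B], at least double on [B']. *)
Lemma double_roots_eq0 (u : {poly F}) (B B' : seq F) : uniq B -> uniq B' ->
  {subset B' <= B} -> all (root u) B -> all (root u^`()) B' ->
  (size u <= size B + size B')%N -> u = 0.
Proof.
move=> uB uB' sub ru rd su.
have : \prod_(z <- B) ('X - z%:P) %| u by rewrite uniq_roots_dvdp ?uniq_rootsE.
case/dvdpP => v uE; rewrite {}uE in ru rd su *.
suff -> : v = 0 by rewrite mul0r.
apply: (@roots_geq_poly_eq0 _ v B') => //.
  apply/allP => y yB'; move/allP/(_ y yB'): rd.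
  rewrite /root derivM !hornerE; set P := \prod_(_ <- _) _.
  have Py : P.[y] = 0 by apply/eqP; rewrite -/(root P y) root_prod_XsubC sub.
  (* [P] has simple roots, so $(vP)'(y)=v(y)P'(y)$ and [y] is a root of [v] as well. *)
  have P'y : P^`().[y] != 0.
    have : separable_poly P by rewrite separable_prod_XsubC.
    by rewrite unlock => sep; apply: coprimep_root sep _; rewrite /root Py.
  by rewrite Py mulr0 add0r mulf_eq0 (negPf P'y) orbF.
have [->|v0] := eqVneq v 0; first by rewrite size_poly0.
rewrite size_Mmonic ?monic_prod_XsubC // size_prod_XsubC addnS /= in su.
by rewrite addnC leq_add2l in su.
Qed.

(* A bivariate polynomial [tau = \sum P (x) Q] of total degree at most [n]. If
   [tau - k] vanishes to second order in the second variable on [A * B], then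
   [tau x] is constant for [x] in [A], so the coefficients of the high powers
   of the second variable, which are polynomials of low degree in the first
   one, vanish; what remains of the derivative in the first variable has too
   many roots in the second one. *)
Lemma mixed_derivative_eq0 (r : seq ({poly F} * {poly F})) n (A B B' : seq F) (k c c' : F) :
  uniq A -> uniq B -> uniq B' -> {subset B' <= B} -> (0 < size B)%N ->
  (n < size A + size B)%N -> (n < size B + size B')%N ->
  (forall PQ : {poly F} * {poly F}, PQ \in r -> size PQ.1 + size PQ.2 <= n.+2)%N ->
  {in A & B, forall x y, \sum_(PQ <- r) PQ.1.[x] * PQ.2.[y] = k} ->
  {in A & B', forall x y, \sum_(PQ <- r) PQ.1.[x] * PQ.2^`().[y] = 0} ->
  {in B, forall y, \sum_(PQ <- r) PQ.1^`().[c] * PQ.2.[y] = 0} ->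
  \sum_(PQ <- r) PQ.1^`().[c] * PQ.2^`().[c'] = 0.
Proof.
move=> uA uB uB' sB B0 nAB nBB sz HAB HAB' HB.
have szsum (f : {poly F} * {poly F} -> {poly F}) m :
    (forall PQ, PQ \in r -> (size (f PQ) <= m)%N) -> (size (\sum_(PQ <- r) f PQ)%R <= m)%N.
  move=> H; apply: leq_trans (size_sum _ _ _) _; apply/bigmax_leqP_seq => PQ PQr _.
  exact: H.
have constA x : x \in A -> \sum_(PQ <- r) PQ.1.[x] *: PQ.2 = k%:P.
  move=> xA; apply/eqP; rewrite -subr_eq0; apply/eqP.
  apply: (@double_roots_eq0 _ B B') => //.
  - apply/allP => y yB; rewrite /root hornerD hornerN hornerC horner_sum.
    under eq_bigr => PQ _ do rewrite hornerZ.
    by rewrite HAB // subrr.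
  - apply/allP => y yB; rewrite /root derivB derivC subr0 raddf_sum horner_sum /=.
    under eq_bigr => PQ _ do rewrite derivZ hornerZ.
    by rewrite HAB'.
  apply: leq_trans nBB; apply: leq_trans (size_polyD _ _) _.
  rewrite size_polyN geq_max; apply/andP; split; last first.
    by apply: leq_trans (size_polyC_leq1 _) _.
  apply: szsum => PQ PQr; have [->|nz] := eqVneq PQ.1 0.
    by rewrite horner0 scale0r size_poly0.
  apply: leq_trans (size_scale_leq _ _) _.
  have := sz _ PQr; have : (0 < size PQ.1)%N by rewrite size_poly_gt0.
  by move: (size PQ.1) (size PQ.2) => a b; lia.
(* The coefficient of the [b]-th power of the second variable, of size at most [n.+1 - b] in the
   first one. *)
pose t b := \sum_(PQ <- r) PQ.2`_b *: PQ.1.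
have t0 b : (0 < b)%N -> (n.+1 - b <= size A)%N -> t b = 0.
  move=> b0 bA; apply: (@roots_geq_poly_eq0 _ _ A) => //.
    apply/allP => x xA; rewrite /root horner_sum.
    have /(congr1 (fun u : {poly F} => u`_b)) := constA x xA.
    rewrite coefC (gtn_eqF b0) coef_sum => e.
    apply/eqP; rewrite -[RHS]e; apply: eq_bigr => PQ _.
    by rewrite hornerZ coefZ mulrC.
  apply: leq_trans bA; apply: szsum => PQ PQr.
  have [Qb|Qb] := leqP (size PQ.2) b.
    by rewrite (nth_default 0 Qb) scale0r size_poly0.
  apply: leq_trans (size_scale_leq _ _) _.
  by have := sz _ PQr; move: Qb; move: (size PQ.1) (size PQ.2) => a a'; lia.
pose w := \sum_(PQ <- r) PQ.1^`().[c] *: PQ.2.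
have w0 : w = 0.
  apply: (@roots_geq_poly_eq0 _ _ B) => //.
    apply/allP => y yB; rewrite /root horner_sum.
    under eq_bigr => PQ _ do rewrite hornerZ.
    by rewrite HB.
  apply/leq_sizeP => b Bb; rewrite coef_sum.
  have tb : t b = 0.
    by apply: t0; move: Bb B0 nAB; move: (size A) (size B) => x y; lia.
  have /(congr1 (fun u : {poly F} => u^`().[c])) := tb.
  rewrite /t raddf_sum horner_sum deriv0 horner0 => e; rewrite -[RHS]e.
  by apply: eq_bigr => PQ _ /=; rewrite derivZ hornerZ coefZ mulrC.
have /(congr1 (fun u : {poly F} => u^`().[c'])) := w0.
rewrite /w raddf_sum horner_sum deriv0 horner0 => e; rewrite -[RHS]e.
by apply: eq_bigr => PQ _ /=; rewrite derivZ hornerZ.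
Qed.

End PolynomialVanishing.

(** * Symbols of the coproduct and the vanishing of products of forms G *)

Section ProductOfG.
Variables (R : realType) (p : nat).
Hypothesis p_ge2 : (2 <= p)%N.
Local Notation C := R[i].
Local Notation q := (qpar R p).
Local Notation Uq := (palg (@uq_rel R p)).
Local Notation UU := (tens Uq Uq).
Local Notation Delta := (@uqDelta R p).
Local Notation E := (uE R p).
Local Notation F := (uF R p).
Local Notation K := (uK R p).
Local Notation Ki := (uKi R p).
Local Notation cas := (cas R p).
Local Notation theta := (theta R p).
Local Notation cval := (cval R p).
Local Notation cyc := (@cyc R p).
Local Notation G := (Gform R p).
Local Notation zeta := (@zeta R p).

(** Each term of $\Delta(c)$ has total degree at most 2, so $\Delta(c^nK^j)$ has degree at most
    $2n$. As $c$ counts for 2, this becomes total degree $n$ in the two Casimir values. *)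
Definition tens_le n : UU -> Prop :=
  lspan (fun t => exists (x y : Uq) d d', [/\ nform d x, nform d' y,
    (d + d' <= 2 * n)%N & t = tpure x y]).

Lemma tens_le_pure n d d' x y : nform d x -> nform d' y -> (d + d' <= 2 * n)%N ->
  tens_le n (tpure x y).
Proof. by move=> nx ny dd; apply: lspan_gen; exists x, y, d, d'. Qed.

Lemma Delta_cas : Delta cas = theta *: (tpure F E + tpure (F * E) K + tpure Ki (F * E)
    + tpure (Ki * E) (F * K)) + q *: tpure K K + q^-1 *: tpure Ki Ki.
Proof.
rewrite /cas !DeltaD // !DeltaZ // DeltaM // DeltaE // DeltaF // DeltaK //.
rewrite /uKi DeltaKX // /DE /DF -/(uKi R p) !(mulrDl, mulrDr) !tpureM !mul1r !mulr1.
by congr (_ *: _ + _ + _); rewrite -!addrA; congr (_ + _); rewrite addrCA.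
Qed.

Lemma tens_le_cas n t : tens_le n t -> tens_le n.+1 (Delta cas * t).
Proof.
apply: lspan_map => [a x y|m [x [y [d [d' [nx ny dd ->]]]]]].
  by rewrite mulrDr -tens_scaleAr.
rewrite Delta_cas !(mulrDl, mulrDr) -!tens_scaleAl !(mulrDl, mulrDr) !tpureM.
have KX z e : nform e z -> nform e (Ki * z) by exact: nform_KXl.
apply: lspan_add; last first.
  by apply/lspan_scale/(tens_le_pure (KX _ _ nx) (KX _ _ ny)); lia.
apply: lspan_add; last first.
  by apply/lspan_scale/(tens_le_pure (nform_Kl p_ge2 nx) (nform_Kl p_ge2 ny)); lia.
apply: lspan_scale; rewrite -!mulrA; apply: lspan_add; last first.
  by apply: (tens_le_pure (KX _ _ (nform_El p_ge2 nx)) (nform_Fl p_ge2 (nform_Kl p_ge2 ny))); lia.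
apply: lspan_add; last first.
  by apply: (tens_le_pure (KX _ _ nx) (nform_Fl p_ge2 (nform_El p_ge2 ny))); lia.
apply: lspan_add.
  by apply: (tens_le_pure (nform_Fl p_ge2 nx) (nform_El p_ge2 ny)); lia.
by apply: (tens_le_pure (nform_Fl p_ge2 (nform_El p_ge2 nx)) (nform_Kl p_ge2 ny)); lia.
Qed.

Lemma tens_le_casX n j : tens_le n (Delta (cas ^+ n * K ^+ j)).
Proof.
elim: n => [|n IH]; last by rewrite exprS -mulrA DeltaM //; exact: tens_le_cas.
have nK : nform 0 (K ^+ j).
  by have := @nform_mon R p 0 0 j 0 true (leqnn _); rewrite !expr0 mul1r mulr1.
by rewrite expr0 mul1r DeltaKX //; exact: (tens_le_pure nK nK).
Qed.

(* On the forms [zeta a] and [G a] with [a] of fixed parity, an element acts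
   through a polynomial in the value [cval a] of the Casimir element, and
   through the derivative of this polynomial, respectively. *)
Definition symbol (e : bool) (x : Uq) (P : {poly C}) : Prop :=
  (forall a, (a <= p)%N -> odd a = e -> zeta a x = P.[cval a]) /\
  (forall a, (0 < a < p)%N -> odd a = e -> G a x = theta * P^`().[cval a]).

Lemma symbol_exists e d x : nform d x ->
  exists2 P, symbol e x P & (size P <= d./2.+1)%N.
Proof.
elim=> [|c m0 {}x [a [l [w [b [ad ->]]]]] _ [P [Pz PG] szP]].
  exists 0; last by rewrite size_poly0.
  split=> a ap _; first by have [lz _] := zeta_SLF R p_ge2 ap; rewrite lin0 // horner0.
  by have [lG _] := Gform_SLF R p_ge2 a; rewrite lin0 // deriv0 horner0 mulr0.
set m := cas ^+ a * _.
have [Q [Qz QG] szQ] : exists2 Q, symbol e m Q & (size Q <= d./2.+1)%N.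
  case: w ad @m => [|w] ad m; last first.
    exists 0; last by rewrite size_poly0.
    split=> k kp _; rewrite slf_mon ?horner0 ?deriv0 ?horner0 ?mulr0 //.
      exact: zeta_SLF.
    exact: Gform_SLF.
  have mE : m = cas ^+ a * K ^+ l by rewrite /m expr0 mulr1.
  exists (cyc e l *: 'X^a).
    have cycE k : odd k = e -> cyc k l = cyc e l.
      by move=> ke; apply: cyc_parity => //; rewrite ke; case: (e).
    split=> k kp ke; rewrite mE -/(cvalue _ a l).
      by rewrite cvalue_zeta // /zval hornerZ hornerXn cycE // mulrC.
    rewrite val_G // wsum_cyc //; last by lia.
    by rewrite derivZ derivXn hornerZ hornerMn hornerXn cycE // -mulr_natl; ring.
  apply: leq_trans (size_scale_leq _ _) _; rewrite size_polyXn ltnS.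
  by rewrite geq_half_double -mul2n; lia.
exists (c *: Q + P).
  split=> k kp ke.
    have [lz _] := zeta_SLF R p_ge2 kp.
    by rewrite (linD lz) (linZ lz) hornerD hornerZ -Qz // -Pz.
  have [lG _] := Gform_SLF R p_ge2 k.
  by rewrite (linD lG) (linZ lG) derivD derivZ hornerD hornerZ QG // PG // /GRing.scale /=; ring.
apply: leq_trans (size_polyD _ _) _; rewrite geq_max szP andbT.
exact: leq_trans (size_scale_leq _ _) szQ.
Qed.

(** The polynomial [r] is chosen before [f] and [g]: one bivariate polynomial must serve all four
    combinations of [zeta] and [G]. *)
Lemma symbols_exist e e' n t : tens_le n t ->
  exists2 r : seq ({poly C} * {poly C}),
    (forall PQ : {poly C} * {poly C}, PQ \in r -> size PQ.1 + size PQ.2 <= n.+2)%N &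
    forall (f g : Uq -> C^o) (u v : {poly C} -> C), linear f -> linear g ->
      (forall x P, symbol e x P -> f x = u P) -> (forall x P, symbol e' x P -> g x = v P) ->
      linear (u : {poly C} -> C^o) ->
      tens_eval (fun x y => f x * g y : C^o) t = \sum_(PQ <- r) u PQ.1 * v PQ.2.
Proof.
elim=> [|c m {}t [x [y [d [d' [nx ny dd ->]]]]] _ [r szr IH]].
  exists [::] => // f g u v lf lg _ _ _.
  by rewrite big_nil lin0 //; apply: tens_eval_linear; exact: bilin_forms.
have [P sP szP] := symbol_exists e nx; have [Q sQ szQ] := symbol_exists e' ny.
exists ((c *: P, Q) :: r).
  move=> PQ; rewrite inE => /predU1P[->|]; last exact: szr.
  have := size_scale_leq c P; rewrite /=.
  have : (d./2 + d'./2 <= n)%N by lia.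
  move: szP szQ; move: (size (c *: P)) (size P) (size Q) (d./2) (d'./2) => x1 x2 x3 x4 x5.
  by lia.
move=> f g u v lf lg fu gv lu; have bfg := bilin_forms lf lg.
rewrite big_cons /= (tens_evalD bfg) (tens_evalZ bfg) tens_eval_pure // (IH f g u v) //.
by rewrite (fu _ _ sP) (gv _ _ sQ) (linZ lu) /GRing.scale /= mulrA.
Qed.

(** The endpoints $a=0,p$ give values of [zeta] without a derivative condition. Hence [points e] and
    [inner_points e] have together $p$ entries, one more than the largest $n$ to be treated. *)
Definition points (e : bool) : seq C := [seq cval a | a <- iota 0 p.+1 & odd a == e].
Definition inner_points (e : bool) : seq C := [seq cval a | a <- iota 1 p.-1 & odd a == e].

Lemma cval_uniq s : uniq s -> {in s, forall a, (a <= p)%N} -> uniq [seq cval a | a <- s].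
Proof.
move=> us sp; rewrite map_inj_in_uniq // => a b /sp ap /sp bp /eqP e.
case: (ltngtP a b) e => // ab; last rewrite eq_sym.
  by rewrite (negPf (cval_inj R p_ge2 (m := a) (n := b) _)) // ab.
by rewrite (negPf (cval_inj R p_ge2 (m := b) (n := a) _)) // ab.
Qed.

Lemma size_parity e m k : size [seq a <- iota m k | odd a == e] =
  if odd m == e then uphalf k else k./2.
Proof.
elim: k m => [|k IH] m /=; first by case: ifP.
case: eqP => [me|me] /=; rewrite IH /=.
  by rewrite -me; case: (odd m) => /=; lia.
have -> : ~~ odd m == e by case: (odd m) (e) me => [] [].
by lia.
Qed.

Lemma points_uniq e : uniq (points e).
Proof.
apply: cval_uniq; first by rewrite filter_uniq // iota_uniq.
by move=> a; rewrite mem_filter mem_iota => /andP[_]; lia.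
Qed.

Lemma inner_points_uniq e : uniq (inner_points e).
Proof.
apply: cval_uniq; first by rewrite filter_uniq // iota_uniq.
by move=> a; rewrite mem_filter mem_iota => /andP[_]; lia.
Qed.

Lemma pointsP e x : x \in points e -> exists a, [/\ (a <= p)%N, odd a = e & x = cval a].
Proof.
case/mapP => a; rewrite mem_filter mem_iota => /andP[/eqP oa ap] ->.
by exists a; split=> //; lia.
Qed.

Lemma inner_pointsP e x : x \in inner_points e ->
  exists a, [/\ (0 < a < p)%N, odd a = e & x = cval a].
Proof.
case/mapP => a; rewrite mem_filter mem_iota => /andP[/eqP oa ap] ->.
by exists a; split=> //; lia.
Qed.

Lemma inner_points_sub e : {subset inner_points e <= points e}.
Proof.
move=> x /inner_pointsP[a [ap ae ->]]; apply: map_f.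
by rewrite mem_filter ae eqxx mem_iota; lia.
Qed.

Lemma G_mul_G s t : (0 < s < p)%N -> (0 < t < p)%N -> slf_mul (G s) (G t) = 0.
Proof.
move=> sp tp; have sG k : SLF (G k) by exact: Gform_SLF.
have sz k : (k <= p)%N -> SLF (zeta k) by move=> kp; exact: zeta_SLF.
apply: (slf_ext p_ge2) => [||n j np]; [exact: slf_mul_SLF|exact: SLF0|].
have [r szr ev] := symbols_exist (odd s) (odd t) (tens_le_casX n j).
have lin_ev (x : C) : linear ((fun P => P.[x]) : {poly C} -> C^o).
  by move=> a P Q; rewrite hornerD hornerZ.
have lin_der (x : C) : linear ((fun P => theta * P^`().[x]) : {poly C} -> C^o).
  by move=> a P Q; rewrite derivD derivZ hornerD hornerZ /GRing.scale /=; ring.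
have [lGs _] := sG s; have [lGt _] := sG t.
rewrite [RHS]/(0 : C) /cvalue /slf_mul.
rewrite (ev _ _ (fun P => theta * P^`().[cval s]) (fun P => theta * P^`().[cval t])) //;
  try by move=> x P [_ H]; exact: H.
under eq_bigr => PQ _ do rewrite mulrACA.
rewrite -mulr_sumr (_ : \sum_(_ <- _) _ = 0) ?mulr0 //.
have t_nz := theta_neq0 R p_ge2.
apply: (@mixed_derivative_eq0 _ r n (points (odd s)) (points (odd t)) (inner_points (odd t))
  (cvalue (slf_mul (zeta s) (zeta t)) n j)) => //.
- exact: points_uniq.
- exact: points_uniq.
- exact: inner_points_uniq.
- exact: inner_points_sub.
- by rewrite size_map size_parity; case: ifP => _ /=; lia.
- by rewrite !size_map !size_parity; do 2 case: ifP => _ /=; lia.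
- by rewrite !size_map !size_parity /=; case: (odd t) => /=; lia.
- move=> x y /pointsP[a [ap ae ->]] /pointsP[b [bp be ->]].
  rewrite -(@zeta_mul_parity R p p_ge2 a s b t) //; try lia.
  have [lza _] := sz a ap; have [lzb _] := sz b bp.
  rewrite /cvalue /slf_mul (ev _ _ (fun P => P.[cval a]) (fun P => P.[cval b])) //;
    by move=> z P [H _]; exact: H.
- move=> x y /pointsP[a [ap ae ->]] /inner_pointsP[b [bp be ->]].
  have [lza _] := sz a ap; have [lGb _] := sG b.
  have : cvalue (slf_mul (zeta a) (G b)) n j = 0 by rewrite zeta_mul_G.
  rewrite /cvalue /slf_mul.
  rewrite (ev _ _ (fun P => P.[cval a]) (fun P => theta * P^`().[cval b])) //;
    try by move=> z P [H1 H2]; first [exact: H1|exact: H2].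
  under eq_bigr => PQ _ do rewrite mulrCA.
  by rewrite -mulr_sumr => /eqP; rewrite mulf_eq0 (negPf t_nz) /= => /eqP.
move=> y /pointsP[b [bp be ->]].
have [lzb _] := sz b bp.
have : cvalue (slf_mul (G s) (zeta b)) n j = 0 by rewrite G_mul_zeta.
rewrite /cvalue /slf_mul.
rewrite (ev _ _ (fun P => theta * P^`().[cval s]) (fun P => P.[cval b])) //;
  try by move=> z P [H1 H2]; first [exact: H1|exact: H2].
under eq_bigr => PQ _ do rewrite -mulrA.
by rewrite -mulr_sumr => /eqP; rewrite mulf_eq0 (negPf t_nz) /= => /eqP.
Qed.

End ProductOfG.

(** * Deduction of all products *)

Section Deduction.
Variables (R : realType) (p : nat).
Hypothesis p_ge2 : (2 <= p)%N.
Local Notation C := R[i].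
Local Notation qn := (qint R p).
Local Notation Uq := (palg (@uq_rel R p)).
Local Notation om := (@omega R p).
Local Notation chi := (chi R p).
Local Notation G := (Gform R p).
Local Notation elt := (slf_elt R p).
Local Notation Q := (palg (@slf_rule R p)).
Local Notation cls := (pcls (@slf_rule R p)).
Local Notation X a s := (cls (tchi R a s)).
Local Notation Y s := (cls (tG R p s)).

Lemma chi2_mul_G1 : slf_mul (chi false 2) (G 1) = qn 2 *: G 2.
Proof.
have := chi2_mul_G_qint R p_ge2 (s := 1); rewrite qint1 // scale1r => -> /=; last by lia.
by rewrite qint0 scale0r add0r.
Qed.

Lemma chi2_mul_G_mid s : (0 < s < p)%N -> slf_mul (chi false 2) (G s) =
  (qn s.-1 / qn s) *: G s.-1 + (qn s.+1 / qn s) *: G s.+1.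
Proof.
move=> sp; have s0 := qint_neq0 R p_ge2 sp; apply: (scalerI s0).
by rewrite chi2_mul_G_qint // scalerDr !scalerA ![qn s * _]mulrC !divfK.
Qed.

Lemma chi2_mul_Gp : slf_mul (chi false 2) (G p.-1) = qn 2 *: G (p - 2).
Proof.
have pp : (0 < p.-1 < p)%N by lia.
have q1 : qn p.-1 = 1 by rewrite -subn1 qint_sub ?qint1 //; lia.
have := chi2_mul_G_qint R p_ge2 pp; rewrite q1 scale1r => ->.
have -> : p.-1.+1 = p by lia.
have -> : p.-1.-1 = (p - 2)%N by lia.
by rewrite qintp // scale0r addr0 qint_sub.
Qed.

Lemma cls_rule s t : @slf_rule R p s t -> cls s = cls t.
Proof. by move=> st; apply/palgP/alg_eq_rel. Qed.

Lemma cls_comm (u v : Q) : u * v = v * u.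
Proof.
by elim/palg_ind: u => s; elim/palg_ind: v => t; rewrite -!pcls_Mul; exact/cls_rule/slf_comm.
Qed.

Lemma cls_unit : X false 1 = 1.
Proof. by rewrite (cls_rule (slf_unit _ _)) pcls_Cst scale1r. Qed.

Lemma tG_out s : ~~ (0 < s < p)%N -> Y s = 0.
Proof. by rewrite /tG => /negPf ->; rewrite pcls_Cst scale0r. Qed.

Lemma cls_G s : (0 < s < p)%N -> cls (Gen (inr s)) = Y s.
Proof. by move=> sp; rewrite /tG sp. Qed.

Lemma slf_basis_uniq : uniq (slf_basis p).
Proof.
rewrite cat_uniq allpairs_uniq ?iota_uniq //; last by case=> [a s] [b t] _ _ /= [-> ->].
rewrite map_inj_uniq ?iota_uniq ?andbT; last by move=> s t [].
rewrite andTb.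
by apply/hasPn => x /mapP[s _ ->]; apply/negP => /allpairsPdep[a [t [_ _]]].
Qed.

Lemma mem_basis_chi a s : (inl (a, s) \in slf_basis p) = (1 <= s <= p)%N.
Proof.
rewrite mem_cat; apply/orP/idP => [[/allpairsPdep[b [t [_]]]|/mapP[t _] //]|sp].
  by rewrite mem_iota => tp [_ ->]; lia.
left; apply/allpairsPdep; exists a, s; split=> //; first by case: a.
by rewrite mem_iota; lia.
Qed.

Lemma mem_basis_G s : (inr s \in slf_basis p) = (0 < s < p)%N.
Proof.
rewrite mem_cat; apply/orP/idP => [[/allpairsPdep[b [t [_ _]]] //|/mapP[t]]|sp].
  by rewrite mem_iota => tp [->]; lia.
by right; apply/mapP; exists s => //; rewrite mem_iota; lia.
Qed.

(** One coefficient vector for a class in the algebra of the rules and for a form, as the last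
    clause of the theorem demands. *)
Definition same_coords (t : Q) (f : Uq -> C^o) : Prop :=
  exists c : slf_gen -> C, f = \sum_(k <- slf_basis p) c k *: elt k /\
    t = \sum_(k <- slf_basis p) c k *: cls (Gen k).

Lemma same_coords0 : same_coords 0 0.
Proof. by exists (fun=> 0); split; rewrite big1 // => k _; rewrite scale0r. Qed.

Lemma same_coordsD t f u g : same_coords t f -> same_coords u g -> same_coords (t + u) (f + g).
Proof.
move=> [c [-> ->]] [d [-> ->]]; exists (fun k => c k + d k).
by split; rewrite -big_split; apply: eq_bigr => k _; rewrite scalerDl.
Qed.

Lemma same_coordsZ a t f : same_coords t f -> same_coords (a *: t) (a *: f).
Proof.
move=> [c [-> ->]]; exists (fun k => a * c k).
by split; rewrite scaler_sumr; apply: eq_bigr => k _; rewrite scalerA.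
Qed.

Lemma same_coordsB t f u g : same_coords t f -> same_coords u g -> same_coords (t - u) (f - g).
Proof.
by move=> tf ug; rewrite -(scaleN1r u) -(scaleN1r g); apply: same_coordsD => //; apply: same_coordsZ.
Qed.

Lemma same_coords_gen k : k \in slf_basis p -> same_coords (cls (Gen k)) (elt k).
Proof.
move=> kb; have H (V : lmodType C) (f : slf_gen -> V) :
    f k = \sum_(j <- slf_basis p) (j == k)%:R *: f j.
  rewrite (bigD1_seq k) ?slf_basis_uniq //= eqxx scale1r big1 ?addr0 // => j /negPf ->.
  by rewrite scale0r.
exists (fun j => (j == k)%:R); split; first exact: (H _ elt).
exact: (H _ (fun j => cls (Gen j))).
Qed.

Lemma same_coords_chi a s : (1 <= s <= p)%N -> same_coords (X a s) (chi a s).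
Proof. by move=> sp; apply: (@same_coords_gen (inl (a, s))); rewrite mem_basis_chi. Qed.

Lemma same_coords_G s : same_coords (Y s) (G s).
Proof.
have [sp|nsp] := boolP (0 < s < p)%N.
  by rewrite /tG sp; apply: (@same_coords_gen (inr s)); rewrite mem_basis_G.
by rewrite tG_out // /Gform (negPf nsp); exact: same_coords0.
Qed.

Lemma basisP (P : slf_gen -> Prop) :
  (forall a s, (1 <= s <= p)%N -> P (inl (a, s))) -> (forall s, (0 < s < p)%N -> P (inr s)) ->
  forall k, k \in slf_basis p -> P k.
Proof.
move=> Pc PG [[a s]|s]; first by rewrite mem_basis_chi; exact: Pc.
by rewrite mem_basis_G; exact: PG.
Qed.

Lemma same_coords_SLF t f : same_coords t f -> SLF f.
Proof.
move=> [c [-> _]]; rewrite big_seq_cond; elim/big_ind: _ => [||k]; [exact: SLF0|exact: SLF_add|].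
rewrite andbT => kb; apply: SLF_scale; elim/basisP: k / kb => [a s sp|s sp].
  by apply: chi_SLF => //; lia.
exact: Gform_SLF.
Qed.

Lemma same_coords_omega t f : same_coords t f -> f \o om = f.
Proof.
move=> [c [-> _]]; rewrite big_seq_cond.
elim/big_ind: _ => [//|g h gE hE|k]; first by rewrite -{2}gE -{2}hE.
rewrite andbT => kb.
suff e : elt k \o om = elt k by rewrite -{2}e.
elim/basisP: k / kb => [a s sp|s sp]; last exact: G_omega.
by apply: chi_omega => //; lia.
Qed.

Lemma same_coords_mul (u : Q) (g : Uq -> C^o) t f :
  (forall k, k \in slf_basis p -> same_coords (u * cls (Gen k)) (slf_mul g (elt k))) ->
  same_coords t f -> same_coords (u * t) (slf_mul g f).
Proof.
move=> H [c [-> ->]]; rewrite slf_mul_sumr mulr_sumr big_seq_cond.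
rewrite [Z in same_coords _ Z]big_seq_cond.
elim/big_ind2: _ => [|t1 f1 t2 f2 h1 h2|k]; [exact: same_coords0|exact: same_coordsD|].
rewrite andbT => kb; rewrite slf_mulZr -palg_scaleAr.
by apply: same_coordsZ; exact: H.
Qed.

Lemma same_coords_chi2 t f : same_coords t f ->
  same_coords (X false 2 * t) (slf_mul (chi false 2) f).
Proof.
apply: same_coords_mul; apply: basisP => [a s sp|s sp] /=.
  have [->|s1] := eqVneq s 1%N.
    rewrite chi2_mul_chi // chi0 add0r.
    have -> : X false 2 * X a 1 = X a 2.
      case: a; last by rewrite cls_unit mulr1.
      (* Commutativity turns this product into $\chi^-_1\chi^+_2$, to which a rule applies. *)
      by rewrite cls_comm -pcls_Mul (cls_rule (slf_chi1_chi _ _ _)) //; lia.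
    by apply: same_coords_chi; lia.
  have [->|sp'] := eqVneq s p.
    rewrite chi2_mul_chip // -pcls_Mul (cls_rule (slf_chi2_chip _ _ _)) pcls_Add !pcls_CstM.
    by apply: same_coordsD; apply: same_coordsZ; apply: same_coords_chi; lia.
  rewrite -pcls_Mul (cls_rule (slf_chi2_chi _ _ _)) ?pcls_Add; last by lia.
  have -> : slf_mul (chi false 2) (chi a s) = chi a s.-1 + chi a s.+1.
    by case: s sp s1 sp' => [|[|s]] // *; rewrite chi2_mul_chi //; lia.
  by apply: same_coordsD; apply: same_coords_chi; lia.
rewrite cls_G //; have [->|s1] := eqVneq s 1%N.
  rewrite chi2_mul_G1 -pcls_Mul (cls_rule (slf_chi2_G1 _ _)) pcls_CstM.
  by apply: same_coordsZ; exact: same_coords_G.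
have [->|sp'] := eqVneq s p.-1.
  rewrite chi2_mul_Gp -pcls_Mul (cls_rule (slf_chi2_Gp _ _)) pcls_CstM.
  by apply: same_coordsZ; exact: same_coords_G.
rewrite chi2_mul_G_mid // -pcls_Mul (cls_rule (slf_chi2_G _ _)); last by lia.
rewrite pcls_Add !pcls_CstM.
by apply: same_coordsD; apply: same_coordsZ; exact: same_coords_G.
Qed.

Lemma same_coords_chi1 t f : same_coords t f ->
  same_coords (X true 1 * t) (slf_mul (chi true 1) f).
Proof.
apply: same_coords_mul; apply: basisP => [a s sp|s sp] /=.
  rewrite chi1_mul_chi //; last by lia.
  rewrite -pcls_Mul (cls_rule (slf_chi1_chi _ _ _)) //; exact: same_coords_chi.
rewrite cls_G // chi1_mul_G // -pcls_Mul (cls_rule (slf_chi1_G _ _)); last by lia.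
rewrite pcls_CstM -(scaleN1r (G (p - s))); apply: same_coordsZ; exact: same_coords_G.
Qed.

Lemma same_coords_chi_mul a s t f : (1 <= s <= p)%N -> same_coords t f ->
  same_coords (X a s * t) (slf_mul (chi a s) f).
Proof.
move=> sp tf; have sf := same_coords_SLF tf; have [lf _] := sf.
have pos k : (1 <= k <= p)%N -> same_coords (X false k * t) (slf_mul (chi false k) f).
  elim/nat_ind2: k => [//|_|k IH IH1 kp]; first by rewrite cls_unit mul1r chi1_unit.
  case: k IH IH1 kp => [_ _ _|k IH IH1 kp]; first exact: same_coords_chi2.
  have -> : X false k.+3 = X false 2 * X false k.+2 - X false k.+1.
    rewrite -pcls_Mul (cls_rule (slf_chi2_chi _ _ _)) ?pcls_Add; last by lia.
    by rewrite addrC addKr.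
  have -> : chi false k.+3 = slf_mul (chi false 2) (chi false k.+2) - chi false k.+1.
    by rewrite chi2_mul_chi 1?addrC ?addKr //; lia.
  have [lc _] := chi_SLF R p_ge2 false (s := k.+2) (ltnW kp).
  rewrite mulrBl -mulrA slf_mulDl slf_mulNl chi_mulA //.
  apply: same_coordsB; last by apply: IH; lia.
  by apply: same_coords_chi2; apply: IH1; lia.
case: a; last exact: pos.
have -> : X true s = X true 1 * X false s.
  by rewrite -pcls_Mul (cls_rule (slf_chi1_chi _ _ _)).
have sp' : (s <= p)%N by lia.
have [lc _] := chi_SLF R p_ge2 false sp'.
have -> : chi true s = slf_mul (chi true 1) (chi false s) by rewrite chi1_mul_chi.
rewrite -mulrA chi_mulA //; last by lia.
by apply: same_coords_chi1; exact: pos.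
Qed.

Lemma same_coords_basis_mul x y : x \in slf_basis p -> y \in slf_basis p ->
  same_coords (cls (Gen x) * cls (Gen y)) (slf_mul (elt x) (elt y)).
Proof.
move=> xb yb; elim/basisP: x / xb => [a s sp|s sp].
  by apply: same_coords_chi_mul => //; exact: same_coords_gen.
elim/basisP: y / yb => [b u up|u up] /=.
  (* The product in the other order has coordinates, hence is fixed by [omega]; this is the last
     hypothesis of [slf_mulC]. *)
  have H : same_coords (X b u * Y s) (slf_mul (chi b u) (G s)).
    by apply: same_coords_chi_mul => //; exact: same_coords_G.
  have up' : (u <= p)%N by lia.
  rewrite cls_G // cls_comm.
  rewrite -(slf_mulC p_ge2 (chi_SLF R p_ge2 b up') (Gform_SLF R p_ge2 s)) //.
  - exact: chi_omega.
  - exact: G_omega.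
  - exact: same_coords_omega H.
rewrite G_mul_G // !cls_G // -pcls_Mul (cls_rule (slf_GG _ _ _)); try lia.
by rewrite pcls_Cst scale0r; exact: same_coords0.
Qed.

Lemma cls_sum (c : slf_gen -> C) s :
  cls (\big[@Add _ _/Cst 0]_(k <- s) Mul (Cst (c k)) (Gen k)) =
  \sum_(k <- s) c k *: cls (Gen k).
Proof.
elim: s => [|k s IH]; first by rewrite !big_nil pcls_Cst scale0r.
by rewrite !big_cons pcls_Add pcls_CstM IH.
Qed.

End Deduction.

Theorem theorem5p1 (R : realType) (p : nat) (p_ge2 : (2 <= p)%N) :
  ((forall (a : bool) (s : nat), (1 <= s <= p)%N -> SLF (chi R p a s)) /\
   (forall s : nat, (1 <= s <= p.-1)%N -> SLF (Gform R p s))) /\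
  [/\ slf_mul (chi R p false 2) (Gform R p 1) = qint R p 2 *: Gform R p 2,
      (forall s : nat, (2 <= s <= p - 2)%N ->
         slf_mul (chi R p false 2) (Gform R p s) =
           (qint R p s.-1 / qint R p s) *: Gform R p s.-1
           + (qint R p s.+1 / qint R p s) *: Gform R p s.+1),
      slf_mul (chi R p false 2) (Gform R p p.-1) =
        qint R p 2 *: Gform R p (p - 2),
      (forall s : nat, (1 <= s <= p.-1)%N ->
         slf_mul (chi R p true 1) (Gform R p s) = - Gform R p (p - s)) &
      (forall s t : nat, (1 <= s <= p.-1)%N -> (1 <= t <= p.-1)%N ->
         slf_mul (Gform R p s) (Gform R p t) = 0)] /\
  (forall x y : slf_gen, x \in slf_basis p -> y \in slf_basis p ->
     exists c : slf_gen -> R[i],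
       slf_mul (slf_elt R p x) (slf_elt R p y) =
         \sum_(k <- slf_basis p) c k *: slf_elt R p k /\
       slf_deducible R p (Mul (Gen x) (Gen y))
         (\big[@Add _ _/Cst 0]_(k <- slf_basis p) Mul (Cst (c k)) (Gen k))).
Proof.
split; first split.
- by move=> a s /andP[_ sp]; exact: chi_SLF.
- by move=> s _; exact: Gform_SLF.
split; first split.
- exact: chi2_mul_G1.
- by move=> s sp; apply: chi2_mul_G_mid => //; lia.
- exact: chi2_mul_Gp.
- by move=> s sp; apply: chi1_mul_G => //; lia.
- by move=> s t sp tp; apply: G_mul_G => //; lia.
move=> x y xb yb; have [c [e d]] := same_coords_basis_mul R p_ge2 xb yb.
by exists c; split=> //; apply/palgP; rewrite pcls_Mul d cls_sum.
Qed.
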